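(* Let $R$ be a countable Borel measure-preserving equivalence relation on a standard probability space $(X,\mu)$, and suppose $R$ does not contain singleton classes. Then $R$ is sofic if and only if $[R]$ is metrically sofic.
   Context: A standard probability space $(X,\mu)$ is a standard Borel space with a Borel probability measure. A countable Borel equivalence relation $R$ on $X$ is an equivalence relation that is Borel in $X\times X$ with all classes countable. $[[R]]_B$ is the set of Borel isomorphisms $g:\operatorname{dom}g\to\operatorname{ran}g$ between Borel subsets of $X$ with $(x,gx)\in R$ for all $x\in\operatorname{dom}g$; it is an inverse monoid under composition of partial maps. $R$ is measure-preserving if $\mu(g(A))=\mu(A)$ for all $g\in[[R]]_B$ and Borel $A\subseteq\operatorname{dom}g$. The full semigroup $[[R]]$ is the quotient of $[[R]]_B$ by the pseudometric $d_\mu(g,h)=\mu(\operatorname{dom}g\triangle\operatorname{dom}h)+\mu\{x\in\operatorname{dom}g\cap\operatorname{dom}h:gx\ne hx\}$. The full group $[R]$, with metric $d_\mu$, is the image in $[[R]]$ of those $g$ with $\operatorname{dom}g=\operatorname{ran}g=X$. For $N\in\mathbb{N}$, $[N]=\{0,\dots,N-1\}$ carries normalized counting measure $\mu_\#$, $[[N]]$ is the set of all partial bijections of $[N]$, $\mathfrak{S}_N\subseteq[[N]]$ is the permutation group, and $d_\#$ is the analogous metric defined with $\mu_\#$ (on $\mathfrak{S}_N$, the normalized Hamming distance). $R$ is sofic if for each finite $K\subseteq[[R]]$ and $\epsilon>0$ there exist $N\in\mathbb{N}$ and $\pi:[[R]]\to[[N]]$ with: (i) $\pi(\operatorname{id}_X)=1_{[N]}$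 and $\pi(\varnothing)=\varnothing$; (ii) $d_\#(\pi(\varphi\psi),\pi(\varphi)\pi(\psi))<\epsilon$ for all $\varphi,\psi\in K$; (iii) $|\mu\{x:\varphi(x)=x\}-\mu_\#\{m:\pi(\varphi)(m)=m\}|<\epsilon$ for all $\varphi\in K$. $\prod_{\mathcal{U}}\mathfrak{S}_{n_k}$ is the metric ultraproduct: the quotient of $\prod_k\mathfrak{S}_{n_k}$ by the pseudometric $d_{\mathcal{U}}((x_k),(y_k))=\lim_{k\to\mathcal{U}}d_\#(x_k,y_k)$, a group under coordinatewise product. $[R]$ is metrically sofic if there is an isometric group homomorphism from $[R]$ into $\prod_{\mathcal{U}}\mathfrak{S}_{n_k}$ for some free ultrafilter $\mathcal{U}$ on $\mathbb{N}$ and some sequence $(n_k)$ of positive integers. *)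

(* Defs.v *)
From HB Require Import structures.
From mathcomp Require Import all_boot all_order all_algebra all_fingroup.
From mathcomp Require Import all_classical all_reals all_analysis.

Set Implicit Arguments.
Unset Strict Implicit.
Unset Printing Implicit Defensive.

Import Order.TTheory GRing.Theory Num.Theory.
Import numFieldNormedType.Exports.

Local Open Scope classical_set_scope.
Local Open Scope ring_scope.

(* Borel isomorphic to a Polish space: [complete] together with [hausdorff_space]
   makes the pseudometric of [P] a complete metric. *)
Definition standard_borel (R : realType) (d : measure_display)
    (X : measurableType d) : Prop :=
  exists (P : completePseudoMetricType R) (f : X -> P),
    [/\ hausdorff_space P, @second_countable P, bijective f &
        forall B : set P,
          <<s [set U : set P | open U] >> B <-> measurable (f @^-1` B)].

(* A partial map is a total map into [option X], undefined where it is [None]. *)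
Section PartialBijections.
Variable X : Type.

Definition pinjective (f : X -> option X) : Prop :=
  forall x y z, f x = Some z -> f y = Some z -> x = y.

Record pbij := PBij { pbij_fun :> X -> option X; pbij_inj : pinjective pbij_fun }.

Implicit Types f g : X -> option X.

Definition pdom f : set X := [set x | f x].
Definition pimage f (A : set X) : set X :=
  [set y | exists2 x, A x & f x = Some y].
Definition ppreimage f (B : set X) : set X :=
  [set x | exists2 y, B y & f x = Some y].
Definition pran f : set X := pimage f setT.
Definition pfix f : set X := [set x | f x = Some x].
Definition pdisagree f g : set X :=
  [set x | [/\ pdom f x, pdom g x & f x <> g x]].

Lemma pinj_id : pinjective Some.
Proof. by move=> x y z [->] [->]. Qed.
Definition pbij_id := PBij pinj_id.

Lemma pinj_empty : pinjective (fun=> None).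
Proof. by []. Qed.
Definition pbij_empty := PBij pinj_empty.

Lemma pinj_comp (f g : pbij) : pinjective (pcomp f g).
Proof.
move=> x y z; rewrite /pcomp.
case gx: (g x) => [u|//]; case gy: (g y) => [v|//] /= fu fv.
have uv := pbij_inj fu fv; rewrite -uv in gy.
exact: pbij_inj gx gy.
Qed.
(* [pbij_comp f g] is [f] after [g]. *)
Definition pbij_comp (f g : pbij) := PBij (@pinj_comp f g).

Definition pdist (R : realType) (m : set X -> R) f g : R :=
  m (pdom f `+` pdom g) + m (pdisagree f g).

End PartialBijections.

(* The points are the classes [{y | D x y = 0}]. Operations on classes are
   computed on the representative [mrepr]; for [d_mu] this is independent of the
   choice because on a standard Borel space the sets where two Borel maps differ
   are measurable, and because the measure is preserved. *)
Section PseudometricQuotient.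
Variables (R : realType) (T : Type) (D : T -> T -> R).

Record mquot := MQuot {
  mqset : set T;
  mqsetP : exists x, mqset = [set y | D x y = 0] }.

Definition mclass (x : T) : mquot :=
  @MQuot [set y | D x y = 0] (ex_intro _ x erefl).

Definition mrepr (C : mquot) : T := projT1 (cid (mqsetP C)).

Definition mdist (C C' : mquot) : R := D (mrepr C) (mrepr C').

End PseudometricQuotient.

Definition mu_sharp (R : realType) (N : nat) (A : set 'I_N) : R :=
  #|[pred i | i \in A]|%:R / N%:R.

Definition d_sharp (R : realType) (N : nat) : pbij 'I_N -> pbij 'I_N -> R :=
  pdist (@mu_sharp R N).

Lemma pinj_perm (N : nat) (s : 'S_N) : pinjective (Some \o s).
Proof. by move=> x y z [<-] [e]; exact: perm_inj (esym e). Qed.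
Definition pbij_of_perm (N : nat) (s : 'S_N) : pbij 'I_N := PBij (@pinj_perm N s).

Record cber (d : measure_display) (X : measurableType d) := CBER {
  cber_rel :> X -> X -> Prop;
  cber_measurable : measurable [set p : X * X | cber_rel p.1 p.2];
  cber_refl : forall x, cber_rel x x;
  cber_sym : forall x y, cber_rel x y -> cber_rel y x;
  cber_trans : forall x y z, cber_rel x y -> cber_rel y z -> cber_rel x z;
  cber_countable : forall x, countable [set y | cber_rel x y] }.

Definition borel_pbij (d : measure_display) (X : measurableType d)
    (g : X -> option X) : Prop :=
  [/\ measurable (pdom g), measurable (pran g),
      forall B, measurable B -> measurable (ppreimage g B) &
      forall A, measurable A -> measurable (pimage g A)].

Section FullSemigroup.
Context {d : measure_display} {X : measurableType d}.
Variable E : cber X.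

Record fullB := FullB {
  fullB_map :> pbij X;
  fullB_borel : borel_pbij fullB_map;
  fullB_rel : forall x y, fullB_map x = Some y -> E x y }.

Lemma borel_pbij_id : borel_pbij (@pbij_id X).
Proof.
have im A : pimage Some A = A :> set X.
  by rewrite eqEsubset; split=> [x [y Ay [<-]]|x Ax] //; exists x.
have pre A : ppreimage Some A = A :> set X.
  by rewrite eqEsubset; split=> [x [y Ay [->]]|x Ax] //; exists x.
split=> /=; first by rewrite (_ : pdom _ = setT) //; apply/seteqP; split.
- by rewrite /pran im.
- by move=> B; rewrite pre.
- by move=> A; rewrite im.
Qed.

Lemma rel_id (x y : X) : pbij_id X x = Some y -> E x y.
Proof. by case=> <-; exact: cber_refl. Qed.

Definition fullB_id : fullB := FullB borel_pbij_id rel_id.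

Lemma borel_pbij_empty : borel_pbij (@pbij_empty X).
Proof.
have im A : pimage (fun=> None) A = set0 :> set X.
  by apply/seteqP; split=> x // [].
have pre A : ppreimage (fun=> None) A = set0 :> set X.
  by apply/seteqP; split=> x // [].
split=> /=; first by rewrite (_ : pdom _ = set0) //; apply/seteqP; split.
- by rewrite /pran im.
- by move=> B; rewrite pre.
- by move=> A; rewrite im.
Qed.

Lemma rel_empty (x y : X) : pbij_empty X x = Some y -> E x y.
Proof. by []. Qed.

Definition fullB_empty : fullB := FullB borel_pbij_empty rel_empty.

Lemma borel_pbij_comp (f g : fullB) : borel_pbij (pbij_comp f g).
Proof.
have im A : pimage (pbij_comp f g) A = pimage f (pimage g A).
  apply/seteqP; split=> [z [x Ax]|z [y [x Ax gx] fy]] /=.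
    rewrite /pcomp; case gx: (g x) => [y|//] /= fy.
    by exists y => //; exists x.
  by exists x => //=; rewrite /pcomp gx.
have pre B : ppreimage (pbij_comp f g) B = ppreimage g (ppreimage f B).
  apply/seteqP; split=> [x [z Bz]|x [y [z Bz fy] gx]] /=.
    rewrite /pcomp; case gx: (g x) => [y|//] /= fy.
    by exists y => //; exists z.
  by exists z => //=; rewrite /pcomp gx.
have dom : pdom (pbij_comp f g) = ppreimage (pbij_comp f g) setT.
  apply/seteqP; split=> [x|x [y _]]; rewrite /pdom /ppreimage /=.
    by case: (pcomp f g x) => // y _; exists y.
  by move=> ->.
have [[_ _ fpre fim] [_ _ gpre gim]] := (fullB_borel f, fullB_borel g).
split.
- by rewrite dom pre; apply/gpre/fpre; exact: measurableT.
- by rewrite /pran im; apply/fim/gim; exact: measurableT.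
- by move=> B mB; rewrite pre; apply/gpre/fpre.
- by move=> A mA; rewrite im; apply/fim/gim.
Qed.

Lemma rel_comp (f g : fullB) (x z : X) : pbij_comp f g x = Some z -> E x z.
Proof.
rewrite /= /pcomp; case gx: (g x) => [y|//] /= fy.
exact: cber_trans (fullB_rel gx) (fullB_rel fy).
Qed.

Definition fullB_comp (f g : fullB) : fullB :=
  FullB (borel_pbij_comp f g) (@rel_comp f g).

Variables (R : realType) (mu : probability X R).

Definition measure_preserving : Prop :=
  forall (g : fullB) (A : set X), measurable A -> A `<=` pdom g ->
    mu (pimage g A) = mu A.

Definition d_mu : fullB -> fullB -> R := pdist (fun A => fine (mu A)).

Definition full_semigroup := mquot d_mu.

Definition fs_id : full_semigroup := mclass d_mu fullB_id.
Definition fs_empty : full_semigroup := mclass d_mu fullB_empty.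
Definition fs_mul (phi psi : full_semigroup) : full_semigroup :=
  mclass d_mu (fullB_comp (mrepr phi) (mrepr psi)).
Definition fs_fix (phi : full_semigroup) : R := fine (mu (pfix (mrepr phi))).

Definition full_group : set full_semigroup :=
  [set mclass d_mu g | g in [set g : fullB | pdom g = setT /\ pran g = setT]].

Definition sofic : Prop :=
  forall (K : set full_semigroup) (eps : R), finite_set K -> 0 < eps ->
  exists (N : nat) (pi : full_semigroup -> pbij 'I_N),
    [/\ (0 < N)%N,
        pi fs_id = pbij_id 'I_N,
        pi fs_empty = pbij_empty 'I_N,
        forall phi psi, K phi -> K psi ->
          d_sharp R (pi (fs_mul phi psi)) (pbij_comp (pi phi) (pi psi)) < eps &
        forall phi, K phi -> `|fs_fix phi - mu_sharp R (pfix (pi phi))| < eps].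

End FullSemigroup.

Definition free_ultrafilter (U : set_system nat) : Prop :=
  UltraFilter U /\ \bigcap_(A in U) A = set0.

Section Ultraproduct.
Variables (R : realType) (U : set_system nat) (n : nat -> nat).

Definition d_ultra (x y : forall k, 'S_(n k)) : R :=
  lim ((fun k => d_sharp R (pbij_of_perm (x k)) (pbij_of_perm (y k))) @ U).

Definition ultraproduct := mquot d_ultra.

(* In the product of permutations of the library, the left factor is applied
   first: [y k * x k] is the composite [x k \o y k]. *)
Definition up_mul (a b : ultraproduct) : ultraproduct :=
  mclass d_ultra (fun k => mrepr b k * mrepr a k)%g.

End Ultraproduct.

(* The values of [theta] outside [full_group] are irrelevant. *)
Definition metrically_sofic (d : measure_display) (X : measurableType d)
    (E : cber X) (R : realType) (mu : probability X R) : Prop :=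
  exists (U : set_system nat) (n : nat -> nat)
         (theta : full_semigroup E mu -> ultraproduct R U n),
    [/\ free_ultrafilter U,
        forall k, (0 < n k)%N,
        forall x y, full_group x -> full_group y ->
          theta (fs_mul x y) = up_mul (theta x) (theta y) &
        forall x y, full_group x -> full_group y ->
          mdist (theta x) (theta y) = mdist x y].

(* Main.v *)
Require Import Defs.
From mathcomp Require Import all_boot all_order all_algebra all_fingroup ring lra.
From mathcomp Require Import all_classical all_reals all_analysis.

(** For the direct implication, apply soficity to a finite set of automorphisms
    and their inverses. Since [g^-1 g] is the identity, an almost multiplicative
    map sends [g] to an almost total partial bijection, which extends to a
    permutation ([perm_extend]); comparing the fixed points of [g^-1 h] with
    their measure shows that these permutations lie at nearly the right
    distances ([sofic_perms]). The full group is separable ([dense_baut]), and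
    the approximations along a dense sequence fit together in an ultraproduct.

    For the converse, partial isomorphisms and Borel sets have to be recovered
    from an isometric representation of the full group alone. The points of the
    ultraproduct form a space [W] with a finitely additive measure, on which the
    automorphisms act almost everywhere, [g] and [h] differing on a set of
    measure [mu {g <> h}]. Let [A], [g A], [h A] be pairwise disjoint. The three
    involutions [a], [b], [c] that swap two of these sets have supports of measure
    [2 mu A], and [ab = ca = bc] is a 3-cycle, whose support has measure [3 mu A];
    almost every point of [W] that it moves is moved by at least two of the
    involutions. Counting ([triangle_count]) leaves one possibility: almost every
    point moved by one of the involutions is moved by exactly two. Hence the set
    [Theta A g h] of the points moved by both swaps that involve [A] has measure
    [mu A]: it is the copy of [A] in [W]. The key fact is that an automorphism that fixes [A]
    pointwise fixes this copy ([fixes_disjoint]); it follows that copies of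
    disjoint sets are disjoint ([Theta_disjoint]), that automorphisms carry
    copies to copies ([Theta_equiv]) and that the choice of [g] and [h] is
    immaterial ([Theta_indep]). A partial isomorphism that agrees with an
    automorphism on each of finitely many such sets [A] is then copied piece by
    piece ([chart_map]), and copying respects composition, coincidence and fixed
    points ([models_comp], [models_diff], [models_fix]).

    Such sets [A] fill, up to a null set, the part of [X] where the classes have
    at least three points. Where they have at most two, the relation is that of
    an involution ([type_decomposition_exists]); there a finite sample of points
    with the right frequencies ([sampling]), taken together with their partners,
    is a model ([sample_action]). A fibre of the ultraproduct in which finitely
    many densities are close to their limits is multiplied by the sample; over
    the copy of the large part the first model acts, and elsewhere the second
    ([splice], [finite_models]). The values at the identity and at the empty map
    come out nearly right, and are then corrected.

    Both implications use a substitute for the theorems of Lusin-Novikov and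
    Feldman-Moore: there are countably many automorphisms whose values exhaust,
    almost everywhere, those of any automorphism ([countable_cover]). *)

Set Implicit Arguments.
Unset Strict Implicit.
Unset Printing Implicit Defensive.

Import Order.TTheory GRing.Theory Num.Theory.
Import numFieldNormedType.Exports.

Local Open Scope classical_set_scope.
Local Open Scope ring_scope.

(** * Standard Borel spaces as closed sets of integer sequences *)

(** The value is 0 where no witness exists, so that [least] can be applied pointwise
    to a family of sets. *)
Definition least (p : nat -> Prop) : nat :=
  if pselect (exists n, `[< p n >]) is left h then ex_minn h else 0%N.

Lemma least_spec (p : nat -> Prop) n : p n -> p (least p).
Proof.
move=> pn; rewrite /least; case: pselect => [h|[]]; last by exists n; apply/asboolP.
by case: ex_minnP => m /asboolP.
Qed.

Lemma least_le (p : nat -> Prop) n : p n -> (least p <= n)%N.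
Proof.
move=> pn; rewrite /least; case: pselect => // h.
by case: ex_minnP => m _; apply; apply/asboolP.
Qed.

Lemma countable_enum (T : Type) (A : set T) (a : T) : countable A -> A a ->
  exists f : nat -> T, (forall n, A (f n)) /\ (forall x, A x -> exists n, f n = x).
Proof.
move=> /countable_injP[h hinj] Aa.
pose P n x := A x /\ h x = n.
exists (fun n => if pselect (exists x, P n x) is left e then sval (cid e) else a).
split=> [n|x Ax].
  by case: pselect => [e|//]; case: cid => x /= [].
exists (h x); case: pselect => [e|[]]; last by exists x.
by case: cid => y /= [Ay /hinj]; apply; exact/mem_set.
Qed.

Lemma countable_setU (T : Type) (A B : set T) :
  countable A -> countable B -> countable (A `|` B).
Proof.
move=> cA cB; rewrite (_ : A `|` B = \bigcup_(b in [set: bool]) if b then A else B).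
  by apply: bigcup_countable => [|[]].
apply/seteqP; split=> x; first by case=> ?; [exists true|exists false].
by case=> -[] _ ?; [left|right].
Qed.

Section Least.
Context {d : measure_display} {X : measurableType d}.

Lemma measurable_least (p : nat -> set X) k :
  (forall n, measurable (p n)) ->
  measurable [set x | least (fun n => p n x) = k].
Proof.
move=> mp.
have mlt : measurable (\bigcap_(i in `I_k) ~` p i).
  by apply: bigcap_measurableType => i _; exact: measurableC.
have mnone : measurable (if k == 0%N then \bigcap_i ~` p i else set0).
  case: eqP => _; last exact: measurable0.
  by apply: bigcap_measurableType => i _; exact: measurableC.
rewrite (_ : [set x | _] = (p k `&` \bigcap_(i in `I_k) ~` p i) `|`
    (if k == 0%N then \bigcap_i ~` p i else set0)).
  by apply: measurableU => //; exact: measurableI.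
apply/seteqP; split=> x /=.
  move=> <-; case: (pselect (exists n, p n x)) => [[n pn]|np].
    left; split; first exact: (@least_spec (fun n => p n x) n).
    move=> i /= il pi; move: il; rewrite ltnNge => /negP; apply.
    exact: (@least_le (fun n => p n x)).
  right; rewrite /least; case: pselect => [h|_] /=.
    by case: np; case: h => n /asboolP; exists n.
  by move=> n _ pn; apply: np; exists n.
move=> [[pk lk]|].
  apply/eqP; rewrite eqn_leq (@least_le (fun n => p n x)) //= leqNgt.
  by apply/negP => /lk; apply; apply: (@least_spec (fun n => p n x) k).
case: eqP => [->|] // np; rewrite /least; case: pselect => // h.
by have [n /asboolP /(np n I)] := h.
Qed.

End Least.

(** A Borel isomorphism with a closed set of integer sequences. Closedness turns
    coherent finite approximations into points, and [code_generates] reduces claims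
    about Borel sets to the sets that fix one coordinate. *)
Record coding (d : measure_display) (X : measurableType d) := Coding {
  code :> X -> nat -> nat;
  code_measurable : forall j k, measurable [set x | code x j = k];
  code_inj : forall x y, (forall j, code x j = code y j) -> x = y;
  code_closed : forall z : nat -> nat,
    (forall n, exists x, forall j, (j < n)%N -> code x j = z j) ->
    exists x, forall j, code x j = z j;
  code_generates : forall G : set (set X), sigma_algebra setT G ->
    (forall j k, G [set x | code x j = k]) -> measurable `<=` G }.

Section CodingExists.
Variables (R : realType) (d : measure_display) (X : measurableType d).

(** Coordinates may be indexed by any countable type: an integer that encodes no
    index gets the constant coordinate 0. *)
Lemma coding_of_countable (I : countType) (c : I -> X -> nat) :
  (forall i k, measurable [set x | c i x = k]) ->
  (forall x y, (forall i, c i x = c i y) -> x = y) ->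
  (forall z : I -> nat, (forall n, exists x, forall i, (pickle i < n)%N -> c i x = z i) ->
    exists x, forall i, c i x = z i) ->
  (forall G : set (set X), sigma_algebra setT G ->
    (forall i k, G [set x | c i x = k]) -> measurable `<=` G) ->
  inhabited (coding X).
Proof.
move=> cm ci cc cg.
pose e x j := if pickle_inv j is Some i then c i x else 0%N.
have eP i x : e x (pickle i) = c i x by rewrite /e pickleK_inv.
have eN j : @pickle_inv I j = None -> forall x, e x j = 0%N by rewrite /e => ->.
constructor; exists e.
- move=> j k; rewrite /e; case: pickle_inv => [i|]; first exact: cm.
  case: (pselect (0%N = k)) => h.
    by rewrite (_ : mkset _ = setT) //; apply/seteqP; split.
  by rewrite (_ : mkset _ = set0) //; apply/seteqP; split.
- by move=> x y exy; apply: ci => i; rewrite -!eP.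
- move=> z hz; have [n|x xz] := cc (z \o pickle).
    by have [x xz] := hz n; exists x => i ilt; rewrite -eP xz.
  exists x => j; case E: (@pickle_inv I j) => [i|].
    by have := @pickle_invK I j; rewrite E /= => <-; rewrite eP xz.
  have [y yz] := hz j.+1.
  by rewrite -(yz j) // !(eN _ E).
- move=> G sG eG; apply: cg => // i k.
  by have := eG (pickle i) k; under eq_set do rewrite eP.
Qed.

(** The open sets [O j] are the members of a countable base and the complements of
    their closures. The code of a point tells, for each [j], whether it lies in
    [O j], and if so the least basic set [V i] that witnesses it by having the point
    in its closure and its closure in [O j]; it also gives, for each [n], the least
    basic set of radius [1 / n.+1] around the point. If the codes of a sequence of
    points become stationary, the radii make it a Cauchy sequence, and the witnesses
    make the limit belong to the same sets [O j]. *)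
Lemma standard_borel_coding : standard_borel R X -> inhabited (coding X).
Proof.
move=> [P [f [hP [B cB [Bo Bb]] [g fK gK] fm]]].
have openM U : open U -> measurable (f @^-1` U).
  by move=> oU; apply/fm; exact: sub_gen_smallest.
have clM U : closed U -> measurable (f @^-1` U).
  move=> cU; rewrite (_ : _ @^-1` _ = ~` (f @^-1` (~` U))).
    by apply/measurableC/openM; rewrite openC.
  by rewrite preimage_setC setCK.
have [V [VB BV]] := @countable_enum _ (B `|` [set set0]) set0
  (countable_setU cB (countable1 set0)) (or_intror erefl).
have Vo j : open (V j) by case: (VB j) => [/Bo//|->]; exact: open0.
have reg (O : set P) y : open O -> O y -> exists i, V i y /\ closure (V i) `<=` O.
  move=> oO Oy; have [W Wy WO] := @uniform_regular P y O (open_nbhs_nbhs (conj oO Oy)).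
  have [U [BU Uy] UW] := Bb y W Wy.
  have [i iU] := BV U (or_introl BU).
  by exists i; rewrite iU; split=> //; apply: subset_trans WO; exact: closureS.
pose O (j : nat + nat) := match j with inl j => V j | inr j => ~` closure (V j) end.
have Oo j : open (O j).
  by case: j => j //=; rewrite openC; exact: closed_closure.
pose small n i := exists p, V i `<=` ball p (n.+1%:R^-1 : R).
have sm n y : exists i, V i y /\ small n i.
  have [U [BU Uy] UW] := Bb y _ (nbhsx_ballx y (n.+1%:R^-1 : R) ltac:(by rewrite invr_gt0)).
  by have [i iU] := BV U (or_introl BU); exists i; rewrite iU; split => //; exists y; rewrite iU.
pose p1 j y i := closure (V i) y /\ closure (V i) `<=` O j.
pose p2 n y i := V i y /\ small n i.
(* the successor distinguishes the witness 0 from the absence of a witness *)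
pose c (i : (nat + nat) + nat) (x : X) := match i with
  | inl j => if pselect (O j (f x)) is left _ then (least (p1 j (f x))).+1 else 0%N
  | inr n => least (p2 n (f x)) end.
have mconst (Q : Prop) : measurable [set x : X | Q].
  case: (pselect Q) => h.
    by rewrite (_ : mkset _ = setT) //; apply/seteqP; split.
  by rewrite (_ : mkset _ = set0) //; apply/seteqP; split.
apply: (@coding_of_countable _ c).
- case=> [j|n] k /=; last first.
    apply: measurable_least => i; apply: measurableI; last exact: mconst.
    exact: openM.
  have mO : measurable [set x | O j (f x)] by exact: openM.
  have ml k' : measurable [set x | least (p1 j (f x)) = k'].
    apply: measurable_least => i; apply: measurableI; last exact: mconst.
    by apply: clM; exact: closed_closure.
  case: k => [|k].
    rewrite (_ : mkset _ = ~` [set x | O j (f x)]); first exact: measurableC.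
    by apply/seteqP; split=> x /=; case: pselect.
  rewrite (_ : mkset _ = [set x | O j (f x)] `&` [set x | least (p1 j (f x)) = k]).
    exact: measurableI.
  apply/seteqP; split=> x /=; case: pselect => //.
    by move=> h [].
  by move=> h [_ ->].
  by move=> nh [].
- move=> x y xy; apply: (can_inj fK).
  apply: hP => A C fxA fyC.
  move: fxA; rewrite nbhsE => -[A' [oA' A'x] AA'].
  have [i [Vx cV]] := reg _ _ oA' A'x.
  have Vy : V i (f y).
    have := xy (inl (inl i)); rewrite /c /=.
    by do 2! case: pselect.
  exists (f y); split; last exact: nbhs_singleton.
  by apply/AA'/cV/subset_closure.
- move=> z hz.
  have {hz} [y yz] := choice hz.
  have yz' i : exists m, forall n, (m <= n)%N -> c i (y n) = z i.
    by exists (pickle i).+1 => n; exact: yz.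
  have cau : cauchy (f (y n) @[n --> \oo]).
    apply: (@cauchy_exP R) => eps eps0.
    have [n nlt] : exists n, (n.+1%:R^-1 : R) < eps.
      by have /filter_ex[n] := near_infty_natSinv_lt (PosNum eps0); exists n.
    have [m ym] := yz' (inr n).
    have [_ [p Vp]] : p2 n (f (y m)) (z (inr n)).
      have [i hi] := sm n (f (y m)).
      by rewrite -(ym m) //; apply: (@least_spec (p2 n (f (y m))) i).
    exists p; exists m => // k /= mk.
    apply: (le_ball (ltW nlt)); apply: Vp.
    have [i hi] := sm n (f (y k)).
    rewrite -(ym k) //; exact: (@least_spec (p2 n (f (y k))) i hi).1.
  have /cvg_ex [l yl] : cvg (f (y n) @[n --> \oo]) by exact: cauchy_cvg.
  have inl_ A m : closed A -> (forall n, (m <= n)%N -> A (f (y n))) -> A l.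
    by move=> cA Am; apply: (closed_cvg _ cA _ _ yl); exists m.
  have Ol j : O j l <-> z (inl j) <> 0%N.
    have [m ym] := yz' (inl j).
    case E: (z (inl j)) => [|k]; split => //.
      move=> Ojl; exfalso.
      have : (~` O j) l.
        apply: (inl_ _ m) => [|n mn]; first by rewrite closedC.
        by have := ym n mn; rewrite E /c; case: pselect.
      by [].
    move=> _; have [] : closure (V k) `<=` O j /\ closure (V k) l; last by move=> h /h.
    have h n : (m <= n)%N -> p1 j (f (y n)) k.
      move=> mn; have := ym n mn; rewrite E /c; case: pselect => // Oj [<-].
      have [i [Vi cVi]] := reg _ _ (Oo j) Oj.
      apply: (@least_spec (p1 j (f (y n))) i); split => //; exact: subset_closure.
    split; first by have [] := h m (leqnn m).
    apply: (inl_ _ m); first exact: closed_closure.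
    by move=> n /h[].
  have Oy j : exists m, forall n, (m <= n)%N -> O j (f (y n)) <-> O j l.
    have [m ym] := yz' (inl j); exists m => n /ym; rewrite Ol => <-.
    by rewrite /c; case: pselect.
  have Vy i : exists m, forall n, (m <= n)%N -> V i (f (y n)) <-> V i l by exact: (Oy (inl i)).
  have cVy i : exists m, forall n, (m <= n)%N -> closure (V i) (f (y n)) <-> closure (V i) l.
    have [m hm] := Oy (inr i); exists m => n /hm /= h.
    by split=> h1; apply: contrapT => h2; move: h1; apply/h.
  (* the least witness of the limit is decided by finitely many conditions, each of
     which is eventually constant along the sequence *)
  have stab (p : P -> nat -> Prop) : (exists i, p l i) ->
      (forall i, exists m, forall n, (m <= n)%N -> p (f (y n)) i <-> p l i) ->
      exists m, forall n, (m <= n)%N -> least (p (f (y n))) = least (p l).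
    move=> [i0 pi0] /choice[M hM].
    pose L := least (p l).
    exists (\max_(i < L.+1) M i)%N => n nM.
    have MS i : (i <= L)%N -> p (f (y n)) i <-> p l i.
      move=> iL; apply: hM; apply: leq_trans nM.
      by rewrite -ltnS in iL; exact: (leq_bigmax (Ordinal iL)).
    have pL : p (f (y n)) L by apply/MS => //; exact: (@least_spec (p l) i0).
    have le1 := least_le pL.
    apply/eqP; rewrite eqn_leq le1 /=.
    apply: (@least_le (p l)); apply/MS => //.
    exact: (@least_spec (p (f (y n))) L).
  exists (g l) => i.
  have [m ym] := yz' i.
  suff [m' hm'] : exists m', forall n, (m' <= n)%N -> c i (y n) = c i (g l).
    by rewrite -(hm' (maxn m m')) ?leq_maxr // ym // leq_maxl.
  case: i ym => [j|n] ym /=; rewrite gK.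
    have [m1 h1] := Oy j.
    case: (pselect (O j l)) => Ojl; last first.
      exists m1 => n /h1 h; case: pselect => // /h //.
    have [| |m2 h2] := stab (p1 j).
    + have [i [Vi cVi]] := reg _ _ (Oo j) Ojl; exists i; split => //; exact: subset_closure.
    + move=> i; have [m2 h2] := cVy i; exists m2 => n /h2 h.
      by split=> -[/h ? ?].
    exists (maxn m1 m2) => n; rewrite geq_max => /andP[/h1 h /h2 ->].
    by case: pselect => // -[]; apply/h.
  apply: stab; first exact: sm.
  move=> i; have [m2 h2] := Vy i; exists m2 => k /h2 h.
  by split=> -[/h ? ?].
- move=> G sG cG A mA.
  have GC S : G S -> G (~` S) by case: sG => _ h _ GS; rewrite -setTD; exact: h.
  have GU (S : nat -> set X) : (forall n, G (S n)) -> G (\bigcup_n S n).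
    by case: sG => _ _ h; exact: h.
  have sub : <<s [set U : set P | open U] >> `<=` [set C | G (f @^-1` C)].
    apply: smallest_sub.
      split=> /=.
      + by rewrite preimage_set0; case: sG.
      + by move=> C GC'; rewrite setTD preimage_setC; exact: GC.
      + by move=> F GF; rewrite preimage_bigcup; exact: GU.
    move=> U /= oU.
    have GV i : G (f @^-1` V i).
      have := GC _ (cG (inl (inl i)) 0%N).
      rewrite (_ : ~` _ = f @^-1` V i) //.
      by apply/seteqP; split=> x /=; case: pselect.
    rewrite (_ : U = \bigcup_i (if pselect (V i `<=` U) is left _ then V i else set0)).
      rewrite preimage_bigcup; apply: GU => i.
      by case: pselect => _ //; rewrite preimage_set0; case: sG.
    apply/seteqP; split=> [y Uy|y [i _]]; last by case: pselect => // h /h.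
    have [i [Vy cV]] := reg _ _ oU Uy; exists i => //.
    by case: pselect => // -[]; apply: subset_trans cV; exact: subset_closure.
  suff -> : A = f @^-1` (g @^-1` A) by apply/sub/fm; rewrite -comp_preimage (_ : _ \o _ = id) //; apply/funext => x /=.
  by apply/seteqP; split => x /=; rewrite fK.
Qed.
End CodingExists.

(** * Real-valued probabilities *)

Section Pr.
Context {R : realType} {d : measure_display} {X : measurableType d}.
Variable mu : probability X R.

Definition pr (A : set X) : R := fine (mu A).

Lemma prE A : measurable A -> mu A = (pr A)%:E.
Proof. by move=> mA; rewrite /pr fineK // fin_num_measure. Qed.

Lemma pr_ge0 A : 0 <= pr A.
Proof. by rewrite /pr fine_ge0. Qed.

Lemma prT : pr setT = 1.
Proof. by rewrite /pr probability_setT. Qed.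

Lemma pr0 : pr set0 = 0.
Proof. by rewrite /pr measure0. Qed.

Lemma le_pr A B : measurable A -> measurable B -> A `<=` B -> pr A <= pr B.
Proof.
by move=> mA mB AB; rewrite -lee_fin -!prE // le_measure // inE.
Qed.

Lemma pr_le1 A : measurable A -> pr A <= 1.
Proof. by move=> mA; rewrite -prT; exact: le_pr. Qed.

Lemma prU A B : measurable A -> measurable B -> A `&` B = set0 ->
  pr (A `|` B) = pr A + pr B.
Proof.
move=> mA mB AB; apply: EFin_inj; rewrite EFinD -!prE //; last exact: measurableU.
by rewrite measureU.
Qed.

Lemma prID A B : measurable A -> measurable B ->
  pr A = pr (A `&` B) + pr (A `\` B).
Proof.
move=> mA mB; rewrite -prU ?setUIDK //; first exact: measurableI.
  exact: measurableD.
by apply/seteqP; split=> x // [[_ ?] [_ ]].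
Qed.

Lemma prC A : measurable A -> pr (~` A) = 1 - pr A.
Proof.
by move=> mA; have := prID measurableT mA; rewrite setTI setTD prT; lra.
Qed.

Lemma prU_le A B : measurable A -> measurable B -> pr (A `|` B) <= pr A + pr B.
Proof.
move=> mA mB; rewrite (_ : A `|` B = A `|` (B `\` A)); last first.
  by rewrite setDE setUIr setUv setIT.
have mD : measurable (B `\` A) by exact: measurableD.
rewrite prU //; first by rewrite lerD2l; apply: le_pr => //; exact: subDsetl.
by apply/seteqP; split=> x // [? [_ ]].
Qed.

Lemma le_pr_sum (I : eqType) (s : seq I) (A : set X) (F : I -> set X) :
  measurable A -> (forall i, measurable (F i)) ->
  (forall x, A x -> exists2 i, i \in s & F i x) ->
  pr A <= \sum_(i <- s) pr (F i).
Proof.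
move=> mA mF; elim: s A mA => [|i s IH] A mA AF.
  rewrite big_nil (_ : A = set0) ?pr0 //.
  by apply/seteqP; split=> x // /AF[].
rewrite big_cons (prID mA (mF i)); apply: lerD.
  by apply: le_pr => //; exact: measurableI.
apply: IH; first exact: measurableD.
by move=> x [/AF[j]]; rewrite in_cons => /predU1P[->|js] //; exists j.
Qed.

(** Continuity of the measure along the decreasing sequence of remainders. *)
Lemma pr_small (F : nat -> set X) eps : (forall n, measurable (F n)) ->
  0 < eps -> exists n, pr (\bigcup_i F i `\` \bigcup_(i in `I_n) F i) < eps.
Proof.
move=> mF eps0.
pose D n := \bigcup_i F i `\` \bigcup_(i in `I_n) F i.
have mD n : measurable (D n).
  by apply: measurableD; apply: bigcup_measurable => i _.
have Dni : {homo D : n m / (n <= m)%N >-> (m <= n)%O}.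
  move=> m n mn; apply/subsetPset => x [Ux nU]; split=> // -[i /= im Fi].
  by apply: nU; exists i => //=; exact: leq_trans mn.
have D0 : \bigcap_n D n = set0.
  apply/seteqP; split=> x // Dx.
  have [[i _ Fi] _] := Dx 0%N I; have [_] := Dx i.+1 I; apply.
  by exists i => /=.
have fin : (mu (D 0%N) < +oo)%E by rewrite ltey_eq fin_num_measure.
have mD0 : measurable (\bigcap_n D n) by rewrite D0; exact: measurable0.
have := nonincreasing_cvg_mu fin mD mD0 Dni.
rewrite D0 measure0 => /fine_cvgP[_] /cvgrPdist_lt /(_ _ eps0) [n _ /(_ n (leqnn n))].
rewrite /= sub0r normrN ger0_norm ?fine_ge0 // => h.
by exists n.
Qed.

Lemma pr_bigcup0 (F : nat -> set X) : (forall n, measurable (F n)) ->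
  (forall n, pr (F n) = 0) -> pr (\bigcup_i F i) = 0.
Proof.
move=> mF F0; apply/eqP; rewrite eq_le pr_ge0 andbT; apply/ler_addgt0Pl => e e0.
have [n] := pr_small mF e0; rewrite addr0.
set U := \bigcup_i F i; set V := \bigcup_(i in _) _ => /ltW.
have mU : measurable U by exact: bigcup_measurable.
have mV : measurable V by exact: bigcup_measurable.
rewrite (prID mU mV); set a := pr (U `&` V).
have -> : a = 0; last by rewrite add0r.
apply/eqP; rewrite eq_le pr_ge0 andbT.
have -> : 0 = \sum_(i <- iota 0 n) pr (F i) by rewrite big1.
apply: le_pr_sum => //; first exact: measurableI.
move=> x [_ [i /= ilt Fi]]; exists i => //.
by rewrite mem_iota.
Qed.

Lemma pr_sub0 A B : measurable A -> measurable B -> A `<=` B -> pr B = 0 -> pr A = 0.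
Proof.
move=> mA mB AB B0; apply/eqP; rewrite eq_le pr_ge0 andbT -B0; exact: le_pr.
Qed.

End Pr.

(** * Borel automorphisms and swaps *)

Section PartialMaps.
Context {d : measure_display} {X : measurableType d}.
Implicit Types f g : X -> option X.

Definition pmeasurable f := forall B, measurable B -> measurable (ppreimage f B).

Lemma pmeasurable_comp f g : pmeasurable f -> pmeasurable g ->
  pmeasurable (pcomp f g).
Proof.
move=> mf mg B mB; rewrite (_ : ppreimage _ _ = ppreimage g (ppreimage f B)).
  exact/mg/mf.
apply/seteqP; split=> [x [z Bz]|x [y [z Bz fy] gx]].
  by rewrite /pcomp; case gx: (g x) => [y|//] /= fy; exists y => //; exists z.
by exists z => //; rewrite /pcomp gx.
Qed.

Lemma pdom_ppreimage f : pdom f = ppreimage f setT.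
Proof.
apply/seteqP; split=> [x|x [y _]]; rewrite /pdom /=; last by move=> ->.
by case E: (f x) => [y|] // _; exists y.
Qed.

Lemma pmeasurable_dom f : pmeasurable f -> measurable (pdom f).
Proof. by move=> mf; rewrite pdom_ppreimage; exact: mf. Qed.

Variable cd : coding X.

(** Two points are equal as soon as all coordinates of their codes agree, which is a
    countable condition. *)
Lemma measurable_eqmap f g : pmeasurable f -> pmeasurable g ->
  measurable [set x | f x = g x].
Proof.
move=> mf mg.
pose L j k : set X := [set x | cd x j = k].
have mL j k : measurable (L j k) by exact: code_measurable.
rewrite (_ : mkset _ = (~` pdom f `&` ~` pdom g) `|`
    \bigcap_j \bigcup_k (ppreimage f (L j k) `&` ppreimage g (L j k))).
  apply: measurableU.
    by apply: measurableI; apply/measurableC/pmeasurable_dom.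
  apply: bigcap_measurableType => j _; apply: bigcup_measurable => k _.
  by apply: measurableI; [apply: mf|apply: mg].
apply/seteqP; split=> [x /= fg|x [[/= nf ng]|fg]] /=.
- case gx: (g x) => [y|]; last by left; rewrite /pdom /= fg gx.
  by right=> j _; exists (cd y j) => //; split; exists y; rewrite // fg.
- by move: nf ng; rewrite /pdom /=; case: (f x); case: (g x).
- have [k _ [[y _ fx] _]] := fg 0%N I.
  have [k' _ [_ [z _ gx]]] := fg 0%N I.
  rewrite fx gx; congr Some; apply: (code_inj (c := cd)) => j.
  have [i _ []] := fg j I.
  by move=> [y' <-]; rewrite fx => -[->] [z' <-]; rewrite gx => -[->].
Qed.

Lemma measurable_neqmap f g : pmeasurable f -> pmeasurable g ->
  measurable [set x | f x <> g x].
Proof.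
move=> mf mg; rewrite (_ : mkset _ = ~` [set x | f x = g x]) //.
exact/measurableC/measurable_eqmap.
Qed.

End PartialMaps.

Section Automorphisms.
Context {d : measure_display} {X : measurableType d}.
Variable E : cber X.

(** The elements of the full group before maps that agree almost everywhere are
    identified. Total maps that carry their inverse are easier to compose than
    elements of [fullB]. *)
Record baut := BAut {
  afun :> X -> X;
  ainv : X -> X;
  afunK : cancel afun ainv;
  ainvK : cancel ainv afun;
  measurable_afun : forall B, measurable B -> measurable (afun @^-1` B);
  measurable_ainv : forall B, measurable B -> measurable (ainv @^-1` B);
  baut_rel : forall x, E x (afun x) }.

Lemma afun_inj (g : baut) : injective g. Proof. exact: can_inj (@afunK g). Qed.

Definition baut_id : baut.
Proof. by apply: (@BAut id id) => // x; exact: cber_refl. Defined.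

Definition baut_comp (g h : baut) : baut.
Proof.
apply: (@BAut (g \o h) (ainv h \o ainv g)).
- by move=> x /=; rewrite !afunK.
- by move=> x /=; rewrite !ainvK.
- by move=> B mB; rewrite comp_preimage; do 2! apply: measurable_afun.
- by move=> B mB; rewrite comp_preimage; do 2! apply: measurable_ainv.
- by move=> x; apply: cber_trans (baut_rel h x) (baut_rel g _).
Defined.

Definition baut_inv (g : baut) : baut.
Proof.
apply: (@BAut (ainv g) g (@ainvK g) (@afunK g)).
- exact: measurable_ainv.
- exact: measurable_afun.
- by move=> x; apply: cber_sym; rewrite -{2}(ainvK g x); exact: baut_rel.
Defined.

Definition baut_of_involution (s : X -> X) (sK : involutive s)
  (ms : forall B, measurable B -> measurable (s @^-1` B))
  (sE : forall x, E x (s x)) : baut := BAut sK sK ms ms sE.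

Lemma pinj_baut (g : baut) : pinjective (Some \o g).
Proof. by move=> x y z /= [<-] [/afun_inj]. Qed.

Lemma pimage_baut (g : baut) A : pimage (Some \o g) A = ainv g @^-1` A.
Proof.
apply/seteqP; split=> [y [x Ax [<-]]|y Ay]; rewrite /preimage /= ?afunK //.
by exists (ainv g y) => //=; rewrite ainvK.
Qed.

Lemma ppreimage_baut (g : baut) A : ppreimage (Some \o g) A = g @^-1` A.
Proof.
by apply/seteqP; split=> [x [y Ay /= [gx]]|x Ax]; [rewrite /preimage /= gx|exists (g x)].
Qed.

Lemma baut_borel (g : baut) : borel_pbij (PBij (@pinj_baut g)).
Proof.
split=> /=.
- by rewrite pdom_ppreimage ppreimage_baut preimage_setT.
- by rewrite /pran pimage_baut preimage_setT.
- by move=> B mB; rewrite ppreimage_baut; exact: measurable_afun.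
- by move=> A mA; rewrite pimage_baut; exact: measurable_ainv.
Qed.

Lemma baut_fullB_rel (g : baut) x y : PBij (@pinj_baut g) x = Some y -> E x y.
Proof. by case=> <-; exact: baut_rel. Qed.

Definition fullB_of_baut (g : baut) : fullB E := FullB (baut_borel g) (@baut_fullB_rel g).

Lemma fullB_measurable (phi : fullB E) : pmeasurable phi.
Proof. by case: (fullB_borel phi). Qed.

Lemma fullB_mdom (phi : fullB E) : measurable (pdom phi).
Proof. by case: (fullB_borel phi). Qed.

Lemma fullB_mimage (phi : fullB E) A : measurable A -> measurable (pimage phi A).
Proof. by case: (fullB_borel phi) => _ _ _; exact. Qed.

Section Swap.
Variables (phi : fullB E) (A : set X).

Definition swap_fun x : X :=
  if pselect (A x) is left _ then odflt x (phi x) else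
  if pselect (exists2 a, A a & phi a = Some x) is left h then s2val (cid2 h)
  else x.

(** The condition for [x <-> phi x] to define an involution on [A] and its image. *)
Definition swappable := [/\ measurable A, A `<=` pdom phi &
  forall x y, A x -> phi x = Some y -> ~ A y].

Hypothesis sw : swappable.

Lemma swap_funP x : (exists y, [/\ A x, phi x = Some y & swap_fun x = y]) \/
  ((exists y, [/\ A y, phi y = Some x & swap_fun x = y]) \/
  [/\ ~ A x, (forall y, A y -> phi y <> Some x) & swap_fun x = x]).
Proof.
have [_ Adom Adisj] := sw.
rewrite /swap_fun; case: pselect => [Ax|nAx].
  left; have := Adom x Ax; rewrite /pdom /=; case: (phi x) => // y _.
  by exists y.
right; case: pselect => [h|nh].
  by left; case: cid2 => y Ay yx /=; exists y.
by right; split=> // y Ay yx; apply: nh; exists y.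
Qed.

Lemma swap_fun_on x y : A x -> phi x = Some y -> swap_fun x = y /\ swap_fun y = x.
Proof.
move=> Ax xy; have [_ _ Adisj] := sw; split.
  case: (swap_funP x) => [[z [_ + ->]]|[[z [Az zx _]]|[]//]].
    by rewrite xy => -[].
  by have := Adisj _ _ Az zx.
have nAy := Adisj _ _ Ax xy.
case: (swap_funP y) => [[z []]//|[[z [Az zy ->]]|[_ /(_ x Ax)]//]].
exact: pbij_inj zy xy.
Qed.

Lemma swap_funK : involutive swap_fun.
Proof.
move=> x; case: (swap_funP x) => [[y [Ax xy ->]]|[[y [Ay yx ->]]|[_ _ e]]].
- by have [] := swap_fun_on Ax xy.
- by have [] := swap_fun_on Ay yx.
- by rewrite !e.
Qed.

Lemma swap_fun_rel x : E x (swap_fun x).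
Proof.
case: (swap_funP x) => [[y [_ xy ->]]|[[y [_ yx ->]]|[_ _ ->]]].
- exact: fullB_rel xy.
- by apply: cber_sym; exact: fullB_rel yx.
- exact: cber_refl.
Qed.

Lemma measurable_swap_fun B : measurable B -> measurable (swap_fun @^-1` B).
Proof.
move=> mB; have [mA Adom Adisj] := sw.
have mim C : measurable C -> measurable (pimage phi C) by exact: fullB_mimage.
rewrite (_ : _ @^-1` _ = (A `&` ppreimage phi B) `|` pimage phi (A `&` B) `|`
    (B `&` ~` A `&` ~` pimage phi A)).
  apply: measurableU; [apply: measurableU|apply: measurableI].
  - by apply: measurableI => //; exact: fullB_measurable.
  - by apply: mim; exact: measurableI.
  - by apply: measurableI => //; exact: measurableC.
  - by apply: measurableC; exact: mim.
apply/seteqP; split=> x; rewrite /preimage /=.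
  case: (swap_funP x) => [[y [Ax xy ->]]|[[y [Ay yx ->]]|[nA nI ->]]] Bx.
  - by left; left; split=> //; exists y.
  - by left; right; exists y.
  - by right; split=> // -[y Ay yx]; exact: (nI y).
move=> [[[Ax [y By xy]]|[y [Ay By] yx]]|[[Bx nA] nI]].
- by have [->] := swap_fun_on Ax xy.
- by have [_ ->] := swap_fun_on Ay yx.
- case: (swap_funP x) => [[y []//]|[[y [Ay yx _]]|[_ _ ->]]] //.
  by exfalso; apply: nI; exists y.
Qed.

End Swap.

(** Exchanges [x] and [phi x] for [x] in [A]. The identity is taken when [A] is not
    swappable, which makes [swap] a total operation. *)
Definition swap (phi : fullB E) (A : set X) : baut :=
  if pselect (swappable phi A) is left h then
    baut_of_involution (swap_funK h) (measurable_swap_fun h) (swap_fun_rel h)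
  else baut_id.

Lemma swap_on phi A x y : swappable phi A -> A x -> phi x = Some y ->
  swap phi A x = y /\ swap phi A y = x.
Proof. by move=> h Ax xy; rewrite /swap; case: pselect => // h' /=; exact: swap_fun_on. Qed.

Definition moved (g : baut) (A : set X) := measurable A /\ forall x, A x -> ~ A (g x).

Definition sw (g : baut) (A : set X) : baut := swap (fullB_of_baut g) A.

Lemma moved_swappable g A : moved g A -> swappable (fullB_of_baut g) A.
Proof. by move=> [mA h]; split=> //= x y Ax [<-]; exact: h. Qed.

Lemma sw_on g A x : moved g A -> A x -> sw g A x = g x.
Proof. by move=> /moved_swappable h Ax; exact: (swap_on h Ax erefl).1. Qed.

Lemma sw_im g A x : moved g A -> A x -> sw g A (g x) = x.
Proof. by move=> /moved_swappable h Ax; exact: (swap_on h Ax erefl).2. Qed.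

Lemma sw_out g A x : moved g A -> ~ A x -> (forall y, A y -> g y <> x) -> sw g A x = x.
Proof.
move=> /moved_swappable h nA nI; rewrite /sw /swap; case: pselect => // h' /=.
case: (swap_funP h' x) => [[y []//]|[[y [Ay [yx] _]]|[_ _ ->]]] //.
by have := nI y Ay.
Qed.

Lemma sw_cases g A x : moved g A -> [\/ A x, exists2 y, A y & x = g y |
  ~ A x /\ forall y, A y -> g y <> x].
Proof.
move=> h; case: (pselect (A x)) => [|nA]; first by constructor 1.
case: (pselect (exists2 y, A y & x = g y)) => [|nI]; first by constructor 2.
by constructor 3; split=> // y Ay yx; apply: nI; exists y.
Qed.

Lemma sub_moved g A B : moved g A -> measurable B -> B `<=` A -> moved g B.
Proof. by move=> [_ h] mB BA; split=> // x /BA /h nA /BA. Qed.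

Section MeasurePreserving.
Context {R : realType}.
Variable mu : probability X R.
Hypothesis E_mp : measure_preserving E mu.

Lemma pr_ainv (g : baut) A : measurable A -> pr mu (ainv g @^-1` A) = pr mu A.
Proof.
move=> mA; rewrite /pr -(E_mp (g := fullB_of_baut g) mA) //=.
by rewrite pimage_baut.
Qed.

Lemma pr_baut (g : baut) A : measurable A -> pr mu (g @^-1` A) = pr mu A.
Proof. exact: (pr_ainv (baut_inv g)). Qed.

End MeasurePreserving.

Lemma measurable_bautneq (cd : coding X) (g h : baut) : measurable [set x | g x <> h x].
Proof.
have := measurable_neqmap cd (fullB_measurable (fullB_of_baut g))
  (fullB_measurable (fullB_of_baut h)).
by rewrite (_ : mkset _ = [set x | g x <> h x]) //; apply/seteqP;
  split=> x /= nE => [e|[e]]; apply: nE; rewrite ?e.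
Qed.

Lemma measurable_bauteq (cd : coding X) (g h : baut) : measurable [set x | g x = h x].
Proof.
rewrite -[mkset _]setCK; apply: measurableC; exact: measurable_bautneq.
Qed.

Lemma measurable_fullB_baut (cd : coding X) (phi : fullB E) (g : baut) :
  measurable [set x | phi x = Some (g x)].
Proof. exact: (measurable_eqmap cd (fullB_measurable phi)
  (fullB_measurable (fullB_of_baut g))). Qed.

End Automorphisms.

(** * Countably many automorphisms cover the relation almost everywhere *)

Section ClosedSections.
Context {d : measure_display} {X : measurableType d}.
Variable cd : coding X.

(** The functions [c] refine the coding of the second variable in such a way that
    the sections of [B] become closed. This is the coded form of the refinement of a
    Polish topology that makes a given Borel set closed. *)
Definition closed_sections (B : set (X * X)) (c : X * X -> nat -> nat) :=
  forall x (z w : nat -> nat),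
    (forall n, exists y, B (x, y) /\
       forall j, (j < n)%N -> cd y j = z j /\ c (x, y) j = w j) ->
    exists y, B (x, y) /\ forall j, cd y j = z j /\ c (x, y) j = w j.

Definition nice (B : set (X * X)) := exists c : X * X -> nat -> nat,
  (forall j k, measurable [set p | c p j = k]) /\ closed_sections B c.

Lemma measurable_cst_prop d' (Y : measurableType d') (Q : Prop) :
  measurable [set x : Y | Q].
Proof.
case: (pselect Q) => h.
  by rewrite (_ : mkset _ = setT) //; apply/seteqP; split.
by rewrite (_ : mkset _ = set0) //; apply/seteqP; split.
Qed.

Lemma nice_cst (B : set (X * X)) n :
  (forall x y y', (forall j, (j < n)%N -> cd y j = cd y' j) -> B (x, y) -> B (x, y')) ->
  nice B.
Proof.
move=> Bn; exists (fun _ _ => 0%N); split; first by move=> j k; exact: measurable_cst_prop.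
move=> x z w h.
have [y yz] : exists y, forall j, cd y j = z j.
  apply: code_closed => m; have [y [_ hy]] := h m.
  by exists y => j /hy[].
exists y; split=> [|j].
  have [y' [By' hy']] := h n; apply: Bn By' => j /hy'[-> _]; by rewrite yz.
by split=> //; have [y' [_ /(_ j (leqnn _))[]]] := h j.+1.
Qed.

(** All refinements are used at once. The limits obtained for the various [B n] are
    the same point, because they have the same code. *)
Lemma nice_bigcap (B : nat -> set (X * X)) :
  (forall n, nice (B n)) -> nice (\bigcap_n B n).
Proof.
move=> /choice[c hc].
pose e p j := if @pickle_inv (nat * nat)%type j is Some ni then c ni.1 p ni.2 else 0%N.
have eP n i p : e p (pickle (n, i)) = c n p i by rewrite /e pickleK_inv.
exists e; split.
  move=> j k; rewrite /e; case: pickle_inv => [[n i]|]; last exact: measurable_cst_prop.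
  by have [mc _] := hc n; exact: mc.
move=> x z w h.
have hn n : exists y, B n (x, y) /\ forall j, cd y j = z j /\ c n (x, y) j = w (pickle (n, j)).
  have [_] := hc n; apply=> m.
  have [y [By hy]] := h (maxn m (\max_(i < m) (pickle (n, nat_of_ord i)).+1)).
  exists y; split; first exact: By.
  move=> j jm; split.
    by have [] // := hy j; rewrite leq_max jm.
  rewrite -eP; apply: (hy _ _).2; rewrite leq_max; apply/orP; right.
  exact: (@leq_bigmax _ (fun i : 'I_m => (pickle (n, nat_of_ord i)).+1) (Ordinal jm)).
have [y [_ hy]] := hn 0%N.
have yn n : B n (x, y) /\ forall j, c n (x, y) j = w (pickle (n, j)).
  have [y' [By' hy']] := hn n.
  have -> : y = y' by apply: (code_inj (c := cd)) => j; rewrite (hy j).1 (hy' j).1.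
  by split=> // j; rewrite (hy' j).2.
exists y; split=> [n _|j]; first by have [] := yn n.
split; first by rewrite (hy j).1.
rewrite /e; case E: pickle_inv => [[n i]|].
  by rewrite (yn n).2; have := @pickle_invK (nat * nat)%type j; rewrite E /= => ->.
by have [y' [_ /(_ j (leqnn _))[_]]] := h j.+1; rewrite /e E.
Qed.

(** The first coordinate of the refinement records which [B n] holds; along a
    convergent sequence it is constant, so that the limit stays in that [B n]. *)
Lemma nice_bigcup (B : nat -> set (X * X)) :
  (forall n, measurable (B n)) -> (forall m n p, B m p -> B n p -> m = n) ->
  (forall n, nice (B n)) -> nice (\bigcup_n B n).
Proof.
move=> mB Bdisj /choice[c hc].
pose idx p := least (fun n => B n p).
(* a shift by one makes room for the index of the set that holds *)
pose e p j := if j is j'.+1 then c (idx p) p j' else idx p.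
have midx k : measurable [set p | idx p = k] by exact: measurable_least.
exists e; split.
  case=> [|j] k /=; first exact: midx.
  rewrite (_ : mkset _ = \bigcup_n ([set p | idx p = n] `&` [set p | c n p j = k])).
    apply: bigcup_measurable => n _; apply: measurableI; first exact: midx.
    by have [mc _] := hc n; exact: mc.
  apply/seteqP; split=> [p /= pk|p [n _ [/= -> //]]].
  by exists (idx p).
move=> x z w h.
have idxP p n : B n p -> idx p = n.
  by move=> Bp; apply: (Bdisj _ _ p) => //; exact: (@least_spec (fun n => B n p) n).
have [y [By hy]] : exists y, B (w 0%N) (x, y) /\
    forall j, cd y j = z j /\ c (w 0%N) (x, y) j = w j.+1.
  have [_] := hc (w 0%N); apply=> m.
  have [y [[n _ Bn] hy]] := h m.+1.
  have n0 : n = w 0%N by have [] := hy 0%N isT; rewrite /e (idxP _ _ Bn).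
  subst n; exists y; split=> // j jm; split.
    by have [] := hy j (leqW jm).
  by have [_] := hy j.+1 jm; rewrite /e (idxP _ _ Bn).
exists y; split; first by exists (w 0%N).
move=> j; split; first by have [] := hy j.
case: j => [|j] /=; first exact: idxP.
by rewrite (idxP _ _ By); have [] := hy j.
Qed.

(** The complement is included because a refinement that closes the sections of [B]
    need not close those of its complement. *)
Definition good (B : set (X * X)) := [/\ measurable B, nice B & nice (~` B)].

(** A union is made disjoint by removing the earlier sets from each set, which is an
    intersection of the sets [F n] and of complements. *)
Lemma good_sigma : sigma_algebra setT good.
Proof.
have gC A : good A -> good (~` A).
  by case=> mA nA nC; split => //; [exact: measurableC|rewrite setCK].
split.
- split=> //; first by apply: (@nice_cst _ 0).
  by apply: (@nice_cst _ 0).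
- by move=> A gA; rewrite setTD; exact: gC.
- move=> F gF.
  have mF n : measurable (F n) by case: (gF n).
  pose D n i := if (i < n)%N then ~` F i else F n.
  have mD n : measurable (\bigcap_i D n i).
    apply: bigcap_measurableType => i _; rewrite /D; case: ifP => _ //.
    exact: measurableC.
  split; first exact: bigcup_measurable.
  + rewrite (_ : \bigcup_k _ = \bigcup_n \bigcap_i D n i).
      apply: nice_bigcup => //.
        have key m n p : (\bigcap_i D m i) p -> (\bigcap_i D n i) p -> (n <= m)%N.
          move=> Dm Dn; rewrite leqNgt; apply/negP => mn.
          have := Dn m I; rewrite /D mn; apply.
          by have := Dm m I; rewrite /D ltnn.
        by move=> m n p Dm Dn; apply/eqP; rewrite eqn_leq !(key _ _ p).
      move=> n; apply: nice_bigcap => i; rewrite /D; case: ifP => _.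
        by case: (gF i).
      by case: (gF n).
    apply/seteqP; split=> [p [n _ Fn]|p [n _ /(_ n I)]]; last first.
      by rewrite /D ltnn; exists n.
    pose m := least (fun n => F n p).
    have Fm : F m p by exact: (@least_spec (fun n => F n p) n).
    exists m => // i _; rewrite /D; case: ifP => // im Fi.
    by have := @least_le (fun n => F n p) i Fi; rewrite leqNgt im.
  + by rewrite setC_bigcup; apply: nice_bigcap => n; case: (gF n).
Qed.

Lemma measurable_good (B : set (X * X)) : measurable B -> good B.
Proof.
apply: smallest_sub => {B}; first exact: good_sigma.
have [g0 gC gU] := good_sigma.
move=> _ [[A mA <-]|[A mA <-]]; rewrite setTI.
- have m1 : measurable (fst @^-1` A : set (X * X)).
    by rewrite -[_ @^-1` _]setTI; exact: measurable_fst.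
  split=> //; first by apply: (@nice_cst _ 0).
  by apply: (@nice_cst _ 0).
- suff : measurable `<=` [set A : set X | good (snd @^-1` A)] by apply.
  apply: (code_generates (c := cd)).
    split=> /=; first by rewrite preimage_set0.
      by move=> C gCC; rewrite setTD preimage_setC -setTD; exact: gC.
    by move=> F gF; rewrite preimage_bigcup; exact: gU.
  move=> j k /=; split.
  + by rewrite -[_ @^-1` _]setTI; apply: measurable_snd => //; exact: code_measurable.
  + by apply: (@nice_cst _ j.+1) => x y y' /(_ j (leqnn _)); rewrite /preimage /= => ->.
  + by apply: (@nice_cst _ j.+1) => x y y' /(_ j (leqnn _)); rewrite /preimage /= => ->.
Qed.

End ClosedSections.

(** A simultaneous essential supremum: each [F i] is monotone, so the union of
    countably many nearly optimal sets is optimal for every [i]. *)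
Lemma countable_max (R : realType) (T : Type) (I : countType) (F : I -> set T -> R) :
  (forall i A, countable A -> 0 <= F i A <= 1) ->
  (forall i A B, countable B -> A `<=` B -> F i A <= F i B) ->
  exists Q, countable Q /\ forall i Q', countable Q' -> F i Q' <= F i Q.
Proof.
move=> F01 Fle.
pose S i := [set F i A | A in [set A | countable A]].
have S0 i : has_sup (S i).
  split; first by exists (F i set0); exists set0 => //=; exact: countable0.
  by exists 1 => _ [A cA <-]; case/andP: (F01 i A cA).
have near i n : exists A, countable A /\ sup (S i) - n.+1%:R^-1 < F i A.
  have n0 : 0 < n.+1%:R^-1 :> R by rewrite invr_gt0.
  by have [_ [A cA <-] lt] := sup_adherent n0 (S0 i); exists A.
have /choice[A hA] : forall ni : I * nat, exists A, countable A /\ sup (S ni.1) - ni.2.+1%:R^-1 < F ni.1 A.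
  by move=> ni; exact: near.
exists (\bigcup_ni A ni); split.
  by apply: bigcup_countable => // i _; have [] := hA i.
move=> i Q' cQ'.
have h : F i Q' <= sup (S i) by apply: ub_le_sup; [exact: (S0 i).2|exists Q'].
apply: (le_trans h).
suff key (e : R) : 0 < e -> sup (S i) <= e + F i (\bigcup_ni A ni).
  by apply/ler_addgt0Pl => e /key.
move=> e0.
have /filter_ex[n /= ne0] := near_infty_natSinv_lt (PosNum e0).
have ne : n.+1%:R^-1 < e := ne0.
have [_ /= lt] := hA (i, n).
have le : F i (A (i, n)) <= F i (\bigcup_ni A ni).
  apply: Fle; last by move=> t At; exists (i, n).
  by apply: bigcup_countable => // j _; have [] := hA j.
by move: (n.+1%:R^-1) ne lt => r ne lt; lra.
Qed.

Section CountableCover.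
Context {R : realType} {d : measure_display} {X : measurableType d}.
Variables (cd : coding X) (E : cber X) (mu : probability X R).

Lemma countable_bigcup_meas (T : Type) (A : set T) (F : T -> set X) :
  countable A -> (forall t, measurable (F t)) -> measurable (\bigcup_(t in A) F t).
Proof.
move=> cA mF; case: (pselect (exists a, A a)) => [[a Aa]|nA]; last first.
  rewrite (_ : \bigcup_(t in A) F t = set0) //.
  by apply/seteqP; split=> x // [t At]; case: nA; exists t.
have [f [fA Af]] := countable_enum cA Aa.
rewrite (_ : \bigcup_(t in A) F t = \bigcup_n F (f n)); first exact: bigcup_measurable.
apply/seteqP; split=> [x [t /Af[n <-]]|x [n _ Ft]]; first by exists n.
by exists (f n).
Qed.

Lemma measurable_graph_preimage (g : baut E) (C : set (X * X)) :
  measurable C -> measurable [set x | C (x, g x)].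
Proof.
move=> mC.
have mg : measurable_fun setT (fun x => (x, g x)).
  apply: measurable_fun_pair; first exact: measurable_id.
  by move=> _ B mB; rewrite setTI; exact: measurable_afun.
by have := mg measurableT _ mC; rewrite setTI.
Qed.

(** Suppose that [Q0] is as large as possible, in the sense of measure, and that some
    automorphism takes a set of positive measure outside the values of [Q0]. Let [Q1]
    be a countable set that exhausts what can still be reached outside [Q0], and [Q2]
    one that exhausts what can be reached outside [Q0] and [Q1]. By maximality of
    [Q0] the same points [x] are involved, for every finite beginning [s] of the code
    of the value. At almost every such [x], any [s] that occurs is thus continued
    by two distinct points of the class of [x], one reached by [Q1] and one by [Q2],
    and one of the two differs from any prescribed point. So one builds step by step
    a code that differs from those of all the points of an enumeration of the class
    of [x]. Since the sections of the relation are closed for the refined coding,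
    this is the code of a point of the class, a contradiction. *)
Theorem countable_cover : exists Q : set (baut E), countable Q /\
  forall g : baut E, pr mu [set x | forall q, Q q -> q x <> g x] = 0.
Proof.
have [_ [c [mc cc]] _] := measurable_good cd (cber_measurable E).
pose word x y j := (cd y j, c (x, y) j).
pose V (s : seq (nat * nat)) (g : baut E) := [set x | forall j, (j < size s)%N ->
  word x (g x) j = nth (0, 0)%N s j].
have mV s g : measurable (V s g).
  rewrite (_ : V s g = \bigcap_(j in `I_(size s)) [set x | word x (g x) j = nth (0,0)%N s j]) //.
  apply: bigcap_measurableType => j _; case: (nth _ _ _) => k l.
  rewrite (_ : mkset _ = (g @^-1` [set y | cd y j = k]) `&` [set x | c (x, g x) j = l]).
    apply: measurableI; first exact/measurable_afun/code_measurable.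
    exact: (measurable_graph_preimage g (mc j l)).
  by apply/seteqP; split=> x; rewrite /word /preimage /= => -[-> ->].
pose N (Q : set (baut E)) (g : baut E) := [set x | forall q, Q q -> q x <> g x].
have mN Q g : countable Q -> measurable (N Q g).
  move=> cQ; rewrite (_ : N Q g = ~` \bigcup_(q in Q) [set x | q x = g x]).
    apply: measurableC; apply: countable_bigcup_meas => // q.
    exact: measurable_bauteq.
  apply/seteqP; split=> [x Nx [q Qq]|x nU q Qq e]; first exact: Nx.
  by apply: nU; exists q.
(* points that [Q'] sends, along the beginning [s], to values not reached by [Q] *)
pose W Q s Q' := \bigcup_(g in Q') (V s g `&` N Q g).
have mW Q s Q' : countable Q -> countable Q' -> measurable (W Q s Q').
  move=> cQ cQ'; apply: countable_bigcup_meas => // g; apply: measurableI => //.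
  exact: mN.
have W01 Q s Q' : countable Q -> countable Q' -> 0 <= pr mu (W Q s Q') <= 1.
  by move=> cQ cQ'; rewrite pr_ge0 pr_le1 //; exact: mW.
have Wle Q1 Q2 s Q' Q'' : countable Q1 -> countable Q'' -> Q1 `<=` Q2 -> Q' `<=` Q'' ->
    W Q2 s Q' `<=` W Q1 s Q''.
  move=> cQ cQ' QQ Q'Q'' x [g Qg [Vx Nx]]; exists g; first exact: Q'Q''.
  by split=> // q /QQ; exact: Nx.
have maxW Q : countable Q -> exists Q1, countable Q1 /\
    forall s Q', countable Q' -> pr mu (W Q s Q') <= pr mu (W Q s Q1).
  move=> cQ; apply: (@countable_max R _ _ (fun s Q' => pr mu (W Q s Q'))).
    by move=> s A cA; exact: W01.
  move=> s A B cB AB; apply: le_pr; [apply: mW => //|exact: mW|exact: Wle].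
  by apply: sub_countable cB; exact: subset_card_le.
have /choice[S SP] : forall Q, exists Q1, countable Q ->
    countable Q1 /\ forall s Q', countable Q' -> pr mu (W Q s Q') <= pr mu (W Q s Q1).
  move=> Q; case: (pselect (countable Q)) => [/maxW[Q1 h]|nc]; first by exists Q1.
  by exists set0.
have [Q0 [cQ0 minQ0]] : exists Q0, countable Q0 /\ forall s Q, countable Q ->
    1 - pr mu (W Q s (S Q)) <= 1 - pr mu (W Q0 s (S Q0)).
  apply: (@countable_max R _ _ (fun s Q => 1 - pr mu (W Q s (S Q)))).
    move=> s Q cQ; have [cS _] := SP Q cQ.
    by have /andP[] := W01 Q s _ cQ cS; lra.
  move=> s A B cB AB.
  have cA : countable A by apply: sub_countable cB; exact: subset_card_le.
  have [cSA hA] := SP A cA; have [cSB hB] := SP B cB.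
  rewrite lerD2l lerN2; apply: le_trans (hA s (S B) cSB).
  by apply: le_pr; [exact: mW|exact: mW|exact: Wle].
have [cQ1 hQ1] := SP Q0 cQ0; set Q1 := S Q0 in cQ1 hQ1.
have cQ01 : countable (Q0 `|` Q1) by exact: countable_setU.
have [cQ2 hQ2] := SP _ cQ01; set Q2 := S (Q0 `|` Q1) in cQ2 hQ2.
pose A s := W Q0 s Q1; pose B s := W (Q0 `|` Q1) s Q2.
have mA s : measurable (A s) by exact: mW.
have mB s : measurable (B s) by exact: mW.
have prAB s : pr mu (A s) <= pr mu (B s).
  by have := minQ0 s _ cQ01; rewrite -/Q1 -/Q2 -/(A s) -/(B s); lra.
have BA0 s : pr mu (B s `\` A s) = 0.
  apply/eqP; rewrite eq_le pr_ge0 andbT.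
  have cQ12 : countable (Q1 `|` Q2) by exact: countable_setU.
  have := hQ1 s _ cQ12; rewrite -/(A s).
  have : pr mu (A s) + pr mu (B s `\` A s) <= pr mu (W Q0 s (Q1 `|` Q2)).
    have mD : measurable (B s `\` A s) by exact: measurableD.
    rewrite -prU //; last by apply/seteqP; split=> x // [? []].
    apply: le_pr; [exact: measurableU|exact: mW|].
    move=> x [|[Bx _]]; first by apply: Wle => //; exact: subsetUl.
    by apply: Wle Bx.
  lra.
have AB0 s : pr mu (A s `\` B s) = 0.
  have := prID mu (mA s) (mB s); have := prID mu (mB s) (mA s).
  rewrite setIC BA0; have := prAB s; have := pr_ge0 mu (A s `\` B s); lra.
pose D n := if @unpickle (seq (nat * nat)) n is Some s
  then (A s `\` B s) `|` (B s `\` A s) else set0.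
(* the construction by steps: no point of [A [::]] lies outside the null set *)
have A0 : A [::] `<=` \bigcup_n D n.
  move=> x Ax; apply: contrapT => nU.
  have AB s : A s x -> B s x.
    move=> Asx; apply: contrapT => nB; apply: nU; exists (pickle s) => //.
    by rewrite /D pickleK; left.
  have BA s : B s x -> A s x.
    move=> Bsx; apply: contrapT => nA; apply: nU; exists (pickle s) => //.
    by rewrite /D pickleK; right.
  have [y [yE yP]] := countable_enum (cber_countable E x) (cber_refl E x).
  pose ext s s' := [/\ (size s < size s')%N, take (size s) s' = s, A s' x &
     exists y, E x y /\ forall j, (j < size s')%N -> word x y j = nth (0,0)%N s' j].
  have step k s : A s x -> exists s', [/\ (size s < size s')%N, (k < size s')%N,
      forall j, (j < size s)%N -> nth (0,0)%N s' j = nth (0,0)%N s j, A s' x &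
      exists2 j, (j < size s')%N & word x (y k) j <> nth (0,0)%N s' j].
    move=> Asx.
    have [g Q1g [Vg Ng]] := Asx; have [h Q2h [Vh Nh]] := AB s Asx.
    have gh : g x <> h x by apply: Nh; right.
    (* a beginning of the code of [z] long enough to tell [z] from [y k]; the maxima also
       make its length exceed [k] and the size of [s] *)
    have pref z : z <> y k -> exists n, [/\ (size s < n)%N, (k < n)%N &
        exists2 j, (j < n)%N & word x (y k) j <> word x z j].
      move=> zy; have [j jP] : exists j, cd z j <> cd (y k) j.
        apply: contrapT => nj; apply: zy; apply: (code_inj (c := cd)) => j.
        by apply: contrapT => hj; apply: nj; exists j.
      exists (maxn (maxn j k) (size s)).+1; split.
      + by rewrite ltnS leq_maxr.
      + by rewrite ltnS leq_max leq_maxr.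
      + by exists j; [rewrite ltnS leq_max leq_maxl|move=> [/esym]].
    pose u z n := mkseq (word x z) n.
    have uV z n j : (j < n)%N -> nth (0,0)%N (u z n) j = word x z j by move=> jn; rewrite nth_mkseq.
    have concl z : (forall j, (j < size s)%N -> word x z j = nth (0,0)%N s j) ->
        (forall n, A (u z n) x) -> z <> y k -> exists s', [/\ (size s < size s')%N, (k < size s')%N,
      forall j, (j < size s)%N -> nth (0,0)%N s' j = nth (0,0)%N s j, A s' x &
      exists2 j, (j < size s')%N & word x (y k) j <> nth (0,0)%N s' j].
      move=> zs Az /pref[n [sn kn [j jn zj]]]; exists (u z n).
      rewrite size_mkseq; split=> //.
      + by move=> i si; rewrite uV ?zs //; exact: ltn_trans sn.
      + by exists j => //; rewrite uV.
    case: (pselect (g x = y k)) => [gy|]; last first.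
      apply: concl => // n; exists g => //; split=> // j.
      by rewrite size_mkseq => jn; rewrite uV.
    apply: (concl (h x)) => //; last by rewrite -gy => /esym.
    move=> n; apply: BA; exists h => //; split=> // j.
    by rewrite size_mkseq => jn; rewrite uV.
  have /choice[nxt nxtP] : forall ks : nat * seq (nat * nat), exists s', A ks.2 x ->
      [/\ (size ks.2 < size s')%N, (ks.1 < size s')%N,
      forall j, (j < size ks.2)%N -> nth (0,0)%N s' j = nth (0,0)%N ks.2 j, A s' x &
      exists2 j, (j < size s')%N & word x (y ks.1) j <> nth (0,0)%N s' j].
    move=> [k s] /=; case: (pselect (A s x)) => [/(step k)[s' h]|nA]; first by exists s'.
    by exists [::].
  pose t := fix t k := if k is k'.+1 then nxt (k', t k') else [::].
  have tA k : A (t k) x by elim: k => //= k IH; have [] := nxtP (k, t k) IH.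
  have tP k := nxtP (k, t k) (tA k).
  have tle k l j : (k <= l)%N -> (j < size (t k))%N ->
      (j < size (t l))%N /\ nth (0,0)%N (t l) j = nth (0,0)%N (t k) j.
    move=> kl jk; elim: l kl => [|l IH]; first by rewrite leqn0 => /eqP <-.
    rewrite leq_eqVlt => /predU1P[<-//|/IH[jl e]].
    have [s1 _ s2 _ _] := tP l; split; first exact: ltn_trans jl s1.
    by rewrite -e; exact: s2.
  have tsz k : (k < size (t k.+1))%N by have [] := tP k.
  pose lim j := nth (0,0)%N (t j.+1) j.
  have limE k j : (j < size (t k))%N -> nth (0,0)%N (t k) j = lim j.
    move=> jk; rewrite /lim; case: (leqP k j.+1) => [kj|/ltnW jk'].
      by have [_ ->] := tle _ _ _ kj jk.
    by have [_ ->] := tle _ _ _ jk' (tsz j).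
  have [z [Exz hz]] : exists z, E x z /\ forall j, cd z j = (lim j).1 /\ c (x, z) j = (lim j).2.
    apply: cc => n; have [g _ [Vg _]] := tA n.
    exists (g x); split; first exact: baut_rel.
    move=> j jn; have jt : (j < size (t n))%N.
      case: n jn {Vg} => // n; rewrite ltnS => jn; exact: leq_ltn_trans (tsz n).
    have := Vg j jt; rewrite limE // /word => <-; by [].
  have [k ykz] := yP z Exz.
  have [_ _ _ _ [j js]] := tP k; apply; rewrite ykz (limE k.+1 j js) /word.
  by rewrite (hz j).1 (hz j).2; case: (lim j).
have mD n : measurable (D n).
  rewrite /D; case: unpickle => [s|//].
  by apply: measurableU; exact: measurableD.
have D0 : pr mu (\bigcup_n D n) = 0.
  apply: pr_bigcup0 => // n; rewrite /D; case: unpickle => [s|]; last exact: pr0.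
  rewrite prU ?AB0 ?BA0 ?addr0 //; [exact: measurableD|exact: measurableD|].
  by apply/seteqP; split=> x // [[_ ?] [? _]].
have prA0 : pr mu (A [::]) = 0.
  by apply: pr_sub0 A0 D0 => //; exact: bigcup_measurable.
exists Q0; split=> // g; apply/eqP; rewrite eq_le pr_ge0 andbT -prA0.
apply: le_trans (hQ1 [::] [set g] (countable1 g)).
apply: le_pr; [exact: mN|by apply: mW => //; exact: countable1|].
by move=> x Nx; exists g.
Qed.

End CountableCover.

(** * Quotients of pseudometrics, distances of partial bijections *)

Section Quotient.
Variables (R : realType) (T : Type) (D : T -> T -> R).
Hypotheses (D0 : forall x, D x x = 0) (Dsym : forall x y, D x y = D y x)
  (Dtri : forall x y z, D x z <= D x y + D y z).

Lemma pseudo_ge0 x y : 0 <= D x y.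
Proof. by have := Dtri x y x; rewrite D0 (Dsym y x); lra. Qed.

Lemma mquot_eq (C C' : mquot D) : mqset C = mqset C' -> C = C'.
Proof.
case: C C' => [A hA] [B hB] /= AB; subst B; congr MQuot; exact: Prop_irrelevance.
Qed.

Lemma mclass_eq x y : D x y = 0 -> mclass D x = mclass D y.
Proof.
move=> xy; apply: mquot_eq; apply/seteqP; split=> z /= xz; apply/eqP;
  rewrite eq_le pseudo_ge0 andbT.
  by have := Dtri y x z; rewrite xz (Dsym y x) xy; lra.
by have := Dtri x y z; rewrite xz xy; lra.
Qed.

Lemma mqset_mrepr (C : mquot D) : mqset C = [set y | D (mrepr C) y = 0].
Proof. exact: (projT2 (cid (mqsetP C))). Qed.

Lemma mrepr_mclass x : D (mrepr (mclass D x)) x = 0.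
Proof.
have : mqset (mclass D x) x by rewrite /=.
by rewrite mqset_mrepr.
Qed.

Lemma pseudo_congr x x' y y' : D x x' = 0 -> D y y' = 0 -> D x y = D x' y'.
Proof.
move=> xx yy; have := Dtri x x' y; have := Dtri x' y' y.
have := Dtri x' x y'; have := Dtri x y y'.
by rewrite (Dsym x' x) (Dsym y' y) xx yy; lra.
Qed.

Lemma mdist_mclass x y : Defs.mdist (mclass D x) (mclass D y) = D x y.
Proof. by apply: pseudo_congr; exact: mrepr_mclass. Qed.

End Quotient.

(** The set where only one of the maps is defined and the set where both are defined
    and differ are disjoint, and together they form the set where [f] and [g] differ
    as total maps into the option type. *)
Lemma pdistE (R : realType) (X : Type) (m : set X -> R) (f g : X -> option X) :
  (m ((pdom f `+` pdom g) `|` pdisagree f g) =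
    m (pdom f `+` pdom g) + m (pdisagree f g)) ->
  pdist m f g = m [set x | f x <> g x].
Proof.
rewrite /pdist => <-; congr m; apply/seteqP; split=> x; rewrite /pdom /=.
  by rewrite /pdisagree /setY /setD /=; case: (f x) => [y|]; case: (g x) => [z|] //= [[]|[]] // [].
rewrite /pdisagree /pdom /setY /setD /=.
case: (f x) => [y|]; case: (g x) => [z|] //= n.
- by right.
- by left; left.
- by left; right.
Qed.

Lemma pdist_disj (X : Type) (f g : X -> option X) :
  (pdom f `+` pdom g) `&` pdisagree f g = set0.
Proof. by apply/seteqP; split=> x // [[[_ nf]|[_ ng]] []]. Qed.

Section MuSharp.
Variables (R : realType) (N : nat).
Notation ms := (@mu_sharp R N).

Lemma ms_ge0 A : 0 <= ms A.
Proof. by rewrite /mu_sharp divr_ge0. Qed.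

Lemma ms_le A B : A `<=` B -> ms A <= ms B.
Proof.
move=> AB; rewrite /mu_sharp ler_wpM2r ?invr_ge0 // ler_nat.
by apply/subset_leq_card/fintype.subsetP => x; rewrite !inE; exact: AB.
Qed.

Lemma msU A B : A `&` B = set0 -> ms (A `|` B) = ms A + ms B.
Proof.
move=> AB; rewrite /mu_sharp -mulrDl -natrD; congr (_%:R / _).
rewrite -cardUI [X in (_ = _ + X)%N]eq_card0 ?addn0.
  by apply: eq_card => x; rewrite !inE in_setU.
move=> x; rewrite !inE; apply/negP => /andP[/set_mem Ax /set_mem Bx].
by have : (A `&` B) x by []; rewrite AB.
Qed.

Lemma ms0 : ms set0 = 0.
Proof.
rewrite /mu_sharp (_ : #|_| = 0%N) ?mul0r //.
by apply: eq_card0 => x; rewrite !inE in_set0.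
Qed.

Lemma msT : (0 < N)%N -> ms setT = 1.
Proof.
move=> N0; rewrite /mu_sharp (_ : #|_| = N) ?divff // ?pnatr_eq0 -?lt0n //.
by rewrite -[RHS]card_ord; apply: eq_card => x; rewrite !inE in_setT.
Qed.

Lemma msU_le A B : ms (A `|` B) <= ms A + ms B.
Proof.
rewrite (_ : A `|` B = A `|` (B `\` A)); last by rewrite setDE setUIr setUv setIT.
rewrite msU; last by apply/seteqP; split=> x // [? []].
by rewrite lerD2l; apply: ms_le; exact: subDsetl.
Qed.

Lemma ms_inj (A B : set 'I_N) (f : 'I_N -> 'I_N) :
  {in A &, injective f} -> (forall x, A x -> B (f x)) -> ms A <= ms B.
Proof.
move=> fi fAB; rewrite /mu_sharp ler_wpM2r ?invr_ge0 // ler_nat.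
rewrite -(card_in_image (f := f)); last by move=> x y xA yA; exact: fi.
apply/subset_leq_card/fintype.subsetP => y /fintype.imageP[x xA ->].
by rewrite -[_ \in _]/(f x \in B); apply/mem_set/fAB; exact: (set_mem xA).
Qed.

Lemma ms_perm (s : 'S_N) A : ms (s @^-1` A) = ms A.
Proof.
apply/eqP; rewrite eq_le; apply/andP; split.
  by apply: (@ms_inj _ _ s) => // x y _ _; exact: perm_inj.
apply: (@ms_inj _ _ (s^-1)%g) => [x y _ _|x Ax]; first exact: perm_inj.
by rewrite /preimage /= permKV.
Qed.

Lemma d_sharpE (f g : pbij 'I_N) : d_sharp R f g = ms [set x | f x <> g x].
Proof. by rewrite /d_sharp pdistE // msU // pdist_disj. Qed.

Lemma d_sharp_ge0 (f g : pbij 'I_N) : 0 <= d_sharp R f g.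
Proof. by rewrite d_sharpE ms_ge0. Qed.

Lemma d_sharp0 (f : pbij 'I_N) : d_sharp R f f = 0.
Proof.
rewrite d_sharpE (_ : mkset _ = set0) ?ms0 //.
by apply/seteqP; split.
Qed.

Lemma d_sharpC (f g : pbij 'I_N) : d_sharp R f g = d_sharp R g f.
Proof.
by rewrite !d_sharpE; congr ms; apply/seteqP; split=> x /= h /esym.
Qed.

Lemma d_sharp_tri (g f h : pbij 'I_N) : d_sharp R f h <= d_sharp R f g + d_sharp R g h.
Proof.
rewrite !d_sharpE; apply: le_trans (msU_le _ _); apply: ms_le => x /= fh.
by apply: contrapT => /not_orP[/contrapT fg /contrapT gh]; apply: fh; rewrite fg.
Qed.

(** Where the composites differ, either [g] and [g'] do, or [g] leads to a point where
    [f] and [f'] differ; as [g] is injective, the latter set is no larger than the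
    set of these points. *)
Lemma d_sharp_comp (f f' g g' : pbij 'I_N) :
  d_sharp R (pbij_comp f g) (pbij_comp f' g') <= d_sharp R f f' + d_sharp R g g'.
Proof.
pose M := [set x | g x = g' x /\ exists2 y, g x = Some y & f y <> f' y].
rewrite [_ + d_sharp _ _ _]addrC !d_sharpE.
have MD : ms M <= ms [set x | f x <> f' x].
  apply: (@ms_inj _ _ (fun x => odflt x (g x))) => [x y|x [_ [y gx] fy]]; last by rewrite gx.
  move=> /set_mem[_ [x' gx _]] /set_mem[_ [y' gy _]]; rewrite gx gy /= => xy.
  by subst y'; exact: (pbij_inj gx gy).
apply: le_trans (lerD (lexx _) MD); apply: le_trans (msU_le _ _); apply: ms_le => x /=.
rewrite /pcomp => h; case: (pselect (g x = g' x)) => e; last by left.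
right; split=> //; move: h; rewrite -e; case: (g x) => [y|//] /= h.
by exists y.
Qed.

Definition dperm (s t : 'S_N) : R := d_sharp R (pbij_of_perm s) (pbij_of_perm t).

Lemma dpermE s t : dperm s t = ms [set x | s x <> t x].
Proof.
rewrite /dperm d_sharpE; congr ms; apply/seteqP; split=> x /= h e; apply: h.
  by rewrite /= e.
by case: e.
Qed.

Lemma dpermMl (s t u : 'S_N) : dperm (u * s)%g (u * t)%g = dperm s t.
Proof.
rewrite !dpermE -(ms_perm u [set x | s x <> t x]); congr ms.
by apply/seteqP; split=> x; rewrite /preimage /= !permM.
Qed.

Lemma dpermMr (s t u : 'S_N) : dperm (s * u)%g (t * u)%g = dperm s t.
Proof.
rewrite !dpermE; congr ms; apply/seteqP; split=> x /=; rewrite !permM => h e; apply: h.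
  by rewrite e.
exact: perm_inj e.
Qed.

Lemma pbij_of_permM (s t : 'S_N) x :
  pbij_comp (pbij_of_perm s) (pbij_of_perm t) x = pbij_of_perm (t * s)%g x.
Proof. by rewrite /= /pcomp /= permM. Qed.

End MuSharp.

Section DMu.
Context {R : realType} {d : measure_display} {X : measurableType d}.
Variables (cd : coding X) (E : cber X) (mu : probability X R).
Hypothesis E_mp : measure_preserving E mu.
Implicit Types f g h : fullB E.

Lemma measurable_fullB_neq f g : measurable [set x | f x <> g x].
Proof. exact: (measurable_neqmap cd (fullB_measurable f) (fullB_measurable g)). Qed.

Lemma d_muE f g : d_mu mu f g = pr mu [set x | f x <> g x].
Proof.
rewrite /d_mu pdistE // -/(pr mu _) prU ?pdist_disj //.
- by apply: measurableU; apply: measurableD; exact: fullB_mdom.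
- rewrite (_ : pdisagree f g = pdom f `&` pdom g `&` [set x | f x <> g x]).
    apply: measurableI; last exact: measurable_fullB_neq.
    by apply: measurableI; exact: fullB_mdom.
  by apply/seteqP; split=> x; [case=> ? ? ?|case=> [[? ?] ?]].
Qed.

Lemma d_mu0 f : d_mu mu f f = 0.
Proof. by rewrite d_muE (_ : mkset _ = set0) ?pr0 //; apply/seteqP; split. Qed.

Lemma d_muC f g : d_mu mu f g = d_mu mu g f.
Proof. by rewrite !d_muE; congr pr; apply/seteqP; split=> x /= h /esym. Qed.

Lemma d_mu_tri f g h : d_mu mu f h <= d_mu mu f g + d_mu mu g h.
Proof.
rewrite !d_muE.
apply: le_trans (prU_le mu (measurable_fullB_neq f g) (measurable_fullB_neq g h)).
apply: le_pr; [exact: measurable_fullB_neq| |].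
  by apply: measurableU; exact: measurable_fullB_neq.
move=> x /= fh.
by apply: contrapT => /not_orP[/contrapT fg /contrapT gh]; apply: fh; rewrite fg.
Qed.

Lemma pr_ppreimage_le f A : measurable A -> pr mu (ppreimage f A) <= pr mu A.
Proof.
move=> mA; have mp : measurable (ppreimage f A) by exact: fullB_measurable.
have sub : ppreimage f A `<=` pdom f by move=> x [y _]; rewrite /pdom /= => ->.
rewrite /pr -(E_mp mp sub) -/(pr mu _); apply: le_pr => //.
  exact: fullB_mimage.
by move=> y [x [z Az fx]]; rewrite fx => -[<-].
Qed.

Lemma d_mu_comp f f' g g' :
  d_mu mu (fullB_comp f g) (fullB_comp f' g') <= d_mu mu f f' + d_mu mu g g'.
Proof.
have mff : measurable [set x | f x <> f' x] by exact: measurable_fullB_neq.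
have mgg : measurable [set x | g x <> g' x] by exact: measurable_fullB_neq.
rewrite [_ + d_mu _ _ _]addrC !d_muE.
apply: le_trans (lerD (lexx _) (pr_ppreimage_le g mff)).
have mp : measurable (ppreimage g [set x | f x <> f' x]) by exact: fullB_measurable.
apply: le_trans (prU_le mu mgg mp); apply: le_pr.
- exact: measurable_fullB_neq.
- exact: measurableU.
move=> x /=; rewrite /pcomp => h; case: (pselect (g x = g' x)) => e; last by left.
right; move: h; rewrite -e /ppreimage /=; case: (g x) => [y|//] /= h.
by exists y.
Qed.

(** Products of classes are computed on representatives; the choice is immaterial by
    [d_mu_comp]. *)
Lemma fs_mulE f g : fs_mul (mclass (d_mu mu) f) (mclass (d_mu mu) g) =
  mclass (d_mu mu) (fullB_comp f g).
Proof.
apply: (mclass_eq d_mu0 d_muC d_mu_tri); apply/eqP.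
rewrite eq_le (pseudo_ge0 d_mu0 d_muC d_mu_tri) andbT.
apply: le_trans (d_mu_comp _ _ _ _) _.
by rewrite !(mrepr_mclass d_mu0) addr0.
Qed.

Lemma measurable_pfix f : measurable (pfix f).
Proof. exact: (measurable_fullB_baut cd f (baut_id E)). Qed.

Lemma fs_fixE f : fs_fix (mclass (d_mu mu) f) = pr mu (pfix f).
Proof.
rewrite /fs_fix; set g := mrepr _.
have mn h h' : measurable [set x | h x <> h' x] by exact: measurable_fullB_neq.
have le h h' : d_mu mu h h' = 0 -> pr mu (pfix h) <= pr mu (pfix h').
  rewrite d_muE => hh; rewrite -[leRHS]addr0 -hh.
  apply: le_trans (prU_le mu (measurable_pfix h') (mn h h')).
  apply: le_pr; [exact: measurable_pfix|apply: measurableU => //; exact: measurable_pfix|].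
  move=> x /= hx; case: (pselect (h x = h' x)) => e; last by right.
  by left; rewrite /pfix /= -e.
have e : d_mu mu g f = 0 by exact: (mrepr_mclass d_mu0).
by apply/eqP; rewrite eq_le !le // d_muC.
Qed.

Lemma d_mu_baut (g h : baut E) :
  d_mu mu (fullB_of_baut g) (fullB_of_baut h) = pr mu [set x | g x <> h x].
Proof.
rewrite d_muE; congr pr; apply/seteqP; split=> x /= n e; apply: n; first by rewrite e.
by case: e.
Qed.

End DMu.

(** * Separability of the full group *)

Section Local.
Context {d : measure_display} {X : measurableType d}.
Variables (cd : coding X) (E : cber X).

(** Where [phi x <> x], some coordinate of the codes differs. This cuts the part of
    the domain moved by [phi] into countably many sets disjoint from their images, on
    each of which [phi] agrees with a swap. *)
Lemma fullB_local (phi : fullB E) : exists g : nat -> baut E,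
  forall x, pdom phi x -> exists n, phi x = Some (g n x).
Proof.
pose A j k := [set x | cd x j = k] `&` ppreimage phi (~` [set y | cd y j = k]).
have swA j k : swappable phi (A j k).
  split.
  - apply: measurableI; first exact: code_measurable.
    apply: fullB_measurable; apply: measurableC; exact: code_measurable.
  - by move=> x [_ [y _]]; rewrite /pdom /= => ->.
  - by move=> x y [_ [z nz ->]] [<-] [].
pose h (i : option (nat * nat)) := if i is Some jk then swap phi (A jk.1 jk.2) else baut_id E.
pose G n := if @unpickle (option (nat * nat)%type) n is Some i then h i else baut_id E.
have GP i : G (pickle i) = h i by rewrite /G pickleK.
exists G.
move=> x; rewrite /pdom /=; case fx: (phi x) => [y|//] _.
case: (pselect (x = y)) => [<-|xy].
  by exists (pickle (@None (nat * nat)%type)); rewrite GP.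
have [j jxy] : exists j, cd y j <> cd x j.
  apply: contrapT => nj; apply: xy; apply: (code_inj (c := cd)) => j.
  by apply: contrapT => hj; apply: nj; exists j => /esym.
exists (pickle (Some (j, cd x j))); rewrite GP /=.
have Ax : A j (cd x j) x by split=> //; exists y.
by have [->] := swap_on (swA j (cd x j)) Ax fx.
Qed.

(** If [u x <> v x], some coordinate of the codes of the two values differs. On the
    set where that coordinate is [k] for [u x] and not [k] for [v x], the images
    under [u] and [v] are disjoint. *)
Lemma separate (u v : baut E) : exists S : nat -> set X,
  [/\ forall n, measurable (S n), forall n x y, S n x -> S n y -> u x <> v y &
      forall x, u x <> v x -> exists n, S n x].
Proof.
pose A j k := (u @^-1` [set x | cd x j = k]) `&` (v @^-1` (~` [set y | cd y j = k])).
exists (fun n => if unpickle n is Some (j, k) then A j k else set0); split.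
- move=> n; case: unpickle => [[j k]|//]; apply: measurableI; apply: measurable_afun.
    exact: code_measurable.
  by apply: measurableC; exact: code_measurable.
- by move=> n x y; case: unpickle => [[j k]|//] [/= ux _] [_ /= vy] e; apply: vy; rewrite -e.
- move=> x uv.
  have [j jxy] : exists j, cd (v x) j <> cd (u x) j.
    apply: contrapT => nj; apply: uv; apply: (code_inj (c := cd)) => j.
    by apply: contrapT => hj; apply: nj; exists j => /esym.
  by exists (pickle (j, cd (u x) j)); rewrite pickleK.
Qed.

Section Dense.
Context {R : realType}.
Variable mu : probability X R.

(** A countable algebra of sets. The single operation [~ (a \/ b)] generates all
    Boolean combinations, and finite trees are countable. *)
Fixpoint nor_set (t : GenTree.tree (nat * nat)) : set X :=
  match t with
  | GenTree.Leaf jk => [set x | cd x jk.1 = jk.2]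
  | GenTree.Node _ [:: a; b] => ~` (nor_set a `|` nor_set b)
  | _ => set0
  end.

Definition approx (A : set X) := measurable A /\ forall eps, 0 < eps ->
  exists t, measurable (nor_set t) /\ pr mu (A `+` nor_set t) < eps.

Lemma measurableY (A B : set X) : measurable A -> measurable B -> measurable (A `+` B).
Proof. by move=> mA mB; apply: measurableU; exact: measurableD. Qed.

Lemma pr_symdiff_le (A B C : set X) : measurable A -> measurable B -> measurable C ->
  pr mu (A `+` C) <= pr mu (A `+` B) + pr mu (B `+` C).
Proof.
move=> mA mB mC.
apply: le_trans (prU_le mu (measurableY mA mB) (measurableY mB mC)).
apply: le_pr; [exact: measurableY|by apply: measurableU; exact: measurableY|].
move=> x [[Ax nC]|[Cx nA]]; case: (pselect (B x)) => Bx.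
- by right; left.
- by left; left.
- by left; right.
- by right; right.
Qed.

Lemma approxC A : approx A -> approx (~` A).
Proof.
move=> [mA hA]; split=> [|e e0]; first exact: measurableC.
have [t [mt lt]] := hA e e0; exists (GenTree.Node 0 [:: t; t]) => /=.
rewrite setUid; split; first exact: measurableC.
rewrite (_ : _ `+` _ = A `+` nor_set t) //.
by rewrite /setY !setDE !setCK setUC setIC [X in _ `|` X]setIC.
Qed.

Lemma approxU A B : approx A -> approx B -> approx (A `|` B).
Proof.
move=> [mA hA] [mB hB]; split=> [|e e0]; first exact: measurableU.
have e2 : 0 < e / 2 by lra.
have [a [ma la]] := hA _ e2; have [b [mb lb]] := hB _ e2.
pose n := GenTree.Node 0 [:: a; b].
exists (GenTree.Node 0 [:: n; n]) => /=; rewrite setUid setCK.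
split; first exact: measurableU.
apply: le_lt_trans (_ : pr mu (A `+` nor_set a) + pr mu (B `+` nor_set b) < e); last lra.
apply: le_trans (prU_le mu (measurableY mA ma) (measurableY mB mb)).
apply: le_pr; [by apply: measurableY; exact: measurableU| |].
  by apply: measurableU; exact: measurableY.
move=> x [[[Ax|Bx] /not_orP[na nb]]|[[ax|bx] /not_orP[nA nB]]].
- by left; left.
- by right; left.
- by left; right.
- by right; right.
Qed.

Lemma approx0 : approx set0.
Proof.
split=> // e e0; exists (GenTree.Node 0 [::]) => /=; split => //.
by rewrite /setY !setDv setU0 pr0.
Qed.

Lemma measurable_approx A : measurable A -> approx A.
Proof.
move: A; apply: (code_generates (c := cd)).
  split; first exact: approx0.
    by move=> A /approxC; rewrite setTD.
  move=> F hF.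
  have mF n : measurable (F n) by case: (hF n).
  have fin n : approx (\bigcup_(i in `I_n) F i).
    elim: n => [|n IH]; first by rewrite II0 bigcup_set0; exact: approx0.
    rewrite (_ : \bigcup_(i in _) _ = (\bigcup_(i in `I_n) F i) `|` F n); first exact: approxU.
    apply/seteqP; split=> [x [i /= + Fi]|x [[i /= il Fi]|Fn]].
    - rewrite ltnS leq_eqVlt => /predU1P[<-|il]; first by right.
      by left; exists i.
    - by exists i => //=; exact: ltnW.
    - by exists n => /=.
  have mU : measurable (\bigcup_i F i) by exact: bigcup_measurable.
  split=> // e e0; have e2 : 0 < e / 2 by lra.
  have [n lt] := pr_small mu mF e2.
  have [mf hf] := fin n; have [t [mt ltt]] := hf _ e2; exists t; split=> //.
  apply: le_lt_trans (pr_symdiff_le mU mf mt) _.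
  suff -> : (\bigcup_i F i) `+` (\bigcup_(i in `I_n) F i) =
      \bigcup_i F i `\` \bigcup_(i in `I_n) F i by lra.
  rewrite /setY (_ : _ `\` (\bigcup_i F i) = set0) ?setU0 //.
  by apply/seteqP; split=> x // [[i _ Fi]]; apply; exists i.
move=> j k; split=> [|e e0]; first exact: code_measurable.
exists (GenTree.Leaf (j, k)); split; first exact: code_measurable.
by rewrite /= /setY !setDv setU0 pr0.
Qed.

(** Let [P g i] be the part of [X] on which [q i] is the first member of the countable
    cover to agree with [g]. Up to a small set, [g] is described by finitely many of
    these parts, each replaced by a close member of the countable algebra. Two
    automorphisms with the same description agree outside the two small sets, so it
    is enough to choose one automorphism for each description that occurs. *)
Lemma dense_baut : exists h : nat -> baut E, 
  forall (g : baut E) (eps : R), 0 < eps -> exists n, pr mu [set x | g x <> h n x] < eps.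
Proof.
have [Q [cQ QP]] := countable_cover cd E mu.
have [q [_ qQ]] := countable_enum (countable_setU cQ (countable1 (baut_id E))) (or_intror erefl).
pose P (g : baut E) i := [set x | g x = q i x] `&` \bigcap_(j in `I_i) [set x | g x <> q j x].
have mP g i : measurable (P g i).
  apply: measurableI; first exact: measurable_bauteq.
  by apply: bigcap_measurableType => j _; exact: measurable_bautneq.
have Pdisj g i j x : P g i x -> P g j x -> i = j.
  have key k l : P g k x -> P g l x -> (k <= l)%N.
    move=> [_ nk] [gl _]; rewrite leqNgt; apply/negP => lk.
    exact: (nk l lk gl).
  by move=> Pi Pj; apply/eqP; rewrite eqn_leq !key.
have Pcov g : pr mu (~` \bigcup_i P g i) = 0.
  apply: (pr_sub0 _ _ _ (QP g)).
  - by apply: measurableC; exact: bigcup_measurable.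
  - rewrite (_ : mkset _ = ~` \bigcup_(q in Q) [set x | q x = g x]).
      by apply: measurableC; apply: countable_bigcup_meas => // r; exact: measurable_bauteq.
    apply/seteqP; split=> [x Nx [r Qr]|x nU r Qr e]; first exact: Nx.
    by apply: nU; exists r.
  - move=> x nU r Qr e; apply: nU.
    have [i iE] := qQ r (or_introl Qr).
    pose p n := g x = q n x.
    have pi : p (least p) by apply: (@least_spec p i); rewrite /p iE.
    exists (least p) => //; split=> // j /= jl; move=> pj.
    by have := @least_le p j pj; rewrite leqNgt jl.
pose t0 := GenTree.Leaf (0%N, 0%N).
pose D (ts : seq (GenTree.tree (nat * nat))) i := nor_set (nth t0 ts i).
(* where the finite description [ts] of [g] fails *)
pose bad g ts := (~` \bigcup_(i in `I_(size ts)) P g i) `|`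
  \bigcup_(i in `I_(size ts)) (P g i `+` D ts i).
have agree g g' ts x : ~ bad g ts x -> ~ bad g' ts x -> g x = g' x.
  move=> /not_orP[/contrapT[i /= il Pi] nD] /not_orP[_ nD'].
  have Di : D ts i x.
    by apply: contrapT => nDi; apply: nD; exists i => //; left.
  have P'i : P g' i x.
    by apply: contrapT => nP; apply: nD'; exists i => //; right.
  by case: Pi P'i => -> _ [-> _].
pose mts ts := forall i, (i < size ts)%N -> measurable (D ts i).
have mbad g ts : mts ts -> measurable (bad g ts).
  move=> mt; apply: measurableU.
    by apply: measurableC; apply: bigcup_measurable => i _; exact: mP.
  by apply: bigcup_measurable => i il; apply: measurableY => //; exact: mt.
have small g e : 0 < e -> exists ts, mts ts /\ pr mu (bad g ts) < e.
  move=> e0; have e2 : 0 < e / 2 by lra.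
  have [n ltn] := pr_small mu (mP g) e2.
  have mUg : measurable (\bigcup_i P g i) by exact: bigcup_measurable.
  have mUn : measurable (\bigcup_(i in `I_n) P g i) by exact: bigcup_measurable.
  have en : 0 < e / 2 / n.+1%:R by rewrite divr_gt0.
  have /choice[t tP] i : exists t, measurable (nor_set t) /\
      pr mu (P g i `+` nor_set t) < e / 2 / n.+1%:R.
    by have [_ /(_ _ en)] := measurable_approx (mP g i).
  pose ts := mkseq t n.
  have Dts i : (i < n)%N -> D ts i = nor_set (t i) by move=> il; rewrite /D nth_mkseq.
  have mt : mts ts by move=> i; rewrite size_mkseq => il; rewrite Dts //; case: (tP i).
  exists ts; split => //.
  rewrite /bad size_mkseq.
  set B1 := ~` _; set B2 := \bigcup_(i in _) _.
  have mB2 : measurable B2.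
    by apply: bigcup_measurable => i il; apply: measurableY => //; rewrite Dts //; case: (tP i).
  have lt1 : pr mu B1 < e / 2.
    apply: le_lt_trans ltn.
    have mC : measurable (~` \bigcup_i P g i) by exact: measurableC.
    have mDf : measurable (\bigcup_i P g i `\` \bigcup_(i in `I_n) P g i) by exact: measurableD.
    rewrite -[leRHS]add0r -(Pcov g); apply: le_trans (prU_le mu mC mDf).
    apply: le_pr; [exact: measurableC|exact: measurableU|].
    by move=> x nx; case: (pselect ((\bigcup_i P g i) x)) => Ux; [right|left].
  have lt2 : pr mu B2 <= e / 2.
    apply: (@le_trans _ _ (\sum_(i <- iota 0 n) pr mu (P g i `+` nor_set (t i)))).
      apply: le_pr_sum => // [i|x [i /= il]].
        by apply: measurableY => //; case: (tP i).
      by rewrite Dts // => PD; exists i => //; rewrite mem_iota.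
    apply: (@le_trans _ _ (\sum_(i <- iota 0 n) e / 2 / n.+1%:R)).
      by apply: ler_sum => i _; apply: ltW; case: (tP i).
    rewrite big_const_seq count_predT size_iota iter_addr_0 -[_ *+ n]mulr_natr -(mulrA (e / 2)).
    by rewrite ler_piMr ?(ltW e2) // mulrC ler_pdivrMr // mul1r ler_nat.
  apply: le_lt_trans (prU_le mu _ mB2) _; first exact: measurableC.
  lra.
have /choice[h hP] : forall tm : seq (GenTree.tree (nat * nat)) * nat, exists g',
    forall g, mts tm.1 -> pr mu (bad g tm.1) < tm.2.+1%:R^-1 ->
      pr mu (bad g' tm.1) < tm.2.+1%:R^-1.
  move=> [ts m] /=.
  case: (pselect (exists g, pr mu (bad g ts) < m.+1%:R^-1)) => [[g' h]|nh].
    by exists g'.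
  by exists (baut_id E) => g _ h; exfalso; apply: nh; exists g.
exists (fun n => if unpickle n is Some tm then h tm else baut_id E) => g e e0.
have e2 : 0 < e / 2 by lra.
have /filter_ex[m /= ne0] := near_infty_natSinv_lt (PosNum e2).
have ne : m.+1%:R^-1 < e / 2 := ne0.
have m0 : 0 < m.+1%:R^-1 :> R by rewrite invr_gt0.
have [ts [mt lt]] := small g _ m0.
exists (pickle (ts, m)); rewrite pickleK.
have := hP (ts, m) g mt lt; rewrite /=; set g' := h _ => lt'.
apply: le_lt_trans (_ : pr mu (bad g ts) + pr mu (bad g' ts) < e); last first.
  by move: (m.+1%:R^-1) ne lt lt' => r ? ? ?; lra.
apply: le_trans (prU_le mu (mbad g ts mt) (mbad g' ts mt)); apply: le_pr.
- exact: measurable_bautneq.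
- by apply: measurableU; exact: mbad.
- move=> x /= gg; apply: contrapT => /not_orP[h1 h2]; exact/gg/(agree _ _ ts).
Qed.
End Dense.
End Local.

(** * Soficity implies metric soficity *)

Section UltraLimit.
Context {R : realType}.
Variables (U : set_system nat) (UU : UltraFilter U).

Let UP : ProperFilter U := @ultra_proper _ _ UU.
#[local] Existing Instance UP.

(** The values lie in a compact interval, and a cluster point of an ultrafilter is a
    limit. *)
Lemma ulim_cvg (f : nat -> R) : (forall k, 0 <= f k <= 1) ->
  f @ U --> (lim (f @ U) : R).
Proof.
move=> f01.
have [p [_ pc]] : `[(0 : R), 1] `&` cluster (f @ U) !=set0.
  apply: segment_compact; rewrite /= nbhs_simpl /=.
  apply: (@filterS _ U _ setT); last exact: filterT.
  by move=> k _; rewrite /preimage /= in_itv /=; exact: f01.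
apply/cvg_ex; exists p => V Vp.
have [//|UV] := @in_ultra_setVsetC _ U (f @^-1` V) UU.
have [x [Vx nVx]] := pc (~` V) V UV Vp.
by [].
Qed.

Lemma ulim_le (f g : nat -> R) : (forall k, 0 <= f k <= 1) ->
  (forall k, 0 <= g k <= 1) -> (forall k, f k <= g k) -> lim (f @ U) <= lim (g @ U).
Proof.
move=> f01 g01 fg; apply: (ler_cvg_to (ulim_cvg f01) (ulim_cvg g01)).
exact: filterS filterT.
Qed.

Lemma ulim_unique (f : nat -> R) l : f @ U --> l -> lim (f @ U) = l.
Proof. by move=> fl; apply/cvg_lim. Qed.

Lemma ulim_leD (f g h : nat -> R) : (forall k, 0 <= f k <= 1) ->
  (forall k, 0 <= g k <= 1) -> (forall k, 0 <= h k <= 1) ->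
  (forall k, f k <= g k + h k) -> lim (f @ U) <= lim (g @ U) + lim (h @ U).
Proof.
move=> f01 g01 h01 fgh.
have gh : (g \+ h) @ U --> (lim (g @ U) + lim (h @ U) : R).
  by apply: cvgD; exact: ulim_cvg.
apply: (ler_cvg_to (ulim_cvg f01) gh).
exact: filterS filterT.
Qed.

Lemma ulim_D (g h : nat -> R) :
  (forall k, 0 <= g k <= 1) -> (forall k, 0 <= h k <= 1) ->
  lim ((fun k => g k + h k) @ U) = lim (g @ U) + lim (h @ U).
Proof.
by move=> g01 h01; apply: ulim_unique; apply: cvgD; exact: ulim_cvg.
Qed.

Lemma ulim_cst (c : R) : lim ((fun=> c) @ U) = c.
Proof. by apply: ulim_unique; exact: cvg_cst. Qed.

Lemma ulim_eventually (f : nat -> R) (l : R) : \oo `<=` U ->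
  (forall e : R, 0 < e -> exists m, forall k, (m <= k)%N -> `|f k - l| <= e) ->
  lim (f @ U) = l.
Proof.
move=> ooU fl; apply: ulim_unique; apply: (@cvg_trans _ (f @ \oo)).
  by move=> A; exact: ooU.
apply/cvgrPdist_le => e /fl[m hm]; exists m => // k /= mk.
by rewrite distrC; exact: hm.
Qed.

Section Ultraproduct.
Variables (n : nat -> nat) (n0 : forall k, (0 < n k)%N).
Implicit Types x y z : forall k, 'S_(n k).

Lemma dperm01 N (s t : 'S_N) : (0 < N)%N -> 0 <= dperm R s t <= 1.
Proof.
move=> N0; rewrite dpermE ms_ge0 /= -(@msT R N N0); exact: ms_le.
Qed.

Lemma d_ultraE x y : d_ultra R U x y = lim ((fun k => dperm R (x k) (y k)) @ U).
Proof. by []. Qed.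

Lemma d_ultra0 x : d_ultra R U x x = 0.
Proof.
rewrite d_ultraE -[RHS](ulim_cst 0); congr (lim (_ @ U)).
by apply/funext => k; rewrite /dperm d_sharp0.
Qed.

Lemma d_ultraC x y : d_ultra R U x y = d_ultra R U y x.
Proof.
rewrite !d_ultraE; congr (lim (_ @ U)).
by apply/funext => k; rewrite /dperm d_sharpC.
Qed.

Lemma d_ultra_tri x y z : d_ultra R U x z <= d_ultra R U x y + d_ultra R U y z.
Proof.
by apply: ulim_leD => k; [exact: dperm01..|exact: d_sharp_tri].
Qed.

Lemma d_ultra_mul x x' y y' : d_ultra R U (fun k => y k * x k)%g (fun k => y' k * x' k)%g
  <= d_ultra R U x x' + d_ultra R U y y'.
Proof.
apply: ulim_leD => k; [exact: dperm01..|].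
apply: le_trans (d_sharp_tri _ (pbij_of_perm (y k * x' k)%g) _ _) _.
by rewrite -!/(dperm R _ _) dpermMl dpermMr.
Qed.

Lemma up_mulE x y : up_mul (mclass (@d_ultra R U n) x) (mclass (@d_ultra R U n) y) =
  mclass (@d_ultra R U n) (fun k => y k * x k)%g.
Proof.
apply: (mclass_eq d_ultra0 d_ultraC d_ultra_tri); apply/eqP.
rewrite eq_le (pseudo_ge0 d_ultra0 d_ultraC d_ultra_tri) andbT.
apply: le_trans (d_ultra_mul _ _ _ _) _.
by rewrite !(mrepr_mclass d_ultra0) addr0.
Qed.

End Ultraproduct.
End UltraLimit.

(** The complements of the domain and of the range have the same number of elements. *)
Lemma perm_extend N (f : 'I_N -> option 'I_N) : pinjective f ->
  exists s : 'S_N, forall x y, f x = Some y -> s x = y.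
Proof.
move=> fi.
pose A := [set x | f x == None]%SET.
pose B := (~: [set y | [exists x, f x == Some y]])%SET.
have cAB : #|A| = #|B|.
  have -> : A = (~: [set x | f x != None])%SET.
    by apply/setP => x; rewrite !inE negbK.
  rewrite /B [LHS]cardsCs [RHS]cardsCs !finset.setCK; congr (_ - _)%N.
  pose h x := odflt x (f x).
  rewrite -(card_in_imset (f := h)); last first.
    move=> x y; rewrite !inE /h; case fx: (f x) => [u|//]; case fy: (f y) => [v|//] _ _ /= uv.
    by apply: (fi _ _ u); rewrite // uv.
  apply: eq_card => y; apply/imsetP/idP.
    by move=> [x]; rewrite !inE /h; case fx: (f x) => [u|//] _ ->; apply/existsP; exists x; rewrite fx.
  by rewrite !inE => /existsP[x /eqP fx]; exists x; rewrite ?inE /h fx.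
pose s x := if f x is Some y then y else nth x (enum B) (index x (enum A)).
have nA x : f x = None -> (index x (enum A) < size (enum B))%N.
  by move=> fx; rewrite -cardE -cAB cardE index_mem mem_enum inE fx.
have sB x : f x = None -> s x \in B.
  by move=> fx; rewrite /s fx -mem_enum mem_nth // nA.
have si : injective s.
  move=> x y; case fx: (f x) => [u|]; case fy: (f y) => [v|].
  - by rewrite /s fx fy => uv; apply: (fi _ _ u); rewrite // uv.
  - move=> e; have := sB y fy; rewrite -e /s fx !inE => /existsP[].
    by exists x; rewrite fx.
  - move=> e; have := sB x fx; rewrite e /s fy !inE => /existsP[].
    by exists y; rewrite fy.
  - rewrite /s fx fy (set_nth_default y) ?nA // => /eqP.
    rewrite nth_uniq ?nA ?enum_uniq // => /eqP e.
    have xA : x \in enum A by rewrite mem_enum inE fx.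
    by rewrite -(nth_index x xA) e nth_index // mem_enum inE fy.
exists (perm si) => x y fx; by rewrite permE /s fx.
Qed.

Section SoficToMetric.
Context {R : realType} {d : measure_display} {X : measurableType d}.
Variables (cd : coding X) (E : cber X) (mu : probability X R).
Hypothesis E_mp : measure_preserving E mu.

Definition cl (g : baut E) : full_semigroup E mu := mclass (d_mu mu) (fullB_of_baut g).

Lemma cl_eq (g h : baut E) : pr mu [set x | g x <> h x] = 0 -> cl g = cl h.
Proof.
move=> gh; apply: (mclass_eq (d_mu0 cd mu) (d_muC cd mu) (d_mu_tri cd mu)).
by rewrite d_mu_baut.
Qed.

Lemma cl_ext (g h : baut E) : g =1 h -> cl g = cl h.
Proof.
move=> gh; apply: cl_eq; rewrite (_ : mkset _ = set0) ?pr0 //.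
by apply/seteqP; split=> x // /=; rewrite gh.
Qed.

Lemma cl_mul (g h : baut E) : fs_mul (cl g) (cl h) = cl (baut_comp g h).
Proof.
rewrite (fs_mulE cd E_mp); apply: (mclass_eq (d_mu0 cd mu) (d_muC cd mu) (d_mu_tri cd mu)).
rewrite (d_muE cd) (_ : mkset _ = set0) ?pr0 //.
by apply/seteqP; split.
Qed.

Lemma cl_id : cl (baut_id E) = fs_id E mu.
Proof.
apply: (mclass_eq (d_mu0 cd mu) (d_muC cd mu) (d_mu_tri cd mu)).
rewrite (d_muE cd) (_ : mkset _ = set0) ?pr0 //.
by apply/seteqP; split.
Qed.

Lemma fs_fix_cl (g : baut E) : fs_fix (cl g) = 1 - pr mu [set x | g x <> x].
Proof.
rewrite (fs_fixE cd) -[RHS]prC; last exact: (measurable_bautneq cd g (baut_id E)).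
congr pr; apply/seteqP; split=> x; rewrite /pfix /=; last by move/contrapT => ->.
by case=> -> /=.
Qed.

Lemma mdist_cl (g h : baut E) : Defs.mdist (cl g) (cl h) = pr mu [set x | g x <> h x].
Proof.
by rewrite (mdist_mclass (d_mu0 cd mu) (d_muC cd mu) (d_mu_tri cd mu)) d_mu_baut.
Qed.

Lemma cl_inj (g h : baut E) : cl g = cl h -> pr mu [set x | g x <> h x] = 0.
Proof.
move=> gh; rewrite -mdist_cl gh mdist_cl (_ : mkset _ = set0) ?pr0 //.
by apply/seteqP; split.
Qed.

(** A representative with full domain and range is given by a total bijection. *)
Lemma full_group_cl (C : full_semigroup E mu) : full_group C <-> exists g, C = cl g.
Proof.
split=> [[g [gd gr] <-]|[g ->]]; last first.
  exists (fullB_of_baut g) => //; split.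
    by apply/seteqP; split.
  by rewrite /pran pimage_baut.
have tot x : exists y, g x = Some y.
  have : pdom g x by rewrite gd.
  by rewrite /pdom /=; case: (g x) => // y _; exists y.
have sur y : exists x, g x = Some y.
  have : pran g y by rewrite gr.
  by move=> [x _ gx]; exists x.
have [f fP] := choice tot; have [f' fP'] := choice sur.
have fK : cancel f f'.
  by move=> x; apply: (pbij_inj (p := g)); [exact: fP'|exact: fP].
have fK' : cancel f' f.
  by move=> y; have := fP (f' y); rewrite fP' => -[].
have pre B : ppreimage g B = f @^-1` B.
  apply/seteqP; split=> [x [y By]|x Bx]; first by rewrite fP => -[e]; rewrite /preimage /= e.
  by exists (f x).
have im B : pimage g B = f' @^-1` B.
  apply/seteqP; split=> [y [x Bx]|y By]; last by exists (f' y).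
  by rewrite fP => -[<-]; rewrite /preimage /= fK.
have [_ _ gm gm'] := fullB_borel g.
have mf B : measurable B -> measurable (f @^-1` B) by rewrite -pre; exact: gm.
have mf' B : measurable B -> measurable (f' @^-1` B) by rewrite -im; exact: gm'.
have fE x : E x (f x) by apply: (fullB_rel (f := g)).
exists (BAut fK fK' mf mf' fE).
apply: (mclass_eq (d_mu0 cd mu) (d_muC cd mu) (d_mu_tri cd mu)).
rewrite (d_muE cd) (_ : mkset _ = set0) ?pr0 //.
by apply/seteqP; split=> x //=; rewrite fP.
Qed.

(** The approximation [p] is applied to a set large enough to contain the products
    and inverses that appear in the argument. As [p a] composed with [p (a^-1)] is
    close to the identity, [p a] is defined almost everywhere, and it is close to any
    permutation [s a] that extends it. The distance from [s a] to [s b] is that from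
    the identity to [s (a^-1 b)], up to small errors, and is read from the fixed
    points of [a^-1 b]. *)
Lemma sofic_perms : sofic E mu -> forall (S : set (baut E)) (e : R),
  finite_set S -> 0 < e -> exists (N : nat) (s : baut E -> 'S_N),
  [/\ (0 < N)%N,
      forall a b, S a -> S b -> `|dperm R (s a) (s b) - pr mu [set x | a x <> b x]| <= e &
      forall a b, S a -> S b -> dperm R (s (baut_comp a b)) (s b * s a)%g <= e].
Proof.
move=> soficE S e finS e0.
pose S1 := S `|` (@baut_inv _ _ E @` S).
pose S2 := S1 `|` [set baut_comp a b | a in S1 & b in S1].
pose S3 := S2 `|` (@baut_inv _ _ E @` S2).
have fin1 : finite_set S1 by rewrite finite_setU; split=> //; exact: finite_image.
have fin2 : finite_set S2 by rewrite finite_setU; split=> //; exact: finite_image2.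
have fin3 : finite_set S3 by rewrite finite_setU; split=> //; exact: finite_image.
have S12 a : S1 a -> S2 a by left.
have S23 a : S2 a -> S3 a by left.
have S23i a : S2 a -> S3 (baut_inv a) by right; exists a.
have Sm a b : S1 a -> S1 b -> S2 (baut_comp a b) by right; exists a => //; exists b.
(* the isometry estimate uses [qm] and [qfix] twice each: [12 = 2 * (4 + 2)] *)
pose e' := e / 12.
have e'0 : 0 < e' by rewrite /e'; lra.
have [N [pi [N0 pi1 _ pim pifix]]] := soficE (cl @` S3) e' (finite_image cl fin3) e'0.
pose p a := pi (cl a).
have pm a b : S3 a -> S3 b -> d_sharp R (p (baut_comp a b)) (pbij_comp (p a) (p b)) < e'.
  by move=> Sa Sb; rewrite /p -cl_mul; apply: pim; [exists a|exists b].
have /choice[s sP] : forall a, exists s : 'S_N, forall x y, p a x = Some y -> s x = y.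
  by move=> a; apply: perm_extend; exact: pbij_inj.
pose q a := pbij_of_perm (s a).
have pq a : S2 a -> d_sharp R (q a) (p a) <= e'.
  move=> Sa; have := pm a (baut_inv a) (S23 a Sa) (S23i a Sa).
  rewrite {1}/p (cl_ext (h := baut_id E)); last by move=> x /=; rewrite ainvK.
  rewrite cl_id pi1 !d_sharpE => lt; apply: le_trans (ltW lt).
  have fixle : mu_sharp R [set x | pbij_id 'I_N x <> pbij_comp (p a) (p (baut_inv a)) x] =
      1 - mu_sharp R [set x | pbij_comp (p a) (p (baut_inv a)) x = Some x].
    rewrite -(@msT R N N0) (_ : setT = [set x | pbij_id 'I_N x <> pbij_comp (p a) (p (baut_inv a)) x]
      `|` [set x | pbij_comp (p a) (p (baut_inv a)) x = Some x]).
      by rewrite msU ?addrK //; apply/seteqP; split=> x //= [h1 h2]; apply: h1; rewrite h2.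
    apply/seteqP; split=> x //= _.
    by case: (pselect (pbij_comp (p a) (p (baut_inv a)) x = Some x)); [right|left => /esym].
  have domle : mu_sharp R [set x | q a x <> p a x] = 1 - mu_sharp R [set x | q a x = p a x].
    rewrite -(@msT R N N0) (_ : setT = [set x | q a x <> p a x] `|` [set x | q a x = p a x]).
      by rewrite msU ?addrK //; apply/seteqP; split=> x //= [].
    apply/seteqP; split=> x //= _.
    by case: (pselect (q a x = p a x)); [right|left].
  rewrite fixle domle lerD2l lerN2.
  apply: (@ms_inj _ _ _ _ (fun x => odflt x (p (baut_inv a) x))).
    move=> x y /set_mem /= + /set_mem /=; rewrite /pcomp.
    case: (p (baut_inv a) x) => [u|//] /= pu; case: (p (baut_inv a) y) => [v|//] /= pv uv.
    by move: pu pv; rewrite uv => -> [].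
  move=> x /=; rewrite /pcomp.
  by case: (p (baut_inv a) x) => [u|//] /= pu; rewrite pu (sP _ _ _ pu).
have qm a b : S1 a -> S1 b -> dperm R (s (baut_comp a b)) (s b * s a)%g <= 4 * e'.
  move=> Sa Sb.
  have h1 := pq _ (Sm _ _ Sa Sb); have h2 := pm a b (S23 _ (S12 _ Sa)) (S23 _ (S12 _ Sb)).
  have h3 := pq a (S12 _ Sa); have h4 := pq b (S12 _ Sb).
  have h5 := d_sharp_comp R (q a) (p a) (q b) (p b).
  have h6 := d_sharp_tri R (p (baut_comp a b)) (q (baut_comp a b)) (pbij_comp (p a) (p b)).
  have h7 := d_sharp_tri R (pbij_comp (p a) (p b)) (q (baut_comp a b)) (pbij_comp (q a) (q b)).
  rewrite (d_sharpC _ (pbij_comp (p a) (p b))) in h7.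
  rewrite /dperm (_ : d_sharp _ _ _ = d_sharp R (q (baut_comp a b)) (pbij_comp (q a) (q b))).
    lra.
  have pE : pbij_of_perm (s b * s a)%g = pbij_comp (q a) (q b) :> ('I_N -> option 'I_N).
    by apply/funext => x; rewrite -pbij_of_permM.
  by rewrite !d_sharpE pE.
have qfix a : S2 a -> `|dperm R (s a) 1%g - pr mu [set x | a x <> x]| <= 2 * e'.
  move=> Sa; have := pifix (cl a) (ex_intro2 _ _ a (S23 _ Sa) erefl).
  rewrite fs_fix_cl -/(p a) => h1.
  have h2 := pq a Sa.
  have h3 : dperm R (s a) 1%g = 1 - mu_sharp R (pfix (q a)).
    rewrite dpermE -(@msT R N N0) (_ : setT = [set x | s a x <> (1%g : 'S_N) x] `|` pfix (q a)).
      by rewrite msU ?addrK //; apply/seteqP; split=> x //= [h3 [h4]]; apply: h3; rewrite perm1.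
    apply/seteqP; split=> x //= _; rewrite /pfix /= perm1.
    by case: (pselect (s a x = x)) => [->|]; [right|left].
  have h4 : mu_sharp R (pfix (q a)) <= mu_sharp R (pfix (p a)) + d_sharp R (q a) (p a).
    rewrite d_sharpE; apply: le_trans (msU_le _ _ _); apply: ms_le => x qx.
    by case: (pselect (q a x = p a x)) => e1; [left; rewrite /pfix /= -e1|right].
  have h5 : mu_sharp R (pfix (p a)) <= mu_sharp R (pfix (q a)).
    by apply: ms_le => x; rewrite /pfix /= => /sP ->.
  rewrite h3; move: h1; rewrite ltr_norml ler_norml; lra.
exists N, s; split=> // a b Sa Sb; last first.
  by apply: le_trans (qm a b _ _) _; [left|left|rewrite /e'; lra].
pose c := baut_inv a.
have Sc : S1 c by right; exists a.
have [Sa1 Sb1] : S1 a /\ S1 b by split; left.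
have h1 := qm c a Sc Sa1; have h2 := qm c b Sc Sb1.
have h3 := qfix _ (Sm c a Sc Sa1); have h4 := qfix _ (Sm c b Sc Sb1).
have e3 : pr mu [set x | baut_comp c a x <> x] = 0.
  by rewrite (_ : mkset _ = set0) ?pr0 //; apply/seteqP; split=> x //=; rewrite afunK.
have e4 : [set x | baut_comp c b x <> x] = [set x | a x <> b x].
  apply/seteqP; split=> x /= n e1; apply: n; first by rewrite -e1 afunK.
  by rewrite -{1}e1 ainvK.
have h5 : dperm R (s a) (s b) = dperm R (s a * s c)%g (s b * s c)%g by rewrite dpermMr.
rewrite e3 in h3; rewrite e4 in h4.
have t1 := d_sharp_tri R (pbij_of_perm (s (baut_comp c a))) (pbij_of_perm 1%g) (pbij_of_perm (s a * s c)%g).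
have t2 := d_sharp_tri R (pbij_of_perm 1%g) (pbij_of_perm (s a * s c)%g) (pbij_of_perm (s b * s c)%g).
have t3 := d_sharp_tri R (pbij_of_perm (s (baut_comp c b))) (pbij_of_perm 1%g) (pbij_of_perm (s b * s c)%g).
have t4 := d_sharp_tri R (pbij_of_perm (s a * s c)%g) (pbij_of_perm 1%g) (pbij_of_perm (s b * s c)%g).
have t5 := d_sharp_tri R (pbij_of_perm (s b * s c)%g) (pbij_of_perm 1%g) (pbij_of_perm (s (baut_comp c b))).
rewrite -!/(dperm R _ _) in t1 t2 t3 t4 t5.
have sy (u v : 'S_N) : dperm R u v = dperm R v u by rewrite /dperm d_sharpC.
rewrite !(sy 1%g) in t1 t2 t3 t4 t5.
rewrite (sy (s b * s c)%g (s (baut_comp c b))) in t5.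
rewrite h5; move: h3 h4; rewrite !ler_norml => /andP[h31 h32] /andP[h41 h42].
apply/andP; split; rewrite /e' in h1 h2 h31 h32 h41 h42; lra.
Qed.

(** Let [h] be a dense sequence. At stage [k] an automorphism is represented by the
    closest of [h 0], ..., [h k], to which a [1 / k.+1]-approximation is applied; both
    errors vanish in the limit. *)
Theorem sofic_metrically_sofic : sofic E mu -> metrically_sofic E mu.
Proof.
move=> soficE.
have [h hdense] := dense_baut cd E mu.
have [U [UU ooU]] := @ultraFilterLemma _ \oo _.
pose L k := [set h i | i in `I_k.+1].
have finL k : finite_set (L k) by apply: finite_image; exact: finite_II.
pose S k := L k `|` [set baut_comp a b | a in L k & b in L k].
have finS k : finite_set (S k) by rewrite finite_setU; split=> //; exact: finite_image2.
pose e k : R := k.+1%:R^-1.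
have e0 k : 0 < e k by rewrite invr_gt0.
have e_small (r : R) : 0 < r -> exists m, forall k, (m <= k)%N -> e k < r.
  move=> r0; have [m _ hm] := near_infty_natSinv_lt (PosNum r0).
  by exists m => k mk; exact: hm.
have /choice[Ns NsP] : forall k, exists Ns : {N : nat & baut E -> 'S_N},
  [/\ (0 < projT1 Ns)%N,
      forall a b, S k a -> S k b ->
        `|dperm R (projT2 Ns a) (projT2 Ns b) - pr mu [set x | a x <> b x]| <= e k &
      forall a b, S k a -> S k b ->
        dperm R (projT2 Ns (baut_comp a b)) (projT2 Ns b * projT2 Ns a)%g <= e k].
  move=> k; have [N [s sP]] := sofic_perms soficE (finS k) (e0 k).
  by exists (existT _ N s).
pose N k := projT1 (Ns k); pose s k : baut E -> 'S_(N k) := projT2 (Ns k).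
have dd_le (a b c : baut E) : pr mu [set x | a x <> c x] <=
    pr mu [set x | a x <> b x] + pr mu [set x | b x <> c x].
  have := d_mu_tri cd mu (fullB_of_baut a) (fullB_of_baut b) (fullB_of_baut c).
  by rewrite !d_mu_baut.
have ddC (a b : baut E) : pr mu [set x | a x <> b x] = pr mu [set x | b x <> a x].
  by have := d_muC cd mu (fullB_of_baut a) (fullB_of_baut b); rewrite !d_mu_baut.
have dd_comp (a a' b b' : baut E) :
    pr mu [set x | baut_comp a b x <> baut_comp a' b' x] <=
    pr mu [set x | a x <> a' x] + pr mu [set x | b x <> b' x].
  rewrite -!(d_mu_baut cd); apply: le_trans (d_mu_comp cd E_mp _ _ _ _).
  rewrite !(d_muE cd) le_eqVlt; apply/orP; left; apply/eqP; congr (pr mu _).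
pose idx (g : baut E) k : 'I_k.+1 := [arg min_(i < ord0) pr mu [set x | g x <> h i x]]%O.
pose near (g : baut E) k := h (idx g k).
have nearL (g : baut E) k : L k (near g k) by exists (idx g k) => //=; rewrite ltnS -ltnS.
have near_small (g : baut E) (r : R) : 0 < r -> exists m, forall k, (m <= k)%N ->
    pr mu [set x | g x <> near g k x] < r.
  move=> r0; have [m hm] := hdense g r r0; exists m => k mk.
  rewrite /near /idx; case: arg_minP => //= i _ /(_ (Ordinal (mk : (m < k.+1)%N)) isT) le.
  exact: le_lt_trans le hm.
have /choice[rep repP] : forall C : full_semigroup E mu, exists g, full_group C -> C = cl g.
  move=> C; case: (pselect (full_group C)) => [/full_group_cl[g gC]|nC]; first by exists g.
  by exists (baut_id E).
pose t (g : baut E) k := s k (near g k).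
have tN k : (0 < N k)%N by have [] := NsP k.
have dist_t (g g' : baut E) : d_ultra R U (t g) (t g') = pr mu [set x | g x <> g' x].
  rewrite d_ultraE; apply: (ulim_eventually UU ooU) => r r0.
  have r3 : 0 < r / 3 by lra.
  have [m1 h1] := near_small g _ r3; have [m2 h2] := near_small g' _ r3.
  have [m3 h3] := e_small _ r3.
  exists (maxn m1 (maxn m2 m3)) => k; rewrite !geq_max => /and3P[/h1 k1 /h2 k2 /h3 k3].
  have [_ iso _] := NsP k.
  have := iso (near g k) (near g' k) (or_introl (nearL g k)) (or_introl (nearL g' k)).
  rewrite -/(N k) -/(s k) -/(t g k) -/(t g' k).
  have t1 := dd_le g (near g k) g'; have t2 := dd_le (near g k) (near g' k) g'.
  have t3 := dd_le (near g k) g (near g' k); have t4 := dd_le g g' (near g' k).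
  rewrite (ddC (near g' k) g') in t2; rewrite (ddC (near g k) g) in t3.
  move: k3; rewrite !ler_norml => k3 /andP[i1 i2]; apply/andP; split; lra.
have mul_t (a b c : baut E) : pr mu [set x | c x <> baut_comp a b x] = 0 ->
    d_ultra R U (t c) (fun k => t b k * t a k)%g = 0.
  move=> cab; rewrite d_ultraE; apply: (ulim_eventually UU ooU) => r r0.
  have r5 : 0 < r / 5 by lra.
  have [m1 h1] := near_small a _ r5; have [m2 h2] := near_small b _ r5.
  have [m3 h3] := e_small _ r5; have [m4 h4] := near_small c _ r5.
  exists (maxn m1 (maxn m2 (maxn m3 m4))) => k.
  rewrite !geq_max => /and4P[/h1 k1 /h2 k2 /h3 k3 /h4 k4].
  have [_ iso mul] := NsP k.
  have La := nearL a k; have Lb := nearL b k.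
  have Sab : S k (baut_comp (near a k) (near b k)).
    by right; exists (near a k) => //; exists (near b k).
  have i1 := iso _ _ (or_introl (nearL c k)) Sab.
  have i2 := mul _ _ (or_introl La) (or_introl Lb).
  have i3 := dd_le (near c k) c (baut_comp (near a k) (near b k)).
  have i4 := dd_le c (baut_comp a b) (baut_comp (near a k) (near b k)).
  have i5 := dd_comp a (near a k) b (near b k).
  have i6 := d_sharp_tri R (pbij_of_perm (s k (baut_comp (near a k) (near b k))))
     (pbij_of_perm (t c k)) (pbij_of_perm (t b k * t a k)%g).
  rewrite -!/(dperm R _ _) in i6.
  rewrite (ddC (near c k) c) cab in i3 i4.
  rewrite subr0 ger0_norm ?(d_sharp_ge0 R) //.
  apply: le_trans i6 _.
  rewrite -/(s k) -/(t c k) in i1; rewrite -/(s k) -/(t a k) -/(t b k) in i2.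
  move: i1; rewrite ler_norml => /andP[_ i1].
  lra.
have pseudo0 := @d_ultra0 R U UU N.
have pseudoC := @d_ultraC R U N.
have pseudoT := @d_ultra_tri R U UU N tN.
exists U, N, (fun C => mclass _ (t (rep C))); split=> //.
- split=> //; apply/seteqP; split=> // j /= hj.
  have : [set m | (j < m)%N] j by apply: hj; apply: ooU; exists j.+1.
  by rewrite /= ltnn.
- move=> x y xG yG; rewrite (up_mulE UU tN).
  apply: (mclass_eq pseudo0 pseudoC pseudoT); apply: mul_t.
  have xyG : full_group (fs_mul x y).
    by rewrite (repP x xG) (repP y yG) cl_mul; apply/full_group_cl; eexists.
  by apply: cl_inj; rewrite -(repP _ xyG) -cl_mul -(repP x xG) -(repP y yG).
- move=> x y xG yG; rewrite (mdist_mclass pseudo0 pseudoC pseudoT) dist_t.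
  by rewrite {2}(repP x xG) {2}(repP y yG) mdist_cl.
Qed.

End SoficToMetric.

(** * Recovering Borel sets and partial maps from an isometric action *)

(** The abstract setting in which sets and partial maps are copied: the automorphisms
    act on a finitely additive measure space [W], multiplicatively up to negligible
    sets, and isometrically; [dl] is the measure and [sg] the action. *)
Section Representation.
Context {R : realType} {d : measure_display} {X : measurableType d}.
Variables (cd : coding X) (E : cber X) (mu : probability X R).
Hypothesis E_mp : measure_preserving E mu.
Variables (W : Type) (dl : set W -> R) (sg : baut E -> W -> W).
Hypotheses (dl_ge0 : forall A, 0 <= dl A)
  (dlU : forall A B, A `&` B = set0 -> dl (A `|` B) = dl A + dl B)
  (dl_sg : forall g A, dl (sg g @^-1` A) = dl A)
  (sg_inj : forall g, injective (sg g))
  (sgM : forall g h, dl [set w | sg (baut_comp g h) w <> sg g (sg h w)] = 0)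
  (sg_dist : forall g h, dl [set w | sg g w <> sg h w] = pr mu [set x | g x <> h x]).

Lemma dl_set0 : dl set0 = 0.
Proof. by have := dlU (setI0 set0); rewrite setU0; lra. Qed.

Lemma dlID A B : dl A = dl (A `&` B) + dl (A `\` B).
Proof.
rewrite -dlU ?setUIDK //; apply/seteqP; split=> w // [[_ ?] [_]] //.
Qed.

Lemma dl_le A B : A `<=` B -> dl A <= dl B.
Proof.
move=> AB; rewrite (dlID B A) setIC (_ : A `&` B = A); last exact/setIidPl.
by rewrite lerDl.
Qed.

Lemma dlUI A B : dl (A `|` B) + dl (A `&` B) = dl A + dl B.
Proof.
rewrite (dlID (A `|` B) A) (dlID B A) setUK setDUl setDv set0U setIC; lra.
Qed.

Lemma dlU_le A B : dl (A `|` B) <= dl A + dl B.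
Proof. by have := dlUI A B; have := dl_ge0 (A `&` B); lra. Qed.

(** The sets of full density. As [dl] is only finitely additive, this filter is closed
    under finite intersections only. *)
Definition ae : set_system W := [set A | dl (~` A) = 0].

Instance ae_filter : Filter ae.
Proof.
split; rewrite /ae /=.
- by rewrite setCT dl_set0.
- move=> A B A0 B0; apply/eqP; rewrite eq_le dl_ge0 andbT setCI.
  by apply: le_trans (dlU_le _ _) _; rewrite A0 B0 addr0.
- move=> A B AB A0; apply/eqP; rewrite eq_le dl_ge0 andbT -A0.
  by apply: dl_le; exact: subsetC.
Qed.

Lemma aeE (P : W -> Prop) : (\forall w \near ae, P w) <-> dl [set w | ~ P w] = 0.
Proof. by []. Qed.

Lemma ae_le (A B : set W) : (\forall w \near ae, A w -> B w) -> dl A <= dl B.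
Proof.
move=> /aeE AB; apply: le_trans (_ : dl (B `|` [set w | ~ (A w -> B w)]) <= _).
  apply: dl_le => w Aw; case: (pselect (B w)) => Bw; [by left|right].
  by move=> /(_ Aw).
by apply: le_trans (dlU_le _ _) _; rewrite AB addr0.
Qed.

Lemma ae_eq_dl (A B : set W) : (\forall w \near ae, A w <-> B w) -> dl A = dl B.
Proof.
move=> AB; apply/eqP; rewrite eq_le; apply/andP; split; apply: ae_le;
  by apply: filterS AB => w [].
Qed.

Lemma ae_sg g (P : W -> Prop) : (\forall w \near ae, P w) -> \forall w \near ae, P (sg g w).
Proof. by move=> /aeE h; apply/aeE; rewrite -[RHS]h -[RHS](dl_sg g). Qed.

Lemma ae_mul g h : \forall w \near ae, sg (baut_comp g h) w = sg g (sg h w).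
Proof. exact/aeE/sgM. Qed.

Lemma ae_ext (g h : baut E) : g =1 h -> \forall w \near ae, sg g w = sg h w.
Proof.
move=> gh; apply/aeE; rewrite sg_dist (_ : mkset _ = set0) ?pr0 //.
by apply/seteqP; split=> x // /=; rewrite gh.
Qed.

Lemma ae_id : \forall w \near ae, sg (baut_id E) w = w.
Proof.
have h : \forall w \near ae, sg (baut_id E) w = sg (baut_comp (baut_id E) (baut_id E)) w.
  exact: ae_ext.
by apply: filterS2 h (ae_mul (baut_id E) (baut_id E)) => w e1 e2; apply: (@sg_inj (baut_id E)); rewrite -e2 -e1.
Qed.

Definition supp (g : baut E) : set X := [set x | g x <> x].
Definition act_supp (g : baut E) : set W := [set w | sg g w <> w].

Lemma measurable_supp g : measurable (supp g).
Proof. exact: (measurable_bautneq cd g (baut_id E)). Qed.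

Lemma dl_supp g : dl (act_supp g) = pr mu (supp g).
Proof.
have e : dl (act_supp g) = dl [set w | sg g w <> sg (baut_id E) w].
  by apply: ae_eq_dl; apply: filterS ae_id => w e; rewrite /act_supp /= e.
by rewrite e sg_dist.
Qed.

(** The support of [g h] is the union of the disjoint supports of [g] and [h]. In [W]
    its measure is the sum of the two, and it is contained in the union of the
    supports of [g] and [h], which have therefore a negligible intersection. *)
Lemma disjoint_act_supp (g h : baut E) : (forall x, g x = x \/ h x = x) ->
  \forall w \near ae, sg g w = w \/ sg h w = w.
Proof.
move=> gh; apply/aeE.
rewrite (_ : [set w | _] = act_supp g `&` act_supp h); last first.
  apply/seteqP; split=> w /=; first by move=> /not_orP.
  by move=> [n1 n2] [].
apply/eqP; rewrite eq_le dl_ge0 andbT.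
have := dlUI (act_supp g) (act_supp h); rewrite !dl_supp.
suff : pr mu (supp g) + pr mu (supp h) <= dl (act_supp g `|` act_supp h) by lra.
rewrite -prU; [|exact: measurable_supp|exact: measurable_supp|]; last first.
  by apply/seteqP; split=> x // [/= n1 n2]; case: (gh x).
rewrite (_ : supp g `|` supp h = supp (baut_comp g h)); last first.
  apply/seteqP; split=> x; rewrite /supp /=.
    case=> n; last by case: (gh (h x)) => [->//|/afun_inj].
    by case: (gh x) => // ->.
  move=> n; apply: contrapT => /not_orP[/contrapT n1 /contrapT n2].
  by apply: n; rewrite /= n2.
rewrite -dl_supp; apply: ae_le; apply: filterS (ae_mul g h) => w e.
rewrite /act_supp /= e => n; apply: contrapT => /not_orP[/contrapT n1 /contrapT n2].
by apply: n; rewrite n2.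
Qed.

Lemma act_supp_comp (g h : baut E) :
  \forall w \near ae, sg (baut_comp g h) w <> w -> sg g w <> w \/ sg h w <> w.
Proof.
apply: filterS (ae_mul g h) => w -> n.
apply: contrapT => /not_orP[/contrapT n1 /contrapT n2].
by apply: n; rewrite n2.
Qed.

Lemma act_comp_disjoint (g h : baut E) : (forall x, g x = x \/ h x = x) ->
  \forall w \near ae, (sg g w <> w -> sg (baut_comp g h) w = sg g w) /\
    (sg g w = w -> sg (baut_comp g h) w = sg h w).
Proof.
move=> gh; have dj := disjoint_act_supp gh; have dj' := ae_sg h dj.
apply: filterS3 (ae_mul g h) dj dj' => w -> [e|e] e'; last by rewrite e.
split=> [/(_ e)//|_]; case: e' => // /sg_inj h1.
by rewrite h1 e.
Qed.

Section Triples.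
Implicit Types (A B : set X) (f g h : baut E).

(** A single swap does not tell [A] from [g A]; this is the least configuration in
    which swaps determine [A]. *)
Definition triple A g h :=
  [/\ moved g A, moved h A & forall x y, A x -> A y -> g x <> h y].

(** The copy of [A] in [W]: among [A], [g A] and [h A], the first is the only set moved
    by both swaps. *)
Definition Theta A g h : set W := act_supp (sw g A) `&` act_supp (sw h A).

Lemma triple_sym A g h : triple A g h -> triple A h g.
Proof. by case=> mg mh gh; split=> // x y Ax Ay /esym; exact: gh. Qed.

Lemma Theta_sym A g h : Theta A g h = Theta A h g.
Proof. by rewrite /Theta setIC. Qed.

Lemma sub_triple A B g h : triple A g h -> measurable B -> B `<=` A -> triple B g h.
Proof.
case=> mg mh gh mB BA; split; [exact: sub_moved BA|exact: sub_moved BA|].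
by move=> x y /BA Ax /BA Ay; exact: gh.
Qed.

Lemma measurable_moved g A : moved g A -> measurable A. Proof. by case. Qed.

Lemma supp_sw g A : moved g A -> supp (sw g A) = A `|` ainv g @^-1` A.
Proof.
move=> mg; have [mA disj] := mg; apply/seteqP; split=> x; rewrite /supp /=.
  move=> n; apply: contrapT => /not_orP[nA nI]; apply: n; apply: sw_out => // y Ay gy.
  by apply: nI; rewrite /preimage /= -gy afunK.
case=> [Ax|Ix]; first by rewrite sw_on // => e; apply: (disj x Ax); rewrite e.
have {1 2}-> : x = g (ainv g x) by rewrite ainvK.
rewrite sw_im // => e; apply: (disj _ Ix).
by rewrite -e.
Qed.

Lemma pr_supp_sw g A : moved g A -> pr mu (supp (sw g A)) = 2 * pr mu A.
Proof.
move=> mg; have [mA disj] := mg; rewrite supp_sw // prU //.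
- by rewrite pr_ainv // mulr2n mulrDl mul1r.
- exact: measurable_ainv.
- apply/seteqP; split=> x // [Ax Ix]; apply: (disj _ Ix).
  by rewrite ainvK.
Qed.

(** A swap over [A] is the product of the swaps over the parts of [A]; these have
    disjoint supports. *)
Lemma sw_split g A B : moved g A -> measurable B ->
  sw g A =1 baut_comp (sw g (A `&` B)) (sw g (A `\` B)) /\
  forall x, sw g (A `&` B) x = x \/ sw g (A `\` B) x = x.
Proof.
move=> mg mB; have [mA disj] := mg.
have m1 : moved g (A `&` B) by apply: sub_moved mg _ _ => //; exact: measurableI.
have m2 : moved g (A `\` B) by apply: sub_moved mg _ _ => //; exact: measurableD.
have on1 x : A x -> B x -> [/\ sw g (A `\` B) x = x, sw g (A `\` B) (g x) = g x,
    sw g (A `&` B) x = g x & sw g (A `&` B) (g x) = x].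
  move=> Ax Bx; split; [|  |exact: sw_on|exact: sw_im]; apply: sw_out => //.
  - by case.
  - by move=> y [Ay _] e; apply: (disj y Ay); rewrite e.
  - by case=> /(disj x Ax).
  - by move=> y [_ nBy] /afun_inj e; apply: nBy; rewrite e.
have on2 x : A x -> ~ B x -> [/\ sw g (A `&` B) x = x, sw g (A `&` B) (g x) = g x,
    sw g (A `\` B) x = g x & sw g (A `\` B) (g x) = x].
  move=> Ax nBx; split; [|  |exact: sw_on|exact: sw_im]; apply: sw_out => //.
  - by case.
  - by move=> y [Ay _] e; apply: (disj y Ay); rewrite e.
  - by case=> /(disj x Ax).
  - by move=> y [_ By] /afun_inj e; apply: nBx; rewrite -e.
split=> x /=; case: (sw_cases x mg) => [Ax|[y Ay ->]|[nA nI]].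
- rewrite sw_on //; case: (pselect (B x)) => Bx.
    by have [e1 _ e2 _] := on1 x Ax Bx; rewrite e1 e2.
  by have [_ e1 e2 _] := on2 x Ax Bx; rewrite e2 e1.
- rewrite sw_im //; case: (pselect (B y)) => By.
    by have [_ e1 _ e2] := on1 y Ay By; rewrite e1 e2.
  by have [e1 _ _ e2] := on2 y Ay By; rewrite e2 e1.
- rewrite sw_out //; have -> : sw g (A `\` B) x = x.
    by apply: sw_out => // [[]//|y [Ay _]]; exact: nI.
  by rewrite sw_out // => [[]//|y [Ay _]]; exact: nI.
- case: (pselect (B x)) => Bx; first by right; have [] := on1 x Ax Bx.
  by left; have [] := on2 x Ax Bx.
- case: (pselect (B y)) => By; first by right; have [] := on1 y Ay By.
  by left; have [] := on2 y Ay By.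
- by left; rewrite sw_out // => [[]//|y [Ay _]]; exact: nI.
Qed.

Lemma act_sw_split g A B : moved g A -> measurable B -> \forall w \near ae,
  act_supp (sw g A) w <-> act_supp (sw g (A `&` B)) w \/ act_supp (sw g (A `\` B)) w.
Proof.
move=> mg mB; have [e dj] := sw_split mg mB.
apply: filterS3 (ae_ext e) (act_comp_disjoint dj) (disjoint_act_supp dj) => w.
rewrite /act_supp /= => -> [h1 h2] h3; case: (pselect (sg (sw g (A `&` B)) w = w)) => h.
  by rewrite h2 //; split; [right|case].
by rewrite h1 //; split=> //; left.
Qed.

Lemma act_sw_sub g A B : moved g A -> measurable B -> B `<=` A ->
  \forall w \near ae, act_supp (sw g B) w -> act_supp (sw g A) w.
Proof.
move=> mg mB BA; apply: filterS (act_sw_split mg mB) => w ->.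
by rewrite (_ : A `&` B = B); [left|rewrite setIC; exact/setIidPl].
Qed.

Lemma Theta_sub A B g h : triple A g h -> measurable B -> B `<=` A ->
  \forall w \near ae, Theta B g h w -> Theta A g h w.
Proof.
case=> mg mh _ mB BA; apply: filterS2 (act_sw_sub mg mB BA) (act_sw_sub mh mB BA).
by move=> w h1 h2 [/h1 ? /h2 ?].
Qed.

Lemma disjoint_sw g A (f : baut E) : moved g A -> (forall x, A x -> f x = x) ->
  (forall x, A x -> f (g x) = g x) ->
  \forall w \near ae, ~ (act_supp f w /\ act_supp (sw g A) w).
Proof.
move=> mg fA fgA.
have dj x : f x = x \/ sw g A x = x.
  case: (sw_cases x mg) => [/fA|[y Ay ->]|[nA nI]]; [by left|by left; exact: fgA|].
  by right; exact: sw_out.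
by apply: filterS (disjoint_act_supp dj) => w [e [/(_ e)]|e [_ /(_ e)]].
Qed.

(** The supports of [sw g] over one part of [A] and of [sw h] over the other are
    disjoint, so that no mixed terms appear. *)
Lemma Theta_split A B g h : triple A g h -> measurable B ->
  \forall w \near ae, Theta A g h w -> Theta (A `&` B) g h w \/ Theta (A `\` B) g h w.
Proof.
move=> tr mB; have [mg mh gh] := tr; have mA := measurable_moved mg.
have mI : measurable (A `&` B) by exact: measurableI.
have mD : measurable (A `\` B) by exact: measurableD.
have cross g' h' : triple A g' h' ->
    \forall w \near ae, ~ (act_supp (sw g' (A `&` B)) w /\ act_supp (sw h' (A `\` B)) w).
  move=> [mg' mh' gh'].
  have m1 : moved g' (A `&` B) by apply: sub_moved mg' mI _ => x [].
  have m2 : moved h' (A `\` B) by apply: sub_moved mh' mD _ => x [].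
  apply: (disjoint_sw m2) => x [Ax nBx]; apply: sw_out => //.
  - by case.
  - by move=> y [Ay _] e; apply: (mg'.2 y Ay); rewrite e.
  - by case=> Ahx; have := mh'.2 x Ax.
  - by move=> y [Ay _]; exact: gh'.
apply: filterS3 (act_sw_split mg mB) (act_sw_split mh mB) (filterI (cross _ _ tr) (cross _ _ (triple_sym tr))).
move=> w h1 h2 [/= h3 h4] [/h1 [k1|k1] /h2 [k2|k2]].
- by left.
- by exfalso; exact: h3.
- by exfalso; exact: h4.
- by right.
Qed.

(** The third side of the triangle: the swap between [g A] and [h A], obtained by
    conjugating one swap by the other. *)
Definition opp_swap A g h := baut_comp (sw g A) (baut_comp (sw h A) (sw g A)).

Lemma triple_values A g h x : triple A g h -> A x ->
  [/\ sw g A x = g x, sw g A (g x) = x, sw g A (h x) = h x &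
     [/\ sw h A x = h x, sw h A (h x) = x & sw h A (g x) = g x]].
Proof.
move=> [mg mh gh] Ax; split; [exact: sw_on|exact: sw_im| |split; [exact: sw_on|exact: sw_im|]].
- by apply: sw_out => // [|y Ay]; [exact: (mh.2 x Ax)|exact: gh].
- by apply: sw_out => // [|y Ay /esym]; [exact: (mg.2 x Ax)|exact: gh].
Qed.

Lemma triple_cases A g h x : [\/ A x, exists2 y, A y & x = g y,
  exists2 y, A y & x = h y |
  [/\ ~ A x, (forall y, A y -> g y <> x) & forall y, A y -> h y <> x]].
Proof.
case: (pselect (A x)) => [|nA]; first by constructor 1.
case: (pselect (exists2 y, A y & x = g y)) => [|nI]; first by constructor 2.
case: (pselect (exists2 y, A y & x = h y)) => [|nJ]; first by constructor 3.
constructor 4; split=> // y Ay yx; [apply: nI|apply: nJ]; by exists y.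
Qed.

Lemma opp_swap_values A g h : triple A g h ->
  [/\ forall x, A x -> opp_swap A g h x = x,
      forall x, A x -> opp_swap A g h (g x) = h x,
      forall x, A x -> opp_swap A g h (h x) = g x &
      forall x, opp_swap A g h (opp_swap A g h x) = x].
Proof.
move=> tr.
have h1 x : A x -> opp_swap A g h x = x.
  by move=> Ax; have [a1 a2 a3 [b1 b2 b3]] := triple_values tr Ax; rewrite /= a1 b3 a2.
have h2 x : A x -> opp_swap A g h (g x) = h x.
  by move=> Ax; have [a1 a2 a3 [b1 b2 b3]] := triple_values tr Ax; rewrite /= a2 b1 a3.
have h3 x : A x -> opp_swap A g h (h x) = g x.
  by move=> Ax; have [a1 a2 a3 [b1 b2 b3]] := triple_values tr Ax; rewrite /= a3 b2 a1.
split=> // x; have [mg mh _] := tr; case: (@triple_cases A g h x).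
- by move=> Ax; rewrite !h1.
- by move=> [y Ay ->]; rewrite h2 // h3.
- by move=> [y Ay ->]; rewrite h3 // h2.
- by move=> [nA nI nJ]; rewrite /= !(sw_out mg) // !(sw_out mh) // !(sw_out mg).
Qed.

(** Write [a], [b], [c] for the three swaps. The product [ab = ca = bc] has a support
    of measure [3 mu A], and each of its points is moved by at least two of [a], [b],
    [c]. With [D1], [D2], [D3] the sets of points moved by at least one, two, three of
    them, [dl D1 + dl D2 + dl D3 = 6 mu A] and [3 mu A <= dl D2 <= dl D1]. Hence [D3]
    is negligible and [D1], [D2] both have measure [3 mu A]. *)
Lemma triangle_count A g h : triple A g h ->
  (\forall w \near ae, ~ (Theta A g h w /\ act_supp (opp_swap A g h) w)) /\
  dl (Theta A g h) = pr mu A.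
Proof.
move=> tr; have [mg mh gh] := tr; have mA := measurable_moved mg.
pose a := sw g A; pose b := sw h A; pose c := opp_swap A g h; pose p := baut_comp a b.
have aK x : a (a x) = x.
  case: (sw_cases x mg) => [Ax|[y Ay ->]|[nA nI]]; rewrite /a.
  - by rewrite (sw_on mg Ax) sw_im.
  - by rewrite (sw_im mg Ay) sw_on.
  - by rewrite !(sw_out mg nA nI).
have pE y : p y = a (b y) by [].
have bcE y : baut_comp b c y = b (c y) by [].
have pca : p =1 baut_comp c a by move=> x; rewrite /= -/a -/b !aK.
have pbc : p =1 baut_comp b c.
  move=> x; have [c1 c2 c3 _] := opp_swap_values tr.
  case: (@triple_cases A g h x) => [Ax|[y Ay ->]|[y Ay ->]|[nA nI nJ]].
  - have [a1 a2 a3 [b1 b2 b3]] := triple_values tr Ax.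
    by rewrite pE bcE c1 // /b /a b1 a3.
  - have [a1 a2 a3 [b1 b2 b3]] := triple_values tr Ay.
    by rewrite pE bcE c2 // /b /a b3 a2 b2.
  - have [a1 a2 a3 [b1 b2 b3]] := triple_values tr Ay.
    by rewrite pE bcE c3 // /b /a b2 a1 b3.
  - have cx : c x = x.
      by rewrite /c /= !(sw_out mg nA nI) !(sw_out mh nA nJ) !(sw_out mg nA nI).
    by rewrite pE bcE cx /a /b (sw_out mh nA nJ) (sw_out mg nA nI).
have da : dl (act_supp a) = 2 * pr mu A by rewrite dl_supp pr_supp_sw.
have db : dl (act_supp b) = 2 * pr mu A by rewrite dl_supp pr_supp_sw.
have dc : dl (act_supp c) = 2 * pr mu A.
  rewrite dl_supp -(pr_supp_sw mh) -(pr_baut E_mp a); last exact: measurable_supp.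
  congr (pr mu _); apply/seteqP; split=> x; move=> n e; apply: n.
    by rewrite -[LHS]/(a (b (a (a x)))) aK e.
  apply: (@afun_inj _ _ E a); rewrite -[RHS]e.
  by rewrite -[RHS]/(a (b (a (a x)))) aK.
have mga : measurable (ainv g @^-1` A) by exact: measurable_ainv.
have mha : measurable (ainv h @^-1` A) by exact: measurable_ainv.
have dp : dl (act_supp p) = 3 * pr mu A.
  rewrite dl_supp (_ : supp p = (A `|` ainv g @^-1` A) `|` ainv h @^-1` A).
    rewrite prU ?prU //.
    + by rewrite !pr_ainv //; lra.
    + apply/seteqP; split=> x // [Ax gx]; apply: (mg.2 _ gx).
      by rewrite ainvK.
    + exact: measurableU.
    + apply/seteqP; split=> x // [[Ax|gx] hx].
        by apply: (mh.2 _ hx); rewrite ainvK.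
      by apply: (gh _ _ gx hx); rewrite !ainvK.
  apply/seteqP; split=> x.
    case: (@triple_cases A g h x) => [Ax|[y Ay ->]|[y Ay ->]|[nA nI nJ]] n.
    - by left; left.
    - by left; right; rewrite /preimage /= afunK.
    - by right; rewrite /preimage /= afunK.
    - by exfalso; apply: n; rewrite /p /= /a /b (sw_out mh) // (sw_out mg).
  case=> [[Ax|gx]|hx]; rewrite /supp /p /= /a /b.
  - have [a1 a2 a3 [b1 b2 b3]] := triple_values tr Ax; rewrite b1 a3 => e.
    by apply: (mh.2 x Ax); rewrite e.
  - have [a1 a2 a3 [b1 b2 b3]] := triple_values tr gx.
    have e0 : g (ainv g x) = x by rewrite ainvK.
    rewrite e0 in a1 a2 b3; rewrite b3 a2 => e.
    by apply: (mg.2 _ gx); rewrite e0 -e.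
  - have [a1 a2 a3 [b1 b2 b3]] := triple_values tr hx.
    have e0 : h (ainv h x) = x by rewrite ainvK.
    rewrite e0 in b1 b2 a3; rewrite b2 a1 => e.
    by apply: (gh _ _ hx hx); rewrite e0.
pose Sa := act_supp a; pose Sb := act_supp b; pose Sc := act_supp c.
pose D1 := (Sa `|` Sb) `|` Sc; pose D2 := (Sa `&` Sb) `|` ((Sa `|` Sb) `&` Sc).
pose D3 := (Sa `&` Sb) `&` Sc.
have sum : dl D1 + dl D2 + dl D3 = 6 * pr mu A.
  have := dlUI Sa Sb; have := dlUI (Sa `|` Sb) Sc.
  have := dlUI (Sa `&` Sb) ((Sa `|` Sb) `&` Sc).
  rewrite -/D1 -/D2 (_ : _ `&` (_ `&` Sc) = D3); last first.
    apply/seteqP; split=> w; first by case=> ? [_ ?]; split.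
    by move=> [[? ?] ?]; split=> //; split=> //; left.
  rewrite /Sa /Sb /Sc da db dc; lra.
have pD2 : dl (act_supp p) <= dl D2.
  have t1 := act_supp_comp a b; have t2 := act_supp_comp c a; have t3 := act_supp_comp b c.
  have e2 := ae_ext pca; have e3 := ae_ext pbc.
  apply: ae_le; apply: filterS3 t1 (filterI t2 e2) (filterI t3 e3).
  move=> w h1 [/= h2 k2] [/= h3 k3] pw.
  have q1 := h1 pw; rewrite -k2 in h2; have q2 := h2 pw; rewrite -k3 in h3; have q3 := h3 pw.
  rewrite /D2 /Sa /Sb /Sc /act_supp /setU /setI /=; tauto.
have D21 : dl D2 <= dl D1.
  by apply: dl_le => w [[? ?]|[? ?]]; left => //; left.
have D3_0 := dl_ge0 D3; rewrite dp in pD2.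
have D30 : dl D3 = 0 by lra.
split.
  by apply/aeE; rewrite -D30; congr dl; apply/seteqP; split=> w /=; [move/contrapT|move=> ? ?].
have dab : dl (Sa `|` Sb) = dl D1.
  have e12 : dl (D1 `\` D2) = 0.
    have := dlID D1 D2; rewrite (_ : D1 `&` D2 = D2); first by lra.
    by apply/seteqP; split=> [w []//|w D2w]; split=> //; case: D2w => [[? ?]|[? ?]]; left => //; left.
  apply/eqP; rewrite eq_le dl_le //=; last by move=> w ?; left.
  apply: ae_le; apply/aeE; apply/eqP; rewrite eq_le dl_ge0 andbT -e12.
  apply: dl_le => w /not_implyP[D1w nab]; split=> // -[[? ?]|[? ?]]; apply: nab => //.
  by left.
have := dlUI Sa Sb; rewrite dab /Theta -/a -/b -/Sa -/Sb da db; lra.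
Qed.

Lemma dl_Theta A g h : triple A g h -> dl (Theta A g h) = pr mu A.
Proof. by move=> /triangle_count[]. Qed.

(** Finite additivity is enough to treat a countable cover: after the removal of
    finitely many [B n] what remains of [A] is close to [A] minus the union, and the
    measure of its copy is known by [dl_Theta]. *)
Lemma Theta_cover A g h (Z : set W) (B : nat -> set X) : triple A g h ->
  (forall n, measurable (B n)) ->
  (forall n, \forall w \near ae, ~ (Z w /\ Theta (A `&` B n) g h w)) ->
  dl (Z `&` Theta A g h) <= pr mu (A `\` \bigcup_n B n).
Proof.
move=> tr mB ZB; have [mg _ _] := tr; have mA := measurable_moved mg.
pose C n := A `\` \bigcup_(i in `I_n) B i.
have mU n : measurable (\bigcup_(i in `I_n) B i) by exact: bigcup_measurable.
have mC n : measurable (C n) by exact: measurableD.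
have CA n : C n `<=` A by move=> x [].
have trC n : triple (C n) g h by exact: sub_triple tr (mC n) (CA n).
have step n : \forall w \near ae, Z w -> Theta A g h w -> Theta (C n) g h w.
  elim: n => [|n IH].
    by apply: filterS filterT => w _ _; rewrite /C II0 bigcup_set0 setD0.
  have sub : C n `&` B n `<=` A `&` B n by move=> x [[]].
  have mAB : measurable (A `&` B n) by exact: measurableI.
  have trAB : triple (A `&` B n) g h by apply: sub_triple tr mAB _ => x [].
  have mCB : measurable (C n `&` B n) by exact: measurableI.
  have mono := Theta_sub trAB mCB sub.
  apply: filterS3 IH (filterI (ZB n) mono) (Theta_split (trC n) (mB n)).
  move=> w h1 [/= h2 h3] h4 Zw TA; case: (h4 (h1 Zw TA)) => [T1|].
    by exfalso; apply: h2; split=> //; exact: h3.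
  rewrite (_ : C n `\` B n = C n.+1) //.
  apply/seteqP; split=> x.
    move=> [[Ax nU] nB]; split=> // -[i /= + Bi]; rewrite ltnS leq_eqVlt.
    by case/predU1P => [e|il]; [apply: nB; rewrite -e|apply: nU; exists i].
  move=> [Ax nU]; split; [split=> // -[i /= il Bi]|move=> Bn]; apply: nU.
    by exists i => //=; exact: ltnW.
  by exists n => /=.
rewrite leNgt; apply/negP => lt.
pose U := \bigcup_i B i; have mUU : measurable U by exact: bigcup_measurable.
pose e := dl (Z `&` Theta A g h) - pr mu (A `\` U).
have e0 : 0 < e by rewrite /e subr_gt0.
have [n small] := pr_small mu mB e0.
have le1 : dl (Z `&` Theta A g h) <= pr mu (C n).
  rewrite -(dl_Theta (trC n)); apply: ae_le; apply: filterS (step n) => w h1 [Zw Tw].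
  exact: h1.
have le2 : pr mu (C n) <= pr mu (A `\` U) + pr mu (U `\` \bigcup_(i in `I_n) B i).
  have mAU : measurable (A `\` U) by exact: measurableD.
  have mUn : measurable (U `\` \bigcup_(i in `I_n) B i) by exact: measurableD.
  apply: le_trans (prU_le mu mAU mUn); apply: le_pr => //; first exact: measurableU.
  by move=> x [Ax nx]; case: (pselect (U x)) => Ux; [right|left].
rewrite /e in small; lra.
Qed.

Lemma Theta_cover0 A g h (Z : set W) (B : nat -> set X) : triple A g h ->
  (forall n, measurable (B n)) -> A `<=` \bigcup_n B n ->
  (forall n, \forall w \near ae, ~ (Z w /\ Theta (A `&` B n) g h w)) ->
  \forall w \near ae, ~ (Z w /\ Theta A g h w).
Proof.
move=> tr mB AB ZB; apply/aeE; apply/eqP; rewrite eq_le dl_ge0 andbT.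
have := Theta_cover tr mB ZB; rewrite (_ : A `\` _ = set0) ?pr0; last first.
  by apply/seteqP; split=> x // [/AB].
apply: le_trans; apply: dl_le => w /=; exact: contrapT.
Qed.

Lemma Theta_cover2 A g h (Z : set W) (B : set X) : triple A g h ->
  measurable B ->
  (\forall w \near ae, ~ (Z w /\ Theta (A `&` B) g h w)) ->
  (\forall w \near ae, ~ (Z w /\ Theta (A `\` B) g h w)) ->
  \forall w \near ae, ~ (Z w /\ Theta A g h w).
Proof.
move=> tr mB Z1 Z2; apply: filterS3 Z1 Z2 (Theta_split tr mB).
by move=> w h1 h2 h3 [Zw /h3[Tw|Tw]]; [apply: h1|apply: h2].
Qed.

Definition fixes f A := forall x, A x -> f x = x.

(** If [f] fixes [g A] as well, its support is disjoint from that of [sw g A]. *)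
Lemma fixed_image_disjoint A g h f : triple A g h -> fixes f A ->
  (forall x, A x -> f (g x) = g x) ->
  \forall w \near ae, ~ (act_supp f w /\ Theta A g h w).
Proof.
move=> [mg mh _] fA fg; apply: filterS (disjoint_sw mg fA fg) => w h1 [Sf [Sg _]].
exact: h1.
Qed.

(** If [f] exchanges [g A] and [h A], its product with the third swap [c] fixes [A] and
    [g A]. By [triangle_count] [c] moves almost no point of the copy of [A]. *)
Lemma swapped_images_disjoint A g h f : triple A g h -> fixes f A ->
  (forall x, A x -> f (g x) = h x) -> (forall x, A x -> f (h x) = g x) ->
  \forall w \near ae, ~ (act_supp f w /\ Theta A g h w).
Proof.
move=> tr fA fg fh; have [c1 c2 c3 cK] := opp_swap_values tr.
(* [c] is an involution, so that [f = c f'] *)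
pose c := opp_swap A g h; pose f' := baut_comp c f.
have ff' : f =1 baut_comp c f' by move=> x; rewrite -[RHS]/(c (c (f x))) cK.
have f'A : fixes f' A by move=> x Ax; rewrite -[LHS]/(c (f x)) fA // c1.
have f'g x : A x -> f' (g x) = g x by move=> Ax; rewrite -[LHS]/(c (f (g x))) fg // c3.
apply: filterS3 (fixed_image_disjoint tr f'A f'g) (triangle_count tr).1
  (filterI (act_supp_comp c f') (ae_ext ff')).
move=> w h1 h2 [/= h3 e] [Sf Tw]; rewrite /act_supp /= e in Sf.
by case: (h3 Sf) => S1; [apply: h2|apply: h1].
Qed.

(** Let [k] be the swap of [g A] with [f (g A)], a set disjoint from [A], [g A] and
    [h A]. Then [k f] fixes [A] and [g A], while [k] itself fixes [A] and [h A]. *)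
Lemma separated_image_disjoint A g h f : triple A g h -> fixes f A ->
  (forall x y, A x -> A y -> f (g x) <> g y) ->
  (forall x y, A x -> A y -> f (g x) <> h y) ->
  \forall w \near ae, ~ (act_supp f w /\ Theta A g h w).
Proof.
move=> tr fA fgg fgh; have [mg mh gh] := tr; have mA := measurable_moved mg.
pose C := ainv g @^-1` A.
have CP x : C x <-> exists2 y, A y & x = g y.
  rewrite /C /preimage /=; split=> [Ax|[y Ay ->]]; last by rewrite afunK.
  by exists (ainv g x); rewrite ?ainvK.
have mC : moved f C.
  split; first exact: measurable_ainv.
  by move=> x /CP[y Ay ->] /CP[z Az] /(fgg _ _ Ay Az).
pose k := sw f C; pose f' := baut_comp k f.
have kK x : k (k x) = x.
  case: (sw_cases x mC) => [Cx|[y Cy ->]|[nC nI]]; rewrite /k.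
  - by rewrite (sw_on mC Cx) sw_im.
  - by rewrite (sw_im mC Cy) sw_on.
  - by rewrite !(sw_out mC nC nI).
have ff' : f =1 baut_comp k f' by move=> x; rewrite -[RHS]/(k (k (f x))) kK.
have kA : fixes k A.
  move=> x Ax; apply: sw_out => //.
    by move=> /CP[y Ay xy]; apply: (mg.2 y Ay); rewrite -xy.
  move=> y /CP[z Az ->] e.
  have /afun_inj e1 : f (f (g z)) = f (g z) by rewrite e fA.
  by apply: (fgg z z).
have kh x : A x -> k (h x) = h x.
  move=> Ax; apply: sw_out => //.
    by move=> /CP[y Ay] /esym; exact: gh.
  by move=> y /CP[z Az ->]; exact: fgh.
have f'A : fixes f' A by move=> x Ax; rewrite -[LHS]/(k (f x)) fA // kA.
have f'g x : A x -> f' (g x) = g x.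
  move=> Ax; rewrite -[LHS]/(k (f (g x))) /k sw_im //; apply/CP; by exists x.
have K := fixed_image_disjoint (triple_sym tr) kA kh.
apply: filterS3 (fixed_image_disjoint tr f'A f'g) K
  (filterI (act_supp_comp k f') (ae_ext ff')).
move=> w h1 h2 [/= h3 e] [Sf Tw]; rewrite /act_supp /= e in Sf.
by case: (h3 Sf) => S1; [apply: h2; rewrite Theta_sym|apply: h1].
Qed.

(** Cut [A] into pieces to which [separated_image_disjoint] applies. *)
Lemma moved_image_disjoint A g h f : triple A g h -> fixes f A ->
  (forall x, A x -> f (g x) <> g x) -> (forall x, A x -> f (g x) <> h x) ->
  \forall w \near ae, ~ (act_supp f w /\ Theta A g h w).
Proof.
move=> tr fA fgg fgh; have [mg _ _] := tr; have mA := measurable_moved mg.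
have [S [mS Sd Sc]] := separate cd (baut_comp f g) g.
have [T [mT Td Tc]] := separate cd (baut_comp f g) h.
apply: (@Theta_cover0 _ _ _ _ S) => //.
  by move=> x Ax; have [n Sn] := Sc x (fgg x Ax); exists n.
move=> n; have mAS : measurable (A `&` S n) by exact: measurableI.
have trS : triple (A `&` S n) g h by apply: sub_triple tr mAS _ => x [].
apply: (@Theta_cover0 _ _ _ _ T) => //.
  by move=> x [Ax _]; have [m Tm] := Tc x (fgh x Ax); exists m.
move=> m; have mAST : measurable (A `&` S n `&` T m) by exact: measurableI.
have trST : triple (A `&` S n `&` T m) g h by apply: sub_triple trS mAST _ => x [].
apply: (separated_image_disjoint trST).
- by move=> x [[/fA]].
- by move=> x y [[_ Sx] _] [[_ Sy] _]; exact: Sd Sx Sy.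
- by move=> x y [[_ _] Tx] [[_ _] Ty]; exact: Td Tx Ty.
Qed.

(** Cut [A] according to whether [f] fixes [g x], or fixes [h x], or exchanges the
    two; in the remaining case it sends one of [g x], [h x] outside these two points. *)
Lemma fixes_disjoint A g h f : triple A g h -> fixes f A ->
  \forall w \near ae, ~ (act_supp f w /\ Theta A g h w).
Proof.
move=> tr fA; have [mg mh _] := tr; have mA := measurable_moved mg.
have sub B : measurable B -> B `<=` A -> triple B g h /\ fixes f B.
  by move=> mB BA; split; [exact: sub_triple tr mB BA|move=> x /BA /fA].
pose B0 := [set x | baut_comp f g x = g x]; pose B1 := [set x | baut_comp f h x = h x].
pose B2 := [set x | baut_comp f g x = h x]; pose B3 := [set x | baut_comp f h x = g x].
have mB0 : measurable B0 by exact: measurable_bauteq.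
have mB1 : measurable B1 by exact: measurable_bauteq.
have mB2 : measurable B2 by exact: measurable_bauteq.
have mB3 : measurable B3 by exact: measurable_bauteq.
have mI C B : measurable C -> measurable B -> measurable (C `&` B) by exact: measurableI.
have mD C B : measurable C -> measurable B -> measurable (C `\` B) by exact: measurableD.
apply: (Theta_cover2 tr mB0).
  have [|tr0 f0] := sub _ (mI _ _ mA mB0); first by move=> x [].
  by apply: (fixed_image_disjoint tr0) => // x [].
have mA1 := mD _ _ mA mB0.
have [|tr1 f1] := sub _ mA1; first by move=> x [].
apply: (Theta_cover2 tr1 mB1).
  have [|tr0 f0] := sub _ (mI _ _ mA1 mB1); first by move=> x [[]].
  have := @fixed_image_disjoint _ h g f (triple_sym tr0) f0.
  by rewrite Theta_sym; apply=> x [].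
have mA2 := mD _ _ mA1 mB1.
have [|tr2 f2] := sub _ mA2; first by move=> x [[]].
apply: (Theta_cover2 tr2 mB2); last first.
  have mA3 := mD _ _ mA2 mB2.
  have [|tr3 f3] := sub _ mA3; first by move=> x [[[]]].
  by apply: moved_image_disjoint => // x [[[_ ?] _] ?].
have mA3 := mI _ _ mA2 mB2.
have [|tr3 f3] := sub _ mA3; first by move=> x [[[]]].
apply: (Theta_cover2 tr3 mB3).
  have [|tr4 f4] := sub _ (mI _ _ mA3 mB3); first by move=> x [[[[]]]].
  by apply: swapped_images_disjoint => // x [[_ ?] ?].
have [|tr4 f4] := sub _ (mD _ _ mA3 mB3); first by move=> x [[[[]]]].
rewrite Theta_sym; apply: (moved_image_disjoint (triple_sym tr4)) => // x.
- by move=> [[[_ ?] _] _].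
- by move=> [_ ?].
Qed.

(** Apply [fixes_disjoint] to [f2^-1 f1]. *)
Lemma agree_Theta A g h f1 f2 : triple A g h -> (forall x, A x -> f1 x = f2 x) ->
  \forall w \near ae, Theta A g h w -> sg f1 w = sg f2 w.
Proof.
move=> tr f12; pose k := baut_comp (baut_inv f2) f1.
have kA : fixes k A by move=> x Ax; rewrite /= f12 // afunK.
have f1E : f1 =1 baut_comp f2 k by move=> x; rewrite /= ainvK.
apply: filterS3 (fixes_disjoint tr kA) (ae_ext f1E) (ae_mul f2 k).
move=> w h1 -> -> Tw; congr sg; apply: contrapT => n; exact: h1.
Qed.

(** Where [g'] or [h'] leads from [B] to a point outside [A], the corresponding swap
    fixes [A], and [fixes_disjoint] applies. On the rest [C] of [B] both images lie in
    [A]; they are disjoint, so each point of [A] is fixed by the swap of [g'] or by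
    that of [h'] over [C]. *)
Lemma Theta_disjoint A B g h g' h' : triple A g h -> triple B g' h' ->
  A `&` B = set0 -> \forall w \near ae, ~ (Theta A g h w /\ Theta B g' h' w).
Proof.
move=> trA trB AB; have [mg mh gh] := trA; have [mg' mh' gh'] := trB.
have mA := measurable_moved mg; have mB := measurable_moved mg'.
have nAB x : A x -> ~ B x by move=> Ax Bx; have : (A `&` B) x by []; rewrite AB.
(* the swap of [k] over [C] fixes [A] when [k] sends [C] off [A] *)
have off C k l : triple C k l -> C `<=` B -> (forall x, C x -> ~ A (k x)) ->
    \forall w \near ae, ~ (Theta A g h w /\ Theta C k l w).
  move=> [mk ml kl] CB kA.
  have fA : fixes (sw k C) A.
    move=> x Ax; apply: sw_out => // [Cx|y Cy e]; first exact: (nAB x Ax (CB x Cx)).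
    by apply: (kA y Cy); rewrite e.
  by apply: filterS (fixes_disjoint trA fA) => w h1 [TA [TC _]]; apply: h1.
have mgA : measurable (g' @^-1` A) by exact: measurable_afun.
have mhA : measurable (h' @^-1` A) by exact: measurable_afun.
have mI (C D : set X) : measurable C -> measurable D -> measurable (C `&` D) by exact: measurableI.
have mD (C D : set X) : measurable C -> measurable D -> measurable (C `\` D) by exact: measurableD.
apply: (Theta_cover2 trB mgA); last first.
  apply: (@off _ g' h') => [|x []//|x []//].
  by apply: sub_triple trB (mD _ _ mB mgA) _ => x [].
have m1 := mI _ _ mB mgA.
have tr1 : triple (B `&` g' @^-1` A) g' h' by apply: sub_triple trB m1 _ => x [].
apply: (Theta_cover2 tr1 mhA); last first.
  rewrite (Theta_sym _ g' h'); apply: (@off _ h' g') => [|x [[]]//|x []//].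
  by apply/triple_sym/(sub_triple tr1 (mD _ _ m1 mhA)) => x [].
have m2 := mI _ _ m1 mhA; set C := (_ `&` _) in m2 *.
have trC : triple C g' h' by apply: sub_triple tr1 m2 _ => x [].
have mCg : measurable (ainv g' @^-1` C) by exact: measurable_ainv.
have CP x : (ainv g' @^-1` C) x -> exists2 y, C y & x = g' y.
  by move=> Cx; exists (ainv g' x) => //; rewrite ainvK.
have [mgC mhC ghC] := trC.
have key : \forall w \near ae, ~ (Theta C g' h' w /\ Theta A g h w); last first.
  by apply: filterS key => w h1 [? ?]; apply: h1.
apply: (Theta_cover2 trA mCg).
  have trA1 : triple (A `&` ainv g' @^-1` C) g h by apply: sub_triple trA (mI _ _ mA mCg) _ => x [].
  have fA : fixes (sw h' C) (A `&` ainv g' @^-1` C).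
    move=> x [Ax /CP[y Cy xy]]; apply: sw_out => //; first by case=> [[Bx _] _]; exact: (nAB x).
    by move=> z Cz e; apply: (ghC y z Cy Cz); rewrite e.
  by apply: filterS (fixes_disjoint trA1 fA) => w h1 [[_ TC] TA]; apply: h1.
have trA2 : triple (A `\` ainv g' @^-1` C) g h by apply: sub_triple trA (mD _ _ mA mCg) _ => x [].
have fA : fixes (sw g' C) (A `\` ainv g' @^-1` C).
  move=> x [Ax nC]; apply: sw_out => //; first by case=> [[Bx _] _]; exact: (nAB x).
  by move=> z Cz e; apply: nC; rewrite /preimage /= -e afunK.
by apply: filterS (fixes_disjoint trA2 fA) => w h1 [[TC _] TA]; apply: h1.
Qed.

(** The conjugate of [g] by [f] plays on the image [im f A] the role of [g] on [A]. *)
Definition cj f g := baut_comp f (baut_comp g (baut_inv f)).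
Definition im f A : set X := ainv f @^-1` A.

Lemma triple_cj A g h f : triple A g h -> triple (im f A) (cj f g) (cj f h).
Proof.
move=> [[mA Ag] [_ Ah] gh]; have mi : measurable (im f A) by exact: measurable_ainv.
split; [split=> //|split=> //|].
- by move=> x; rewrite /im /preimage /= afunK; exact: Ag.
- by move=> x; rewrite /im /preimage /= afunK; exact: Ah.
- by move=> x y Ax Ay /= /afun_inj; exact: gh.
Qed.

Lemma sw_cj A g f : moved g A ->
  baut_comp (sw (cj f g) (im f A)) f =1 baut_comp f (sw g A).
Proof.
move=> mg x; have mi : moved (cj f g) (im f A).
  case: mg => mA Ag; split; first exact: measurable_ainv.
  by move=> y; rewrite /im /preimage /= afunK; exact: Ag.
rewrite /=; case: (sw_cases x mg) => [Ax|[y Ay ->]|[nA nI]].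
- by rewrite (sw_on mg Ax) (sw_on mi) /= ?afunK // /im /preimage /= afunK.
- rewrite (sw_im mg Ay) -[f (g y)]/(f (g y)).
  have -> : f (g y) = cj f g (f y) by rewrite /= afunK.
  by rewrite (sw_im mi) // /im /preimage /= afunK.
- rewrite (sw_out mg nA nI) (sw_out mi) //.
    by rewrite /im /preimage /= afunK.
  by move=> y Ay /= /afun_inj e; exact: (nI _ Ay).
Qed.

(** Conjugation by [f] carries the swaps over [A] to swaps over [f A]. *)
Lemma Theta_equiv A g h f : triple A g h ->
  \forall w \near ae, Theta (im f A) (cj f g) (cj f h) (sg f w) <-> Theta A g h w.
Proof.
move=> [mg mh _].
have one k : moved k A -> \forall w \near ae,
    act_supp (sw (cj f k) (im f A)) (sg f w) <-> act_supp (sw k A) w.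
  move=> mk; apply: filterS3 (ae_ext (sw_cj f mk)) (ae_mul (sw (cj f k) (im f A)) f)
    (ae_mul f (sw k A)) => w e1 e2 e3; rewrite /act_supp /= -e2 e1 e3.
  by split=> n e; apply: n; [rewrite e|exact: sg_inj e].
by apply: filterS2 (one g mg) (one h mh) => w h1 h2; rewrite /Theta /setI /= h1 h2.
Qed.

(** Cut [A] into pieces disjoint from their image under [f]; the copies of a piece
    and of its image are disjoint, and [sg f] carries one to the other. *)
Lemma moves_Theta A g h f : triple A g h -> (forall x, A x -> f x <> x) ->
  \forall w \near ae, Theta A g h w -> sg f w <> w.
Proof.
move=> tr fA; have [mg _ _] := tr; have mA := measurable_moved mg.
suff : \forall w \near ae, ~ ([set w | sg f w = w] w /\ Theta A g h w).
  by apply: filterS => w h1 Tw e; apply: h1.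
have [S [mS Sd Sc]] := separate cd f (baut_id E).
apply: (@Theta_cover0 _ _ _ _ S) => //.
  by move=> x Ax; have [n Sn] := Sc x (fA x Ax); exists n.
move=> n; have mAS : measurable (A `&` S n) by exact: measurableI.
have trS : triple (A `&` S n) g h by apply: sub_triple tr mAS _ => x [].
have dj : im f (A `&` S n) `&` (A `&` S n) = set0.
  apply/seteqP; split=> x // [[_ Sx] [_ Sx']].
  by apply: (Sd _ _ _ Sx Sx'); rewrite ainvK.
have D := ae_sg f (Theta_disjoint (triple_cj f trS) trS dj).
apply: filterS2 (Theta_equiv f trS) D => w h1 h2 [/= e Tw].
by apply: h2; split; [exact/h1|rewrite e].
Qed.

(** The swaps [sw g' A] and [sw h' A] move every point of [A], hence by [moves_Theta]
    almost every point of its copy [Theta A g h]. *)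
Lemma Theta_indep A g h g' h' : triple A g h -> triple A g' h' ->
  \forall w \near ae, Theta A g h w -> Theta A g' h' w.
Proof.
move=> tr [mg mh _].
have mv (k : baut E) : moved k A -> forall x, A x -> sw k A x <> x.
  by move=> mk x Ax; rewrite sw_on // => e; apply: (mk.2 x Ax); rewrite e.
have t1 := moves_Theta tr (mv _ mg); have t2 := moves_Theta tr (mv _ mh).
by apply: filterS2 t1 t2 => w h1 h2 Tw; split; [exact: h1|exact: h2].
Qed.

End Triples.

Section Models.
Implicit Types (A B : set X) (f g h : baut E) (psi : X -> option X) (G : W -> option W).

Lemma Theta_ind A g h (P : W -> Prop) (B : nat -> set X) : triple A g h ->
  (forall n, measurable (B n)) -> A `<=` \bigcup_n B n ->
  (forall n, triple (A `&` B n) g h ->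
    \forall w \near ae, Theta (A `&` B n) g h w -> P w) ->
  \forall w \near ae, Theta A g h w -> P w.
Proof.
move=> tr mB AB H; have [[mA _] _ _] := tr.
have : \forall w \near ae, ~ ([set w | ~ P w] w /\ Theta A g h w).
  apply: (Theta_cover0 tr mB AB) => n.
  have trn : triple (A `&` B n) g h.
    by apply: sub_triple tr _ _ => [|x []//]; exact: measurableI.
  by apply: filterS (H n trn) => w h1 [nP /h1].
by apply: filterS => w h1 Tw; apply: contrapT => nP; apply: h1.
Qed.

Lemma ae_lt n (P : nat -> W -> Prop) :
  (forall i, (i < n)%N -> \forall w \near ae, P i w) ->
  \forall w \near ae, forall i, (i < n)%N -> P i w.
Proof.
elim: n => [|n IH] H; first by apply: filterS filterT => w _ i.
apply: filterS2 (IH (fun i il => H i (ltnW il))) (H n (leqnn _)) => w h1 h2 i.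
by rewrite ltnS leq_eqVlt => /predU1P[->|/h1].
Qed.

Lemma Theta_null A g h : triple A g h -> pr mu A = 0 -> \forall w \near ae, ~ Theta A g h w.
Proof.
move=> tr A0; apply/aeE; apply/eqP; rewrite eq_le dl_ge0 andbT -A0 -(dl_Theta tr).
by apply: dl_le => w /=; exact: contrapT.
Qed.

(** [G] acts on the copy of a set [B] as [psi] acts on [B], whenever [psi] is undefined
    on [B] or agrees there with an automorphism. *)
Definition models psi G := forall B g h, triple B g h ->
  (forall f, (forall x, B x -> psi x = Some (f x)) ->
     \forall w \near ae, Theta B g h w -> G w = Some (sg f w)) /\
  ((forall x, B x -> psi x = None) -> \forall w \near ae, Theta B g h w -> G w = None).

Definition plocal psi := pmeasurable psi /\
  exists g : nat -> baut E, forall x y, psi x = Some y -> exists n, y = g n x.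

Lemma measurable_eq_baut psi f : pmeasurable psi -> measurable [set x | psi x = Some (f x)].
Proof.
by move=> mpsi; exact: (measurable_eqmap cd mpsi (fullB_measurable (fullB_of_baut f))).
Qed.

Lemma measurable_None psi : pmeasurable psi -> measurable [set x | psi x = None].
Proof.
move=> mpsi; rewrite (_ : mkset _ = ~` pdom psi).
  exact/measurableC/pmeasurable_dom.
by apply/seteqP; split=> x; rewrite /pdom /=; case: (psi x).
Qed.

Lemma plocal_cover psi : plocal psi -> exists (B : nat -> set X),
  [/\ forall n, measurable (B n), forall x, exists n, B n x &
    forall n, (exists f, forall x, B n x -> psi x = Some (f x)) \/
      (forall x, B n x -> psi x = None)].
Proof.
move=> [mpsi [g gP]].
exists (fun n => if n is n'.+1 then [set x | psi x = Some (g n' x)] else [set x | psi x = None]).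
split.
- by case=> [|n]; [exact: measurable_None|exact: measurable_eq_baut].
- move=> x; case E0: (psi x) => [y|]; last by exists 0%N.
  by have [n yn] := gP x y E0; exists n.+1; rewrite /= E0 yn.
- by case=> [|n]; [right|left; exists (g n)].
Qed.

(** A piece of the graph of a partial map: a set that has a copy in [W] and the
    automorphism with which the map agrees on it. *)
Record chart := Chart {
  cdom : set X; cmap : baut E; cleft : baut E; cright : baut E;
  chartP : triple cdom cleft cright }.

Section ChartMap.
Variables (c : nat -> chart) (J : nat).
Hypothesis cdom_disj : forall i j x, cdom (c i) x -> cdom (c j) x -> i = j.
Hypothesis cran_disj : forall i j x y, cdom (c i) x -> cdom (c j) y ->
  cmap (c i) x = cmap (c j) y -> i = j.

Let dT i := Theta (cdom (c i)) (cleft (c i)) (cright (c i)).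
Let rT i := Theta (im (cmap (c i)) (cdom (c i))) (cj (cmap (c i)) (cleft (c i)))
  (cj (cmap (c i)) (cright (c i))).
Let P w j := [/\ (j < J)%N, dT j w, rT j (sg (cmap (c j)) w) &
  forall i, (i < J)%N -> rT i (sg (cmap (c j)) w) -> i = j].

(** The copies of the ranges are disjoint only almost everywhere. The last clause of
    [P] recovers the chart from the value, so that the map is injective at every
    point. *)
Definition chart_map (w : W) : option W :=
  if pselect (exists j, P w j) is left _ then Some (sg (cmap (c (least (P w)))) w) else None.

Lemma chart_map_inj : pinjective chart_map.
Proof.
move=> w w' v; rewrite /chart_map; case: pselect => // -[j Pj].
case: pselect => // -[j' Pj'] [<-] [].
have [_ _ r1 _] := @least_spec (P w) j Pj.
have [lJ' _ r1' u1'] := @least_spec (P w') j' Pj'.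
have [lJ _ _ _] := @least_spec (P w) j Pj.
move=> e; rewrite -e in r1.
have e1 := u1' _ lJ r1; rewrite e1 in e; exact/esym/sg_inj/e.
Qed.

(** Outside a negligible set the copies of the domains are disjoint, and so are those
    of the ranges. *)
Lemma chart_map_models psi :
  (forall j x, (j < J)%N -> cdom (c j) x -> psi x = Some (cmap (c j) x)) ->
  (forall x, psi x <> None -> exists2 j, (j < J)%N & cdom (c j) x) ->
  models psi chart_map.
Proof.
move=> psiE psiD B g h tr; split=> [f Bf|BN]; last first.
  have : \forall w \near ae, forall i, (i < J)%N -> ~ (Theta B g h w /\ dT i w).
    apply: ae_lt => i iJ; apply: (Theta_disjoint tr (chartP (c i))).
    apply/seteqP; split=> x // [/BN + Dx].
    by rewrite (psiE i x iJ Dx).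
  apply: filterS => w h1 Tw; rewrite /chart_map; case: pselect => // h2.
  by exfalso; case: h2 => j [jJ dj _ _]; apply: (h1 j jJ).
pose D n := if (n < J)%N then cdom (c n) else set0.
have mD n : measurable (D n).
  by rewrite /D; case: ifP => _ //; have [[]] := chartP (c n).
apply: (Theta_ind tr mD) => [x Bx|n trn].
  have [|j jJ Dj] := psiD x; first by rewrite Bf.
  by exists j => //; rewrite /D jJ.
rewrite /D in trn *; case: ifP trn => nJ trn; last first.
  by apply: filterS (Theta_null trn _) => [w nT /nT //|]; rewrite setI0 pr0.
set C := B `&` cdom (c n) in trn *; set k := cmap (c n).
have [[mC _] _ _] := trn.
have CD : C `<=` cdom (c n) by move=> x [].
have trC := sub_triple (chartP (c n)) mC CD.
have H1 : \forall w \near ae, Theta C g h w -> dT n w.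
  apply: filterS2 (Theta_indep trn trC) (Theta_sub (chartP (c n)) mC CD).
  by move=> w h1 h2 /h1 /h2.
have H2 : \forall w \near ae, rT n (sg k w) <-> dT n w by exact: Theta_equiv (chartP (c n)).
have H3 : \forall w \near ae, forall i, (i < J)%N -> rT n (sg k w) -> rT i (sg k w) -> i = n.
  apply: ae_lt => i iJ; case: (eqVneq i n) => [->|/eqP ni]; first by apply: filterS filterT.
  apply: filterS (ae_sg k (Theta_disjoint (triple_cj (cmap (c i)) (chartP (c i)))
    (triple_cj k (chartP (c n))) _)) => [w h1 r1 r2|]; first by exfalso; apply: h1.
  apply/seteqP; split=> x // [Dx Dx']; apply: ni.
  by apply: (cran_disj Dx Dx'); rewrite !ainvK.
have H4 : \forall w \near ae, forall i, (i < J)%N -> dT n w -> dT i w -> i = n.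
  apply: ae_lt => i iJ; case: (eqVneq i n) => [->|/eqP ni]; first by apply: filterS filterT.
  apply: filterS (Theta_disjoint (chartP (c i)) (chartP (c n)) _) => [w h1 r1 r2|].
    by exfalso; apply: h1.
  by apply/seteqP; split=> x // [Dx Dx']; apply: ni; exact: cdom_disj Dx Dx'.
have H5 : \forall w \near ae, Theta C g h w -> sg k w = sg f w.
  apply: (agree_Theta trn) => x [Bx Dx].
  by have := psiE n x nJ Dx; rewrite Bf // => -[].
apply: filterS3 H1 H5 (filterI H2 (filterI H3 H4)) => w h1 h5 [h2 [h3 h4]] Tw.
have dn := h1 Tw; have rn := h2.2 dn.
have Pn : P w n.
  split=> // i iJ ri; exact: (h3 i iJ rn ri).
rewrite /chart_map; case: pselect => [_|[]]; last by exists n.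
have [lJ dl' _ _] := @least_spec (P w) n Pn.
by rewrite (h4 _ lJ dn dl') (h5 Tw).
Qed.
End ChartMap.

(** Cut [B] according to the automorphism with which [psi2] agrees and use
    [Theta_equiv] to read [psi1] on the image. *)
Lemma models_comp psi1 psi2 G1 G2 : models psi1 G1 -> models psi2 G2 -> plocal psi2 ->
  models (pcomp psi1 psi2) (pcomp G1 G2).
Proof.
move=> M1 M2 /plocal_cover[S [mS Scov Sval]] B g h tr.
have piece n f : (forall x, S n x -> psi2 x = Some (f x)) -> triple (B `&` S n) g h ->
    (forall k : baut E, (forall x, (B `&` S n) x -> psi1 (f x) = Some (k x)) ->
      \forall w \near ae, Theta (B `&` S n) g h w -> pcomp G1 G2 w = Some (sg k w)) /\
    ((forall x, (B `&` S n) x -> psi1 (f x) = None) ->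
      \forall w \near ae, Theta (B `&` S n) g h w -> pcomp G1 G2 w = None).
  move=> Sf trn; have [H _] := M2 _ _ _ trn.
  have H2 : \forall w \near ae, Theta (B `&` S n) g h w -> G2 w = Some (sg f w).
    by apply: H => x [_]; exact: Sf.
  have [K1 K2] := M1 _ _ _ (triple_cj f trn); have eqv := Theta_equiv f trn; split.
    move=> k Bk; pose k' := baut_comp k (baut_inv f).
    have H3 : \forall w \near ae, Theta (im f (B `&` S n)) (cj f g) (cj f h) w ->
        G1 w = Some (sg k' w).
      apply: K1 => x Bx; rewrite -[in LHS](ainvK f x); exact: Bk.
    have kE : k =1 baut_comp k' f by move=> x /=; rewrite afunK.
    apply: filterS3 H2 eqv (filterI (ae_sg f H3) (filterI (ae_mul k' f) (ae_ext kE))).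
    by move=> w h1 h2 [/= h3 [h4 h5]] Tw; rewrite /pcomp (h1 Tw) /= h3 ?h5 ?h4 //; exact/h2.
  move=> Bk.
  have H3 : \forall w \near ae, Theta (im f (B `&` S n)) (cj f g) (cj f h) w -> G1 w = None.
    apply: K2 => x Bx; rewrite -(ainvK f x); exact: Bk.
  apply: filterS3 H2 eqv (ae_sg f H3).
  by move=> w h1 h2 h3 Tw; rewrite /pcomp (h1 Tw) /= h3 //; exact/h2.
have Bcov : B `<=` \bigcup_n S n by move=> x _; have [n Sn] := Scov x; exists n.
split=> [k Bk|BN]; apply: (Theta_ind tr mS Bcov) => n trn.
- case: (Sval n) => [[f Sf]|SN].
    have [K _] := piece n f Sf trn; apply: K => x [Bx Sx].
    by rewrite -(Bk x Bx) /pcomp Sf.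
  apply: filterS (Theta_null trn _) => [w nT /nT //|].
  rewrite (_ : _ `&` _ = set0) ?pr0 //; apply/seteqP; split=> x // [Bx Sx].
  by have := Bk x Bx; rewrite /pcomp SN.
- case: (Sval n) => [[f Sf]|SN].
    have [_ K] := piece n f Sf trn; apply: K => x [Bx Sx].
    by rewrite -(BN x Bx) /pcomp Sf.
  have [_ K] := M2 _ _ _ trn.
  have H2 : \forall w \near ae, Theta (B `&` S n) g h w -> G2 w = None.
    by apply: K => x [_]; exact: SN.
  by apply: filterS H2 => w h1 Tw; rewrite /pcomp h1.
Qed.

Section Region.
Variables (c : nat -> chart) (J : nat).
Hypothesis cdom_disj : forall i j x, cdom (c i) x -> cdom (c j) x -> i = j.

Let dT i := Theta (cdom (c i)) (cleft (c i)) (cright (c i)).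
Definition region : set X := \bigcup_(j in `I_J) cdom (c j).
(** The copy of [region] in [W]. *)
Definition Region : set W := \bigcup_(j in `I_J) dT j.

Let mD n : measurable (cdom (c n)). Proof. by have [[]] := chartP (c n). Qed.

Lemma measurable_region : measurable region.
Proof. by apply: bigcup_measurable => j _. Qed.

Lemma region_in B g h : triple B g h -> B `<=` region ->
  \forall w \near ae, Theta B g h w -> Region w.
Proof.
move=> tr BX; pose D n := if (n < J)%N then cdom (c n) else set0.
apply: (@Theta_ind _ _ _ _ D tr) => [n|x /BX[j /= jJ Dj]|n trn].
- by rewrite /D; case: ifP.
- by exists j => //; rewrite /D jJ.
rewrite /D in trn *; case: ifP trn => nJ trn; last first.
  by apply: filterS (Theta_null trn _) => [w nT /nT //|]; rewrite setI0 pr0.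
have [[mC _] _ _] := trn.
have CD : B `&` cdom (c n) `<=` cdom (c n) by move=> x [].
have trC := sub_triple (chartP (c n)) mC CD.
apply: filterS2 (Theta_indep trn trC) (Theta_sub (chartP (c n)) mC CD).
by move=> w h1 h2 /h1 /h2 ?; exists n.
Qed.

Lemma region_out B g h : triple B g h -> B `&` region = set0 ->
  \forall w \near ae, Theta B g h w -> ~ Region w.
Proof.
move=> tr BX.
have : \forall w \near ae, forall j, (j < J)%N -> ~ (Theta B g h w /\ dT j w).
  apply: ae_lt => j jJ; apply: (Theta_disjoint tr (chartP (c j))).
  apply/seteqP; split=> x // [Bx Dx].
  by rewrite -BX; split=> //; exists j.
by apply: filterS => w h1 Tw [j /= jJ Tj]; exact: (h1 j jJ).
Qed.

Let dU m := \bigcup_(j in `I_m) dT j.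
Let cU m := \bigcup_(j in `I_m) cdom (c j).

Let dUS m : dU m.+1 = dU m `|` dT m.
Proof.
apply/seteqP; split=> [x [i /= + Fi]|x [[i /= il Fi]|Fn]].
- rewrite ltnS leq_eqVlt => /predU1P[<-|il]; first by right.
  by left; exists i.
- by exists i => //=; exact: ltnW.
- by exists m => /=.
Qed.

Let cUS m : cU m.+1 = cU m `|` cdom (c m).
Proof.
apply/seteqP; split=> [x [i /= + Fi]|x [[i /= il Fi]|Fn]].
- rewrite ltnS leq_eqVlt => /predU1P[<-|il]; first by right.
  by left; exists i.
- by exists i => //=; exact: ltnW.
- by exists m => /=.
Qed.

Let cU_disj m : cU m `&` cdom (c m) = set0.
Proof.
apply/seteqP; split=> x // [[i /= im Di] Dm].
by rewrite (cdom_disj Di Dm) ltnn in im.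
Qed.

Let mcU m : measurable (cU m). Proof. by apply: bigcup_measurable => j _. Qed.

(** A set [Z] that avoids the copy of every subset of the [B n] is no larger, inside the
    copy of a region, than what the [B n] leave of that region. *)
Lemma region_count (Z : set W) (B : nat -> set X) : (forall n, measurable (B n)) ->
  (forall n A g h, triple A g h -> A `<=` B n ->
    \forall w \near ae, Theta A g h w -> ~ Z w) ->
  dl (Z `&` Region) <= pr mu (region `\` \bigcup_n B n).
Proof.
move=> mB ZB; have mUB : measurable (\bigcup_n B n) by exact: bigcup_measurable.
suff H m : dl (Z `&` dU m) <= pr mu (cU m `\` \bigcup_n B n) by exact: H.
elim: m => [|m IH].
  by rewrite /dU II0 bigcup_set0 setI0 dl_set0 pr_ge0.
rewrite dUS setIUr cUS setDUl.
have mD1 : measurable (cU m `\` \bigcup_n B n) by exact: measurableD.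
have mD2 : measurable (cdom (c m) `\` \bigcup_n B n) by exact: measurableD.
rewrite prU //; last first.
  by apply/seteqP; split=> x // [[Ux _] [Dx _]]; rewrite -(cU_disj m).
apply: le_trans (dlU_le _ _) _; apply: lerD => //.
apply: (Theta_cover (chartP (c m)) mB) => n.
have mDB : measurable (cdom (c m) `&` B n) by exact: measurableI.
have trn : triple (cdom (c m) `&` B n) (cleft (c m)) (cright (c m)).
  by apply: sub_triple (chartP (c m)) mDB _ => x [].
by apply: filterS (ZB n _ _ _ trn _) => [w h1 [Zw /h1]|x []].
Qed.

Lemma dl_region : dl Region = pr mu region.
Proof.
suff H m : dl (dU m) = pr mu (cU m) by exact: H.
elim: m => [|m IH]; first by rewrite /dU /cU II0 !bigcup_set0 dl_set0 pr0.
rewrite dUS cUS prU ?cU_disj // -IH -(dl_Theta (chartP (c m))) -/(dT m).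
rewrite -dlUI (_ : dl (dU m `&` dT m) = 0) ?addr0 //.
apply/eqP; rewrite eq_le dl_ge0 andbT -dl_set0.
apply: ae_le.
have : \forall w \near ae, forall j, (j < m)%N -> ~ (dT j w /\ dT m w).
  apply: ae_lt => j jm; apply: (Theta_disjoint (chartP (c j)) (chartP (c m))).
  by apply/seteqP; split=> x // [Dj Dm]; rewrite (cdom_disj Dj Dm) ltnn in jm.
by apply: filterS => w h1 [[j /= jm Tj] Tm]; exact: (h1 j jm).
Qed.

Definition Xrestrict psi (x : X) : option X :=
  if pselect (region x) is left _ then
    if psi x is Some y then if pselect (region y) is left _ then Some y else None else None
  else None.

Definition Wrestrict G (w : W) : option W :=
  if pselect (Region w) is left _ then
    if G w is Some v then if pselect (Region v) is left _ then Some v else None else None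
  else None.

Lemma XrestrictP psi x y : Xrestrict psi x = Some y <-> [/\ region x, psi x = Some y & region y].
Proof.
rewrite /Xrestrict; case: pselect => rx; last by split=> // -[].
case: (psi x) => [z|]; last by split=> // -[].
case: pselect => rz; split.
- by case=> <-.
- by case=> _ [->].
- by [].
- by case=> _ [<-].
Qed.

Lemma WrestrictP G w v : Wrestrict G w = Some v <-> [/\ Region w, G w = Some v & Region v].
Proof.
rewrite /Wrestrict; case: pselect => rx; last by split=> // -[].
case: (G w) => [z|]; last by split=> // -[].
case: pselect => rz; split.
- by case=> <-.
- by case=> _ [->].
- by [].
- by case=> _ [<-].
Qed.

Lemma Wrestrict_None G w : (forall v, G w = Some v -> Region w -> ~ Region v) ->
  Wrestrict G w = None.
Proof.
move=> H; case E0: (Wrestrict G w) => [v|//].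
by have /WrestrictP[rw /H] := E0; move=> /(_ rw).
Qed.

Lemma plocal_restrict psi : plocal psi -> plocal (Xrestrict psi).
Proof.
move=> [mpsi [g gP]]; split; last first.
  by exists g => x y /XrestrictP[_ /gP].
move=> B mB; rewrite (_ : ppreimage _ _ = region `&` ppreimage psi (B `&` region)).
  by apply: measurableI; [|apply: mpsi; apply: measurableI => //]; exact: measurable_region.
apply/seteqP; split=> [x [y By /XrestrictP[rx xy ry]]|x [rx [y [By ry] xy]]].
  by split=> //; exists y.
by exists y => //; apply/XrestrictP.
Qed.

Lemma models_restrict psi G : plocal psi -> models psi G ->
  models (Xrestrict psi) (Wrestrict G).
Proof.
move=> lpsi M B g h tr; split=> [f Bf|BN].
  have BfP x : B x -> [/\ region x, psi x = Some (f x) & region (f x)].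
    by move=> /Bf /XrestrictP.
  have [K _] := M _ _ _ tr.
  have H1 : \forall w \near ae, Theta B g h w -> G w = Some (sg f w).
    by apply: K => x /BfP[].
  have H2 : \forall w \near ae, Theta B g h w -> Region w.
    by apply: region_in => // x /BfP[].
  have H3 : \forall w \near ae, Theta (im f B) (cj f g) (cj f h) w -> Region w.
    apply: region_in; first exact: triple_cj.
    by move=> x /BfP[_ _]; rewrite ainvK.
  apply: filterS3 H1 H2 (filterI (ae_sg f H3) (Theta_equiv f tr)).
  move=> w h1 h2 [/= h3 h4] Tw; apply/WrestrictP; split; [exact: h2|exact: h1|].
  exact/h3/h4.
have [S [mS Scov Sval]] := plocal_cover lpsi.
pose D n := if n is n'.+1 then region `&` S n' else ~` region.
have mDn n : measurable (D n).
  case: n => [|n] /=; first exact/measurableC/measurable_region.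
  by apply: measurableI => //; exact: measurable_region.
apply: (Theta_ind tr mDn) => [x Bx|n trn].
  case: (pselect (region x)) => rx; last by exists 0%N.
  by have [n Sn] := Scov x; exists n.+1.
case: n trn => [|n] trn.
  have H : \forall w \near ae, Theta (B `&` D 0%N) g h w -> ~ Region w.
    by apply: region_out => //; apply/seteqP; split=> x // [[_ nr] rx]; exact: nr.
  apply: filterS H => w h1 Tw; apply: Wrestrict_None => v _ rw; exfalso; exact: (h1 Tw).
have [K1 K2] := M _ _ _ trn.
case: (Sval n) => [[f Sf]|SN]; last first.
  have H : \forall w \near ae, Theta (B `&` D n.+1) g h w -> G w = None.
    by apply: K2 => x [_ [_ Sx]]; exact: SN.
  by apply: filterS H => w h1 Tw; apply: Wrestrict_None => v; rewrite h1.
have H : \forall w \near ae, Theta (B `&` D n.+1) g h w -> G w = Some (sg f w).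
  by apply: K1 => x [_ [_ Sx]]; exact: Sf.
have H3 : \forall w \near ae, Theta (im f (B `&` D n.+1)) (cj f g) (cj f h) w -> ~ Region w.
  apply: region_out; first exact: triple_cj.
  apply/seteqP; split=> x // [[Bx [rx Sx]] rfx].
  have : Xrestrict psi (ainv f x) = Some x.
    by apply/XrestrictP; split=> //; rewrite (Sf _ Sx) ainvK.
  by rewrite BN.
apply: filterS3 H (ae_sg f H3) (Theta_equiv f trn) => w h1 h2 h3 Tw.
apply: Wrestrict_None => v; rewrite (h1 Tw) => -[<-] _.
exact/h2/h3.
Qed.

Lemma models_diff psi psi' G G' : models psi G -> models psi' G' ->
  plocal psi -> plocal psi' ->
  dl ([set w | G w <> G' w] `&` Region) <= pr mu (region `&` [set x | psi x <> psi' x]).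
Proof.
move=> M M' lpsi lpsi'; have [S [mS Scov Sval]] := plocal_cover lpsi.
pose D n := S n `&` [set x | psi x = psi' x].
have mDn n : measurable (D n).
  apply: measurableI => //; apply: (measurable_eqmap cd); [exact: lpsi.1|exact: lpsi'.1].
rewrite (_ : region `&` _ = region `\` \bigcup_n D n); last first.
  apply/seteqP; split=> x [rx nx]; split=> //; first by case=> n _ [].
  by move=> e; apply: nx; have [n Sn] := Scov x; exists n.
apply: (region_count mDn) => n A g h tr AD.
have [K1 K2] := M _ _ _ tr; have [K1' K2'] := M' _ _ _ tr.
case: (Sval n) => [[f Sf]|SN].
  have H : \forall w \near ae, Theta A g h w -> G w = Some (sg f w).
    by apply: K1 => x /AD[/Sf].
  have H' : \forall w \near ae, Theta A g h w -> G' w = Some (sg f w).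
    by apply: K1' => x /AD[/Sf + /= e]; rewrite e.
  by apply: filterS2 H H' => w h1 h2 Tw; rewrite /= (h1 Tw) (h2 Tw).
have H : \forall w \near ae, Theta A g h w -> G w = None.
  by apply: K2 => x /AD[/SN].
have H' : \forall w \near ae, Theta A g h w -> G' w = None.
  by apply: K2' => x /AD[/SN + /= e]; rewrite e.
by apply: filterS2 H H' => w h1 h2 Tw; rewrite /= (h1 Tw) (h2 Tw).
Qed.

(** Both the set of fixed points and its complement are bounded by [region_count], and
    the two bounds add up to the measure of the region. *)
Lemma models_fix psi G : models psi G -> plocal psi ->
  dl ([set w | G w = Some w] `&` Region) = pr mu (region `&` pfix psi).
Proof.
move=> M lpsi; have [S [mS Scov Sval]] := plocal_cover lpsi.
have mF : measurable (pfix psi) by exact: (measurable_eq_baut (baut_id E) lpsi.1).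
have mr := measurable_region.
have le1 : dl ([set w | G w = Some w] `&` Region) <= pr mu (region `&` pfix psi).
  pose D n := S n `\` pfix psi.
  have mDn n : measurable (D n) by exact: measurableD.
  rewrite (_ : region `&` _ = region `\` \bigcup_n D n); last first.
    apply/seteqP; split=> x [rx nx]; split=> //; first by case=> n _ [].
    by apply: contrapT => nf; apply: nx; have [n Sn] := Scov x; exists n.
  apply: (region_count mDn) => n A g h tr AD.
  have [K1 K2] := M _ _ _ tr.
  case: (Sval n) => [[f Sf]|SN].
    have H : \forall w \near ae, Theta A g h w -> G w = Some (sg f w).
      by apply: K1 => x /AD[/Sf].
    have mv : \forall w \near ae, Theta A g h w -> sg f w <> w.
      apply: (moves_Theta tr) => x /AD[/Sf psix nf] e.
      by apply: nf; rewrite /pfix /= psix e.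
    by apply: filterS2 H mv => w h1 h2 Tw; rewrite /= (h1 Tw) => -[]; exact: h2.
  have H : \forall w \near ae, Theta A g h w -> G w = None.
    by apply: K2 => x /AD[/SN].
  by apply: filterS H => w h1 Tw; rewrite /= (h1 Tw).
have le2 : dl ([set w | G w <> Some w] `&` Region) <= pr mu (region `\` pfix psi).
  rewrite -[pfix psi](bigcup_const (I := nat) (P := setT)); last by exists 0%N.
  apply: (region_count (fun=> mF)) => _ A g h tr AF.
  have [K1 _] := M _ _ _ tr.
  have H : \forall w \near ae, Theta A g h w -> G w = Some (sg (baut_id E) w).
    by apply: K1 => x /AF.
  by apply: filterS2 H ae_id => w h1 h2 Tw; rewrite /= (h1 Tw) h2.
apply/eqP; rewrite eq_le le1 /=.
have := prID mu mr mF; have := dlID Region [set w | G w = Some w].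
rewrite dl_region setIC (_ : Region `\` _ = [set w | G w <> Some w] `&` Region); first lra.
by apply/seteqP; split=> w [].
Qed.

End Region.

End Models.
End Representation.

(** * Splitting off the classes with at most two points *)

Section Types.
Context {R : realType} {d : measure_display} {X : measurableType d}.
Variables (cd : coding X) (E : cber X) (mu : probability X R).
Hypothesis E_mp : measure_preserving E mu.

Lemma covering_sequence : exists q : nat -> baut E, (exists i, q i = baut_id E) /\
  forall g : baut E, pr mu [set x | forall i, q i x <> g x] = 0.
Proof.
have [Q [cQ QP]] := countable_cover cd E mu.
have [q [_ qQ]] := countable_enum (countable_setU cQ (countable1 (baut_id E))) (or_intror erefl).
exists q; split=> [|g]; first by apply: qQ; right.
have mqg (Q' : set (baut E)) : countable Q' ->
    measurable [set x | forall r, Q' r -> r x <> g x].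
  move=> cQ'; rewrite (_ : mkset _ = ~` \bigcup_(r in Q') [set x | r x = g x]).
    by apply: measurableC; apply: countable_bigcup_meas => // r; exact: measurable_bauteq.
  apply/seteqP; split=> [x Nx [r Qr]|x nU r Qr e]; first exact: Nx.
  by apply: nU; exists r.
apply: pr_sub0 (QP g); last first.
- by move=> x nx r Qr; have [i <-] := qQ r (or_introl Qr).
- exact: mqg.
rewrite (_ : mkset _ = [set x | forall r, range q r -> r x <> g x]).
  by apply: mqg; apply: (@sub_countable _ _ _ [set: nat]) => //; exact: card_image_le.
apply/seteqP; split=> [x nx r [i _ <-]|x nx i]; first exact: nx.
by apply: nx; exists i.
Qed.

(** The small part is the set of the points whose class has, up to a null set, at most
    two elements, and the partner of such a point is the other element of its class,
    or the point itself. Every partial isomorphism respects the small part and acts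
    there by partnership. Off the small part there are two further points in the
    class of [x], so that triples exist around [x]. *)
Record type_decomposition := TypeDecomposition {
  small_part : set X;
  partner : baut E;
  measurable_small_part : measurable small_part;
  partnerK : forall x, partner (partner x) = x;
  small_part_partner : forall x, small_part x -> small_part (partner x);
  small_part_values : forall phi : fullB E, exists N, [/\ measurable N, pr mu N = 0 &
    forall x y, ~ N x -> phi x = Some y ->
      (small_part x -> y = x \/ y = partner x) /\ (small_part y -> small_part x)];
  large_part_charts : forall phi : fullB E, exists c : nat -> chart E,
    [/\ forall i j x, cdom (c i) x -> cdom (c j) x -> i = j,
        forall i x, cdom (c i) x -> ~ small_part x /\ phi x = Some (cmap (c i) x) &
        pr mu ((pdom phi `\` small_part) `\` \bigcup_i cdom (c i)) = 0] }.

(** Classes are replaced by the orbits [{q i x}] of a countable cover. These are the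
    classes of an equivalence relation on the conull set [Z] where [q m (q i x)] and
    [q l x] run through the same points. The partner of [x] is the first [q i x]
    different from [x]. Off the small part there are [i] and [j] such that [x],
    [q i x] and [q j x] are distinct; [separate] cuts the domain of [phi] into
    countably many sets on which these three maps have disjoint images. *)
Lemma type_decomposition_exists : inhabited type_decomposition.
Proof.
have [q [[i0 qi0] qP]] := covering_sequence.
pose Z := [set x | forall i l, (exists m, q m (q i x) = q l x) /\ (exists m, q m x = q l (q i x))].
pose Zil i l := (\bigcup_m [set x | baut_comp (q m) (q i) x = q l x]) `&`
  (\bigcup_m [set x | q m x = baut_comp (q l) (q i) x]).
have mZil i l : measurable (Zil i l).
  by apply: measurableI; apply: bigcup_measurable => m _; exact: measurable_bauteq.
have ZE : Z = \bigcap_i \bigcap_l Zil i l.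
  apply/seteqP; split=> [x Zx i _ l _|x Zx i l].
    by have [[m h1] [m' h2]] := Zx i l; split; [exists m|exists m'].
  by have [[m _ h1] [m' _ h2]] := Zx i I l I; split; [exists m|exists m'].
have mZ : measurable Z.
  by rewrite ZE; do 2! apply: bigcap_measurableType => ? _; exact: mZil.
have mN (g : baut E) : measurable [set x | forall i, q i x <> g x].
  rewrite (_ : mkset _ = \bigcap_i [set x | q i x <> g x]).
    by apply: bigcap_measurableType => i _; exact: measurable_bautneq.
  by apply/seteqP; split=> [x nx i _|x nx i]; apply: nx.
have Z0 : pr mu (~` Z) = 0.
  rewrite ZE setC_bigcap; apply: pr_bigcup0 => i.
    by apply: measurableC; apply: bigcap_measurableType => l _; exact: mZil.
  rewrite setC_bigcap; apply: pr_bigcup0 => l; first exact: measurableC.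
  rewrite setCI !setC_bigcup.
  pose N1 := q i @^-1` [set y | forall m, q m y <> baut_comp (q l) (baut_inv (q i)) y].
  pose N2 := [set x | forall m, q m x <> baut_comp (q l) (q i) x].
  have m1 : measurable N1 by apply: measurable_afun; exact: mN.
  have m2 : measurable N2 by exact: mN.
  rewrite (_ : _ `|` _ = N1 `|` N2); last first.
    congr (_ `|` _); apply/seteqP; split=> x nx.
    - by move=> m /=; rewrite afunK; exact: nx.
    - by move=> m _; have := nx m; rewrite /= afunK.
    - by move=> m; exact: nx.
    - by move=> m _; exact: nx.
  apply/eqP; rewrite eq_le pr_ge0 andbT; apply: le_trans (prU_le mu m1 m2) _.
  by rewrite /N1 (pr_baut E_mp) // /N2 !qP addr0.
have Zq x i : Z x -> Z (q i x).
  move=> Zx j l; split.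
    have [_ [a ea]] := Zx i j; have [_ [b eb]] := Zx i l.
    by have [[m em] _] := Zx a b; exists m; rewrite -ea em eb.
  have [_ [a ea]] := Zx i j; have [_ [b eb]] := Zx a l.
  by have [[m em] _] := Zx i b; exists m; rewrite em eb ea.
pose Y := Z `&` [set x | forall i j, [\/ q i x = x, q j x = x | q i x = q j x]].
have mY : measurable Y.
  apply: measurableI => //.
  rewrite (_ : mkset _ = \bigcap_i \bigcap_j ([set x | q i x = baut_id E x] `|`
    [set x | q j x = baut_id E x] `|` [set x | q i x = q j x])).
    do 2! apply: bigcap_measurableType => ? _.
    by apply: measurableU; [apply: measurableU|]; exact: measurable_bauteq.
  apply/seteqP; split=> [x nx i _ j _|x nx i j].
    by case: (nx i j) => h; [left; left|left; right|right].
  by case: (nx i I j I) => [[h|h]|h]; [constructor 1|constructor 2|constructor 3].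
pose idx x := least (fun i => q i x <> x).
have midx k : measurable [set x | idx x = k].
  apply: (@measurable_least _ _ (fun i => [set x | q i x <> x])) => n.
  exact: (measurable_bautneq cd (q n) (baut_id E)).
pose t x := if pselect (Y x) is left _ then q (idx x) x else x.
have idxP x i : q i x <> x -> q (idx x) x <> x.
  by move=> h; apply: (@least_spec (fun i => q i x <> x) i).
have Yq x i : Y x -> q i x = x \/ q i x = t x.
  move=> Yx; case: (pselect (q i x = x)) => h; [by left|right].
  rewrite /t; case: pselect => // _; have h2 := idxP x i h.
  by have [_ /(_ i (idx x))[]] := Yx.
have Yclosed x i : Y x -> Y (q i x).
  move=> Yx; split; first by apply: Zq; case: Yx.
  move=> j l; have [Zx _] := Yx; have [_ [a ea]] := Zx i j; have [_ [b eb]] := Zx i l.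
  rewrite -ea -eb.
  by case: (Yq x a Yx) (Yq x b Yx) (Yq x i Yx) => [->|->] [->|->] [->|->];
    try (by constructor 1); try (by constructor 2); try (by constructor 3).
have tY x : Y x -> t x = q (idx x) x by rewrite /t; case: pselect.
have tN x : ~ Y x -> t x = x by rewrite /t; case: pselect.
have Yt x : Y x -> Y (t x) by move=> Yx; rewrite (tY x Yx); exact: Yclosed.
have tK : involutive t.
  move=> x; case: (pselect (Y x)) => Yx; last by rewrite !tN.
  case: (pselect (t x = x)) => tx; first by rewrite !tx.
  have [Zx _] := Yx; have [[m em] _] := Zx (idx x) i0.
  rewrite -(tY x Yx) qi0 /= in em.
  have tx' : q m (t x) <> t x by rewrite em => /esym.
  have h := idxP _ _ tx'; have [_ [a ea]] := Zx (idx x) (idx (t x)).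
  rewrite -(tY x Yx) in ea; rewrite (tY (t x) (Yt x Yx)) -ea.
  by case: (Yq x a Yx) => // e; exfalso; apply: h; rewrite -ea e.
have mt B : measurable B -> measurable (t @^-1` B).
  move=> mB; rewrite (_ : _ @^-1` _ = (B `\` Y) `|`
      (Y `&` \bigcup_k ([set x | idx x = k] `&` (q k @^-1` B)))).
    apply: measurableU; first exact: measurableD.
    apply: measurableI => //; apply: bigcup_measurable => k _; apply: measurableI => //.
    exact: measurable_afun.
  apply/seteqP; split=> x; rewrite /preimage /=.
    rewrite /t; case: pselect => Yx Bx; [right|by left].
    by split=> //; exists (idx x).
  by case=> [[Bx nY]|[Yx [k _ [/= <- Bx]]]]; [rewrite tN|rewrite tY].
have tE x : E x (t x).
  by rewrite /t; case: pselect => _; [exact: baut_rel|exact: cber_refl].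
pose tau := baut_of_involution tK mt tE.
have mNphi (g : nat -> baut E) : measurable (\bigcup_l [set x | forall i, q i x <> g l x]).
  exact: bigcup_measurable.
constructor; apply: (@TypeDecomposition Y tau) => //.
- move=> phi; have [g gP] := fullB_local cd phi.
  exists (~` Z `|` \bigcup_l [set x | forall i, q i x <> g l x]).
  have mZ' : measurable (~` Z) by exact: measurableC.
  split; first exact: measurableU.
    apply/eqP; rewrite eq_le pr_ge0 andbT; apply: le_trans (prU_le mu mZ' (mNphi g)) _.
    by rewrite Z0 pr_bigcup0 // addr0.
  move=> x y /not_orP[/contrapT Zx nU] xy.
  have [l yl] : exists l, y = g l x.
    have [|l] := gP x; first by rewrite /pdom /= xy.
    by rewrite xy => -[->]; exists l.
  have [i yi] : exists i, y = q i x.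
    apply: contrapT => ni; apply: nU; exists l => // i e; apply: ni; exists i.
    by rewrite yl e.
  split=> [Yx|Yy]; first by rewrite yi; exact: Yq.
  have [[m em] _] := Zx i i0; rewrite qi0 /= -yi in em.
  by rewrite -em; exact: Yclosed.
- move=> phi; have [g gP] := fullB_local cd phi.
  have /choice[S SP] : forall uv : baut E * baut E, exists S : nat -> set X,
      [/\ forall n, measurable (S n), forall n x y, S n x -> S n y -> uv.1 x <> uv.2 y &
      forall x, uv.1 x <> uv.2 x -> exists n, S n x].
    by move=> uv; exact: (separate cd).
  pose pieceD (k : (nat * nat) * (nat * nat) * (nat * nat)) :=
    let: ((l, i), (j, a), (b, e)) := k in
    [set x | phi x = Some (g l x)] `&` S (baut_id E, q i) a `&` S (baut_id E, q j) b
      `&` S (q i, q j) e `\` Y.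
  have pieceP k : exists f u v : baut E, triple (pieceD k) u v /\ forall x, pieceD k x -> phi x = Some (f x).
    case: k => [[[l i] [j a]] [b e]]; exists (g l), (q i), (q j).
    have [m1 s1 _] := SP (baut_id E, q i); have [m2 s2 _] := SP (baut_id E, q j).
    have [m3 s3 _] := SP (q i, q j).
    have mD : measurable (pieceD ((l, i), (j, a), (b, e))).
      apply: measurableD => //; apply: measurableI => //; apply: measurableI => //.
      by apply: measurableI => //; exact: measurable_fullB_baut.
    split; last by move=> x [[[[]]]].
    split.
    + split=> // x [[[[_ Sx] _] _] _] [[[[_ Sy] _] _] _].
      by have := s1 _ _ _ Sy Sx; apply.
    + split=> // x [[[_ Sx] _] _] [[[_ Sy] _] _].
      by have := s2 _ _ _ Sy Sx; apply.
    + by move=> x y [[_ Sx] _] [[_ Sy] _]; exact: (s3 _ _ _ Sx Sy).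
  have mpiece k : measurable (pieceD k) by have [f [u [v [[[]]]]]] := pieceP k.
  pose D n := if unpickle n is Some k then pieceD k else set0.
  have mD n : measurable (D n) by rewrite /D; case: unpickle => //.
  pose D' n := D n `\` \bigcup_(m in `I_n) D m.
  have mD' n : measurable (D' n).
    by apply: measurableD => //; apply: bigcup_measurable => m _.
  have DD n : D' n `<=` D n by move=> x [].
  have /choice[c cP] : forall n, exists c : chart E, cdom c = D' n /\
      forall x, D' n x -> phi x = Some (cmap c x).
    move=> n; case E0 : (@unpickle ((nat * nat) * (nat * nat) * (nat * nat))%type n) => [k|].
      have [f [u [v [tr fP]]]] := pieceP k.
      have DE : D n = pieceD k by rewrite /D E0.
      have tr' : triple (D' n) u v by apply: sub_triple tr (mD' n) _; rewrite -DE; exact: DD.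
      exists (Chart f tr'); split=> //= x /DD; rewrite DE; exact: fP.
    have D0 x : ~ D' n x by move=> /DD; rewrite /D E0.
    have tr' : triple (D' n) (baut_id E) (baut_id E).
      by split=> [||x y /D0] //; split=> // x /D0.
    by exists (Chart (baut_id E) tr'); split=> //= x /D0.
  have cD n : cdom (c n) = D' n by case: (cP n).
  exists c; split.
  + have key i j x : D' i x -> D' j x -> (i <= j)%N.
      move=> [_ ni] [Dj _]; rewrite leqNgt; apply/negP => ji.
      by apply: ni; exists j.
    move=> i j x; rewrite !cD => Di Dj; apply/eqP; rewrite eqn_leq.
    by rewrite (key i j x) // (key j i x).
  + move=> i x; rewrite cD => Dx; split; last by case: (cP i) => _; apply.
    move/DD: Dx; rewrite /D; case: unpickle => // -[[[l i'] [j a]] [b e]].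
    by case.
  + apply: (pr_sub0 _ _ _ Z0).
    * apply: measurableD; first by apply: measurableD => //; exact: fullB_mdom.
      by apply: bigcup_measurable => i _; rewrite cD.
    * exact: measurableC.
    * move=> x [[dx nY] nU] Zx; apply: nU.
      have [i [j [qi qj qij]]] : exists i j, [/\ q i x <> x, q j x <> x & q i x <> q j x].
        apply: contrapT => nij; apply: nY; split=> // i j.
        case: (pselect (q i x = x)) => h1; first by constructor 1.
        case: (pselect (q j x = x)) => h2; first by constructor 2.
        case: (pselect (q i x = q j x)) => h3; first by constructor 3.
        by exfalso; apply: nij; exists i, j.
      have [l xl] := gP x dx.
      have [_ _ s1] := SP (baut_id E, q i); have [_ _ s2] := SP (baut_id E, q j).
      have [_ _ s3] := SP (q i, q j).
      have [a Sa] := s1 x (fun e => qi (esym e)); have [b Sb] := s2 x (fun e => qj (esym e)).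
      have [e Se] := s3 x qij.
      have Dx : exists n, D n x.
        exists (pickle ((l, i), (j, a), (b, e))); rewrite /D pickleK.
        by split.
      have [n Dn] := Dx; pose m := least (fun n => D n x).
      have Dm : D m x by exact: (@least_spec (fun n => D n x) n).
      exists m => //; rewrite cD; split=> // -[k /= km Dk].
      by have := @least_le (fun n => D n x) k Dk; rewrite leqNgt km.
Qed.

End Types.

(** * Finite samples with prescribed frequencies *)

Section Sampling.
Context {R : realType} {d : measure_display} {X : measurableType d}.
Variable mu : probability X R.

Lemma pr_finite_union (V : eqType) (s : seq V) (F : V -> set X) : uniq s ->
  (forall v, measurable (F v)) -> (forall u v x, F u x -> F v x -> u = v) ->
  measurable [set x | exists2 v, v \in s & F v x] /\
  pr mu [set x | exists2 v, v \in s & F v x] = \sum_(v <- s) pr mu (F v).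
Proof.
move=> + mF dF; elim: s => [_|v s IH /= /andP[vs /IH[mU IHs]]].
  rewrite big_nil (_ : mkset _ = set0) ?pr0 //.
  by apply/seteqP; split=> x // [].
rewrite big_cons -IHs (_ : mkset _ = F v `|` [set x | exists2 v, v \in s & F v x]).
  rewrite prU //; first by split=> //; exact: measurableU.
  apply/seteqP; split=> x // [Fv [u us Fu]].
  by move: us; rewrite -(dF _ _ _ Fv Fu) (negbTE vs).
apply/seteqP; split=> x.
  by move=> [u]; rewrite in_cons => /predU1P[->|us] Fu; [left|right; exists u].
by case=> [Fv|[u us Fu]]; [exists v; rewrite ?mem_head|exists u; rewrite // in_cons us orbT].
Qed.

(** The sets [F c] cut [Y] into finitely many atoms. Take in each atom a number of
    points proportional to its measure, rounded down. *)
Lemma sampling_pos (Y : set X) (Q : finType) (F : Q -> set X) (e : R) :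
  measurable Y -> (forall c, measurable (F c)) -> 0 < e -> 0 < pr mu Y ->
  exists (I : finType) (x : I -> X), [/\ (0 < #|I|)%N, forall i, Y (x i) &
    forall c, `|pr mu Y * (#|[pred i | x i \in F c]|%:R / #|I|%:R) - pr mu (Y `&` F c)| <= e].
Proof.
move=> mY mF e0 Y0; set P := pr mu Y in Y0 *.
pose V := {ffun Q -> bool}.
pose wd x : V := [ffun c => `[< F c x >]].
pose atom (v : V) := Y `&` [set x | wd x = v].
have matom v : measurable (atom v).
  apply: measurableI => //.
  rewrite (_ : mkset _ = \bigcap_n (if (insub n : option 'I_#|Q|) is Some i then
      if v (enum_val i) then F (enum_val i) else ~` F (enum_val i) else setT)).
    apply: bigcap_measurableType => n _; case: insub => [c|//].
    by case: ifP => _ //; exact: measurableC.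
  apply/seteqP; split=> [x <- n _|x h].
    by case: insub => [c|//]; rewrite ffunE; case: asboolP.
  apply/ffunP => c; have := h (nat_of_ord (enum_rank c)) I; rewrite valK enum_rankK ffunE.
  by case: (v c) => h'; [apply/asboolP|apply/asboolPn].
have datom u v x : atom u x -> atom v x -> u = v by move=> [_ <-] [_ <-].
have sum_atoms (p : pred V) : pr mu [set x | exists2 v, p v & atom v x] = \sum_(v | p v) pr mu (atom v).
  have [_ e1] := pr_finite_union (filter_uniq p (enum_uniq V)) matom datom.
  have -> : \sum_(v | p v) pr mu (atom v) = \sum_(v <- [seq v <- enum V | p v]) pr mu (atom v).
    by rewrite big_filter big_enum_cond; apply: eq_bigl => v; rewrite inE.
  rewrite -e1; congr (pr mu _).
  apply/seteqP; split=> x [v]; rewrite ?mem_filter ?mem_enum.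
    by move=> pv av; exists v; rewrite // mem_filter mem_enum pv.
  by move=> /andP[pv _] av; exists v.
have sumF c : pr mu (Y `&` F c) = \sum_(v : V | v c) pr mu (atom v).
  rewrite -sum_atoms; congr (pr mu _); apply/seteqP; split=> x.
    by move=> [Yx Fx]; exists (wd x) => //; rewrite ffunE; apply/asboolP.
  by move=> [v + [Yx /= e1]]; rewrite -e1 ffunE => /asboolP.
have sumY : P = \sum_v pr mu (atom v).
  rewrite -sum_atoms; congr (pr mu _); apply/seteqP; split=> x.
    by move=> Yx; exists (wd x).
  by move=> [v _ []].
pose K : R := #|{: V}|%:R.
have K1 : 1 <= K by rewrite /K ler1n; apply/card_gt0P; exists (wd point).
(* rounding down loses at most one point for each of the at most [K] atoms; with this
   [L] the sample has at least [2 * K / e] points, which absorbs the error *)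
pose L : R := (2 * K / e + K + 1) / P.
have LP : L * P = 2 * K / e + K + 1 by rewrite /L mulfVK // gt_eqF.
have Ke : 0 < 2 * K / e by rewrite divr_gt0 // mulr_gt0 //; lra.
have L0 : 0 < L by rewrite /L divr_gt0 //; lra.
pose n v := Num.truncn (L * pr mu (atom v)).
have nle v : (n v)%:R <= L * pr mu (atom v).
  by have /andP[] : (n v)%:R <= L * pr mu (atom v) < (n v).+1%:R
    by apply: truncn_itv; rewrite mulr_ge0 ?pr_ge0 // ltW.
have nge v : L * pr mu (atom v) - 1 <= (n v)%:R.
  have /andP[_] : (n v)%:R <= L * pr mu (atom v) < (n v).+1%:R
    by apply: truncn_itv; rewrite mulr_ge0 ?pr_ge0 // ltW.
  by rewrite -natr1; lra.
pose I : finType := {v : V & 'I_(n v)}.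
pose x (i : I) := xget point (atom (tag i)).
have xP i : atom (tag i) (x i).
  apply: xgetPex; apply: contrapT => nex.
  have a0 : pr mu (atom (tag i)) = 0.
    rewrite (_ : atom _ = set0) ?pr0 //; apply/seteqP; split=> y // ay.
    by apply: nex; exists y.
  have := nle (tag i); rewrite a0 mulr0 => le0.
  have n0 : (0 < n (tag i))%N by apply: leq_ltn_trans (ltn_ord (tagged i)).
  have : 0 < (n (tag i))%:R :> R by rewrite ltr0n.
  by rewrite ltNge le0.
have cnt (p : pred V) : #|[pred i : I | p (tag i)]| = (\sum_(v | p v) n v)%N.
  rewrite -sum1_card (eq_bigl (fun i : I => p (tag i) && true)); last first.
    by move=> i; rewrite !inE andbT.
  rewrite -(sig_big_dep p (fun _ _ => true) (fun v (j : 'I_(n v)) => 1%N)).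
  by apply: eq_bigr => v _; rewrite sum1_card card_ord.
have cntF c : #|[pred i | x i \in F c]| = (\sum_(v : V | v c) n v)%N.
  rewrite -(cnt (fun v : V => v c)); apply: eq_card => i; rewrite !inE.
  have [_ /= <-] := xP i; rewrite ffunE; apply/idP/asboolP => [/set_mem//|h]; exact/mem_set.
have cntI : #|I| = (\sum_v n v)%N.
  by rewrite -(cnt xpredT); apply: eq_card => i; rewrite !inE.
have approx (p : pred V) : 0 <= L * (\sum_(v | p v) pr mu (atom v)) - (\sum_(v | p v) n v)%:R <= K.
  rewrite natr_sum mulr_sumr -sumrB; apply/andP; split.
    by apply: sumr_ge0 => v _; rewrite subr_ge0.
  apply: (@le_trans _ _ (\sum_(v | p v) 1)).
    by apply: ler_sum => v _; have := nge v; lra.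
  by rewrite sumr_const /K ler_nat; exact: max_card.
have T := approx xpredT; rewrite -sumY -cntI LP in T.
have I0 : 0 < #|I|%:R :> R by case/andP: T => T1 T2; lra.
exists I, x; split.
- by rewrite -(ltr0n R).
- by move=> i; case: (xP i).
move=> c; have C := approx (fun v : V => v c); rewrite -sumF -cntF in C.
have fP : pr mu (Y `&` F c) <= P by apply: le_pr => //; exact: measurableI.
have f0 := pr_ge0 mu (Y `&` F c).
set f := pr mu (Y `&` F c) in C fP f0 *; set t := #|_|%:R in C *.
set T0 := #|I|%:R in T I0 *.
have -> : P * (t / T0) - f = (P * t - f * T0) / T0 by field; rewrite gt_eqF.
rewrite normrM normfV (ger0_norm (ltW I0)) ler_pdivrMr //.
have P1 : P <= 1 by exact: pr_le1.
have Te : 2 * K <= e * T0.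
  case/andP: T => _ T2; have : 2 * K / e <= T0 by lra.
  by rewrite ler_pdivrMr // [T0 * e]mulrC.
apply: le_trans Te; case/andP: T => T1 T2; case/andP: C => C1 C2.
have e1 : P * t - f * T0 = f * (2 * K / e + K + 1 - T0) - P * (L * f - t).
  by rewrite -LP; ring.
rewrite e1 ler_norml.
have b1 : 0 <= f * (2 * K / e + K + 1 - T0) <= K.
  apply/andP; split; first exact: mulr_ge0.
  by apply: le_trans T2; rewrite ler_piMl //; lra.
have b2 : 0 <= P * (L * f - t) <= K.
  apply/andP; split; first by apply: mulr_ge0 => //; exact: ltW.
  by apply: le_trans C2; rewrite ler_piMl.
lra.
Qed.

Lemma sampling (Y : set X) (Q : finType) (F : Q -> set X) (e : R) :
  measurable Y -> (forall c, measurable (F c)) -> 0 < e ->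
  exists (I : finType) (x : I -> X), (0 < #|I|)%N /\
    forall c, `|pr mu Y * (#|[pred i | x i \in Y `&` F c]|%:R / #|I|%:R) - pr mu (Y `&` F c)| <= e.
Proof.
move=> mY mF e0; have := pr_ge0 mu Y; rewrite le_eqVlt => /predU1P[Y0|Y0]; last first.
  have [I [x [I0 xY H]]] := sampling_pos mY mF e0 Y0.
  exists I, x; split=> // c; apply: le_trans (H c).
  rewrite (_ : #|[pred i | x i \in Y `&` F c]| = #|[pred i | x i \in F c]|) //.
  apply: eq_card => i; rewrite !inE; apply/idP/idP => /set_mem h; apply: mem_set.
    by case: h.
  by split.
(* a null set needs no sample, but the index type must not be empty *)
exists unit, (fun=> point); split; first by rewrite card_unit.
move=> c; rewrite -Y0 mul0r (pr_sub0 (B := Y)) ?subrr ?normr0 ?(ltW e0) //.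
exact: measurableI.
Qed.

End Sampling.

(** * Partial bijections of finite products *)

Section Transport.
Variables (R : realType) (T : finType).

(** A finite type is identified with an initial segment of the integers, on which
    [mu_sharp] lives. *)
Lemma mu_sharp_enum (P : set T) :
  mu_sharp R [set i : 'I_#|T| | P (enum_val i)] = #|[pred t | t \in P]|%:R / #|T|%:R.
Proof.
rewrite /mu_sharp; congr (_%:R / _).
rewrite -[RHS](fintype.card_image (@enum_rank_inj T)); apply: eq_card => i; rewrite !inE.
apply/idP/fintype.imageP => [/set_mem Pi|[t tP ->]].
  exists (enum_val i); last by rewrite enum_valK.
  exact: (mem_set Pi).
by apply: mem_set; rewrite /= enum_rankK; exact: (set_mem tP).
Qed.

Definition transport (f : T -> option T) (i : 'I_#|T|) : option 'I_#|T| :=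
  omap enum_rank (f (enum_val i)).

Lemma pinj_transport f : pinjective f -> pinjective (transport f).
Proof.
move=> fi i j k; rewrite /transport.
case fx: (f (enum_val i)) => [u|//] [<-]; case fy: (f (enum_val j)) => [v|//] [] /enum_rank_inj vu.
by apply: enum_val_inj; apply: (fi _ _ u); rewrite // fy vu.
Qed.

Lemma transport_comp f g : transport (pcomp f g) = pcomp (transport f) (transport g).
Proof.
apply/funext => i; rewrite /transport /pcomp; case: (g (enum_val i)) => //= t.
by rewrite enum_rankK.
Qed.

Lemma omap_rank_inj : injective (omap (@enum_rank T)).
Proof. by move=> [t|] [u|] //= [/enum_rank_inj ->]. Qed.

Lemma fix_transport f :
  mu_sharp R (pfix (transport f)) = #|[pred t | f t == Some t]|%:R / #|T|%:R.
Proof.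
rewrite (_ : pfix _ = [set i | [set t | f t = Some t] (enum_val i)]).
  rewrite mu_sharp_enum; congr (_%:R / _); apply: eq_card => t.
  rewrite -[LHS]/(t \in [set t | f t = Some t]) -[RHS]/(f t == Some t).
  by apply/idP/idP => [/set_mem /= ->//|/eqP h]; exact: mem_set.
apply/seteqP; split=> i; rewrite /pfix /transport /= => e.
  by apply: omap_rank_inj; rewrite e /= enum_valK.
by rewrite e /= enum_valK.
Qed.

Lemma neq_transport f g :
  mu_sharp R [set i | transport f i <> transport g i] =
  #|[pred t | f t != g t]|%:R / #|T|%:R.
Proof.
rewrite (_ : mkset _ = [set i | [set t | f t <> g t] (enum_val i)]).
  rewrite mu_sharp_enum; congr (_%:R / _); apply: eq_card => t.
  rewrite -[LHS]/(t \in [set t | f t <> g t]) -[RHS]/(f t != g t).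
  by apply/idP/idP => [/set_mem /= /eqP//|/eqP h]; exact: mem_set.
by apply/seteqP; split=> i; rewrite /transport /= => h e; apply: h;
  [rewrite e|exact: omap_rank_inj].
Qed.

End Transport.

Section Splice.
Variables (M S : finType) (Reg : {pred M}).

(** Two models are run side by side on a product, each constant in the other factor,
    so that the frequencies of both are preserved. *)
Definition splice (G : M -> option M) (H : S -> option S) (p : M * S) : option (M * S) :=
  if p.1 \in Reg then omap (fun m => (m, p.2)) (G p.1) else omap (fun s => (p.1, s)) (H p.2).

Lemma pinj_splice G H : pinjective G -> pinjective H ->
  (forall m m', G m = Some m' -> m' \in Reg) -> pinjective (splice G H).
Proof.
move=> Gi Hi GR [m s] [m' s'] [m'' s'']; rewrite /splice /=.
case: ifP => mR; case: ifP => mR'.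
- case Gm: (G m) => [u|//] [<- <-]; case Gm': (G m') => [v|//] [vu <-].
  by rewrite (Gi m m' u) // Gm' vu.
- case Gm: (G m) => [u|//] [<- <-]; case: (H s') => [v|//] [e _].
  by have := GR m u Gm; rewrite -e mR'.
- case: (H s) => [v|//] [<- _]; case Gm': (G m') => [u|//] [e _].
  by have := GR m' u Gm'; rewrite e mR.
- case Hs: (H s) => [v|//] [<- <-]; case Hs': (H s') => [u|//] [<- uv].
  by rewrite (Hi s s' v) // Hs' uv.
Qed.

Lemma splice_comp G G' H H' p : (forall m m', G' m = Some m' -> m' \in Reg) ->
  pcomp (splice G H) (splice G' H') p = splice (pcomp G G') (pcomp H H') p.
Proof.
move=> GR; case: p => m s; rewrite /pcomp /splice /=; case: ifP => mR.
  case Gm: (G' m) => [u|//] /=; by rewrite (GR _ _ Gm).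
by case: (H' s) => [v|] //=; rewrite mR.
Qed.

Lemma splice_fix G H : #|[pred p | splice G H p == Some p]| =
  (#|[pred m | (m \in Reg) && (G m == Some m)]| * #|S| +
   #|[pred m | m \notin Reg]| * #|[pred s | H s == Some s]|)%N.
Proof.
have -> : #|S| = #|[pred s : S | true]| by apply: eq_card.
rewrite -!cardX -cardUI [X in (_ = _ + X)%N]eq_card0 ?addn0; last first.
  by move=> [m s]; rewrite !inE /=; case: (m \in Reg) => //=; rewrite andbF.
apply: eq_card => -[m s]; rewrite !inE /splice /=; case: ifP => mR /=.
  rewrite andbT orbF; case: (G m) => [u|//] /=; by apply/eqP/eqP => [[->]|[->]].
by case: (H s) => [u|//] /=; apply/eqP/eqP => [[->]|[->]].
Qed.

Lemma splice_neq G G' H : #|[pred p | splice G H p != splice G' H p]| =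
  (#|[pred m | (m \in Reg) && (G m != G' m)]| * #|S|)%N.
Proof.
have -> : #|S| = #|[pred s : S | true]| by apply: eq_card.
rewrite -cardX; apply: eq_card => -[m s]; rewrite !inE /splice /= andbT; case: ifP => mR /=.
  congr (~~ _); case: (G m) => [u|]; case: (G' m) => [v|] //=.
  by apply/eqP/eqP => [[->]|[->]].
by rewrite eqxx.
Qed.

End Splice.

Section SampleAction.
Context {X : Type}.
Variables (I : finType) (x : I -> X) (Y : set X) (tau : X -> X).
Hypothesis tauK : forall y, tau (tau y) = y.

(** Both points of the class of a sample point are represented. *)
Definition sample_pt (s : I * bool) : X := if s.2 then tau (x s.1) else x s.1.

(** A point that [psi] moves must go to its partner. When a sample point is its own
    partner both pairs stand for the same point and are fixed, so that the map remains
    injective. *)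
Definition sample_action (psi : X -> option X) (s : I * bool) : option (I * bool) :=
  if pselect (Y (x s.1)) is left _ then
    if psi (sample_pt s) is Some y then
      if pselect (y = sample_pt s) is left _ then Some s else Some (s.1, ~~ s.2)
    else None
  else None.

Definition respects (psi : X -> option X) := forall y z, Y y ->
  (psi y = Some z -> z = y \/ z = tau y) /\ (psi (tau y) = Some z -> z = tau y \/ z = y).

Lemma sample_ptN s : sample_pt (s.1, ~~ s.2) = tau (sample_pt s).
Proof. by case: s => i []; rewrite /sample_pt //= tauK. Qed.

Lemma sample_value psi s y : respects psi -> Y (x s.1) -> psi (sample_pt s) = Some y ->
  y = sample_pt s \/ y = tau (sample_pt s).
Proof.
move=> rpsi Ys; have [h1 h2] := rpsi _ y Ys.
by case: s Ys h1 h2 => i [] /= Ys h1 h2; rewrite /sample_pt /= ?tauK; [exact: h2|exact: h1].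
Qed.

Lemma sample_actionP psi s t : respects psi -> sample_action psi s = Some t ->
  [/\ Y (x s.1), psi (sample_pt s) = Some (sample_pt t), t.1 = s.1 &
    sample_pt t = sample_pt s -> t = s].
Proof.
move=> rpsi; rewrite /sample_action; case: pselect => Ys //.
case E0: (psi _) => [y|//]; case: pselect => [e|ne] [<-].
  by split; rewrite ?e.
split => //.
  by rewrite sample_ptN; case: (sample_value rpsi Ys E0) => // ->.
rewrite sample_ptN => e; exfalso; apply: ne.
by case: (sample_value rpsi Ys E0) => // ->.
Qed.

Lemma pinj_sample_action psi : pinjective psi -> respects psi -> pinjective (sample_action psi).
Proof.
move=> psii rpsi s s' t /(sample_actionP rpsi)[_ e1 f1 g1] /(sample_actionP rpsi)[_ e2 f2 g2].
have e := psii _ _ _ e1 e2.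
case: (pselect (s = s')) => // ns; exfalso.
have e3 : s' = (s.1, ~~ s.2).
  case: s s' f1 f2 ns {e1 e2 g1 g2 e} => i b [i' b'] /= -> -> ns; congr pair.
  by case: b b' ns => [] [].
have st : t = s \/ t = s'.
  case: t s f1 {e1 e2 f2 g1 g2 e ns} e3 => i b [i' b'] /= -> ->.
  by case: b b' => [] []; [left|right|right|left].
have ptt : sample_pt t = sample_pt s by case: st => ->.
by apply: ns; rewrite -(g1 ptt); apply: g2; rewrite ptt e.
Qed.

Lemma sample_action_comp psi psi1 psi2 s : respects psi1 -> respects psi2 ->
  (forall y, Y y -> psi y = pcomp psi1 psi2 y /\ psi (tau y) = pcomp psi1 psi2 (tau y)) ->
  sample_action psi s = pcomp (sample_action psi1) (sample_action psi2) s.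
Proof.
move=> r1 r2 H; rewrite /pcomp {1 3}/sample_action.
case: pselect => Ys //.
have -> : psi (sample_pt s) = pcomp psi1 psi2 (sample_pt s).
  by case: s Ys => i [] /= Ys; rewrite /sample_pt /=; case: (H _ Ys).
rewrite /pcomp; case E2: (psi2 _) => [y|//] /=.
case: pselect => [e|ne] /=; rewrite /sample_action.
  by case: pselect => // _; rewrite e.
have ys : y = sample_pt (s.1, ~~ s.2).
  by rewrite sample_ptN; case: (sample_value r2 Ys E2).
case: pselect => // Ys'; rewrite -ys; case E1: (psi1 y) => [z|//].
have E1' : psi1 (sample_pt (s.1, ~~ s.2)) = Some z by rewrite -ys.
have := sample_value r1 Ys' E1'; rewrite -ys => zy.
have ty : tau y = sample_pt s by rewrite ys sample_ptN tauK.
rewrite ty in zy; case: pselect => zs; case: pselect => zy' //=.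
- by exfalso; apply: ne; rewrite -zy'.
- by rewrite negbK; case: s {Ys E2 ne ys Ys' E1' zy ty zs}.
- by case: zy.
Qed.

Lemma sample_action_fix psi s :
  sample_action psi s = Some s <-> Y (x s.1) /\ psi (sample_pt s) = Some (sample_pt s).
Proof.
rewrite /sample_action; case: pselect => Ys; last by split=> // -[].
case: (psi _) => [y|]; last by split=> // -[].
case: pselect => e; first by rewrite e; split.
split=> [[/esym]|[_ [/e]]//].
by case: s {Ys e} => i [].
Qed.

End SampleAction.

(** * Copies of finitely many partial isomorphisms *)

Section LimitModels.
Context {R : realType} {d : measure_display} {X : measurableType d}.
Variables (cd : coding X) (E : cber X) (mu : probability X R).
Hypothesis E_mp : measure_preserving E mu.
Variables (W : Type) (dl : set W -> R) (sg : baut E -> W -> W).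
Hypotheses (dl_ge0 : forall A, 0 <= dl A)
  (dlU : forall A B, A `&` B = set0 -> dl (A `|` B) = dl A + dl B)
  (dl_sg : forall g A, dl (sg g @^-1` A) = dl A)
  (sg_inj : forall g, injective (sg g))
  (sgM : forall g h, dl [set w | sg (baut_comp g h) w <> sg g (sg h w)] = 0)
  (sg_dist : forall g h, dl [set w | sg g w <> sg h w] = pr mu [set x | g x <> h x]).
Variable td : type_decomposition E mu.
Notation Y := (small_part td).

Let mY : measurable Y. Proof. exact: measurable_small_part. Qed.

Lemma plocal_fullB (phi : fullB E) : plocal E phi.
Proof.
split; first exact: fullB_measurable.
have [g gP] := fullB_local cd phi; exists g => x y xy.
have [|n] := gP x; first by rewrite /pdom /= xy.
by rewrite xy => -[->]; exists n.
Qed.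

Lemma plocal_comp psi1 psi2 : plocal E psi1 -> plocal E psi2 -> plocal E (pcomp psi1 psi2).
Proof.
move=> [m1 [g1 P1]] [m2 [g2 P2]]; split; first exact: pmeasurable_comp.
exists (fun n => if unpickle n is Some (i, j) then baut_comp (g1 i) (g2 j) else baut_id E).
move=> x z; rewrite /pcomp; case E2: (psi2 x) => [y|//] /= E1.
have [j yj] := P2 _ _ E2; have [i zi] := P1 _ _ E1.
by exists (pickle (i, j)); rewrite pickleK /= zi yj.
Qed.

Definition cut (phi : X -> option X) (D : set X) (x : X) : option X :=
  if pselect (D x) is left _ then phi x else None.

Lemma cutP phi D x y : cut phi D x = Some y <-> D x /\ phi x = Some y.
Proof. by rewrite /cut; case: pselect => Dx; split=> // -[]. Qed.

Lemma plocal_cut phi D : plocal E phi -> measurable D -> plocal E (cut phi D).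
Proof.
move=> [m [g gP]] mD; split; last by exists g => x y /cutP[_ /gP].
move=> B mB; rewrite (_ : ppreimage _ _ = D `&` ppreimage phi B).
  by apply: measurableI => //; exact: m.
apply/seteqP; split=> [x [y By /cutP[Dx xy]]|x [Dx [y By xy]]].
  by split=> //; exists y.
by exists y => //; apply/cutP.
Qed.

(** Finitely many charts exhaust the domain of [phi] off the small part, up to a set of
    small measure. *)
Lemma truncated_charts (phi : fullB E) (e : R) : 0 < e ->
  exists (c : nat -> chart E) (J : nat),
  [/\ forall i j x, cdom (c i) x -> cdom (c j) x -> i = j,
      forall i x, cdom (c i) x -> ~ Y x /\ phi x = Some (cmap (c i) x) &
      pr mu ((pdom phi `\` Y) `\` region c J) < e].
Proof.
move=> e0; have [c [c1 c2 c3]] := large_part_charts td phi.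
have mc n : measurable (cdom (c n)) by have [[]] := chartP (c n).
have [J small] := pr_small mu mc e0.
exists c, J; split=> //.
have mU : measurable (\bigcup_i cdom (c i)) by exact: bigcup_measurable.
have mr : measurable (region c J) by exact: measurable_region.
have mdY : measurable (pdom phi `\` Y) by apply: measurableD => //; exact: fullB_mdom.
have m1 : measurable ((pdom phi `\` Y) `\` \bigcup_i cdom (c i)) by exact: measurableD.
have m2 : measurable (\bigcup_i cdom (c i) `\` region c J) by exact: measurableD.
apply: le_lt_trans small; rewrite -[leRHS]add0r -c3.
apply: le_trans (prU_le mu m1 m2); apply: le_pr; [exact: measurableD|exact: measurableU|].
by move=> x [dx nr]; case: (pselect ((\bigcup_i cdom (c i)) x)); [right|left].
Qed.

(** The copies of the [phi a] are restricted, on the side of the domain and of the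
    range, to the copy [Reg] of a region that exhausts most of the large part, which
    is the domain of a truncation of the identity. Restricting in this way keeps [G a]
    inside [Reg], where the finite models will be glued. *)
Lemma limit_models (r : nat) (phi : 'I_r -> fullB E) (e : R) : 0 < e ->
  exists (Reg : set W) (G : 'I_r -> W -> option W),
  [/\ forall a, pinjective (G a) /\ (forall w v, G a w = Some v ->
        [/\ Reg w, Reg v & exists g, v = sg g w]),
      `|dl Reg - (1 - pr mu Y)| <= e,
      forall a, `|dl ([set w | G a w = Some w] `&` Reg) - pr mu (pfix (phi a) `\` Y)| <= 3 * e &
      forall a b c, d_mu mu (phi c) (fullB_comp (phi a) (phi b)) = 0 ->
        dl ([set w | G c w <> pcomp (G a) (G b) w] `&` Reg) <= 6 * e].
Proof.
move=> e0.
have [ci [Ji [ci1 ci2 ci3]]] := truncated_charts (fullB_id E) e0.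
pose Xg := region ci Ji; pose Reg := Region sg ci Ji.
have mXg : measurable Xg by exact: measurable_region.
have XgY x : Xg x -> ~ Y x by move=> [j _ /ci2[]].
have mYg : measurable (~` Y `\` Xg) by apply: measurableD => //; exact: measurableC.
have Xg_small : pr mu (~` Y `\` Xg) <= e.
  apply: ltW; apply: le_lt_trans ci3; apply: le_pr => //.
    by apply: measurableD => //; apply: measurableD => //; exact: fullB_mdom.
  by move=> x [nY nX]; split.
have /choice[cJ cJP] : forall a, exists cJ : (nat -> chart E) * nat,
  [/\ forall i j x, cdom (cJ.1 i) x -> cdom (cJ.1 j) x -> i = j,
      forall i x, cdom (cJ.1 i) x -> ~ Y x /\ phi a x = Some (cmap (cJ.1 i) x) &
      pr mu ((pdom (phi a) `\` Y) `\` region cJ.1 cJ.2) < e].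
  by move=> a; have [c [J cP]] := truncated_charts (phi a) e0; exists (c, J).
have /choice[N NP] : forall a, exists N, [/\ measurable N, pr mu N = 0 &
    forall x y, ~ N x -> phi a x = Some y ->
      (Y x -> y = x \/ y = partner td x) /\ (Y y -> Y x)].
  by move=> a; exact: small_part_values.
pose D a := region (cJ a).1 (cJ a).2.
have mD a : measurable (D a) by exact: measurable_region.
pose psi a := cut (phi a) (D a).
pose G0 a := chart_map sg (cJ a).1 (cJ a).2.
pose G a := Wrestrict sg ci Ji (G0 a).
pose psir a := Xrestrict ci Ji (psi a).
have lpsi a : plocal E (psi a) by apply: plocal_cut => //; exact: plocal_fullB.
have lpsir a : plocal E (psir a) by exact: plocal_restrict.
have M0 a : models dl sg (psi a) (G0 a).
  have [c1 c2 _] := cJP a.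
  apply: (chart_map_models cd E_mp dl_ge0 dlU dl_sg sg_inj sgM sg_dist c1).
  - move=> i j x y Dx Dy e1; have [_ px] := c2 _ _ Dx; have [_ py] := c2 _ _ Dy.
    have xy : x = y by apply: (pbij_inj px); rewrite py e1.
    by apply: (c1 _ _ x Dx); rewrite xy.
  - by move=> j x jJ Dx; apply/cutP; split; [exists j|case: (c2 _ _ Dx)].
  - by move=> x; rewrite /psi /cut; case: pselect => // -[j jJ Dx] _; exists j.
have M a : models dl sg (psir a) (G a).
  exact: (models_restrict cd E_mp dl_ge0 dlU dl_sg sg_inj sgM sg_dist ci Ji (lpsi a) (M0 a)).
have psir_phi a x y : psir a x = Some y -> [/\ Xg x, phi a x = Some y & Xg y].
  by move=> /XrestrictP[? /cutP[_ ?] ?].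
pose bad a := Xg `&` [set x | psir a x <> phi a x].
have mbad a : measurable (bad a).
  apply: measurableI => //; apply: (measurable_neqmap cd); first exact: (lpsir a).1.
  exact: fullB_measurable.
have bad_small a : pr mu (bad a) <= 2 * e.
  have [mN N0 NE] := NP a; have [_ _ small] := cJP a.
  pose B1 := (pdom (phi a) `\` Y) `\` D a.
  pose B3 := ppreimage (phi a) (~` Y `\` Xg).
  have m1 : measurable B1.
    by apply: measurableD => //; apply: measurableD => //; exact: fullB_mdom.
  have m3 : measurable B3 by exact: fullB_measurable.
  have p3 : pr mu B3 <= e by apply: le_trans Xg_small; exact: pr_ppreimage_le.
  have p2 := prU_le mu m1 mN.
  have m12 : measurable (B1 `|` N a) by exact: measurableU.
  have p123 := prU_le mu m12 m3.
  apply: (@le_trans _ _ (pr mu ((B1 `|` N a) `|` B3))); last first.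
    by move: small p2 p123 p3; rewrite -/(D a) -/B1 N0; lra.
  apply: le_pr => //; first exact: measurableU.
  move=> x [Xx /= nx]; case E0: (phi a x) => [y|]; last first.
    exfalso; apply: nx; rewrite E0; case E1: (psir a x) => [y|//].
    by have [_ + _] := psir_phi _ _ _ E1; rewrite E0.
  case: (pselect (D a x)) => Dx; last first.
    by left; left; split=> //; split; [rewrite /pdom /= E0|exact: XgY].
  case: (pselect (N a x)) => Nx; first by left; right.
  right; exists y => //; have [_ Yyx] := NE x y Nx E0.
  split; first by move=> /Yyx; exact: XgY.
  move=> Xy; apply: nx; rewrite E0; apply/XrestrictP; split=> //.
  exact/cutP.
exists Reg, G; split.
- move=> a; split.
    have inj0 : pinjective (G0 a).
      by apply: chart_map_inj => //.
    move=> w w' v /WrestrictP[_ h1 _] /WrestrictP[_ h2 _]; exact: inj0 h1 h2.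
  move=> w v /WrestrictP[h1 h2 h3]; split=> //.
  move: h2; rewrite /G0 /chart_map; case: pselect => // _ [<-].
  by eexists.
- rewrite (dl_region cd E_mp dl_ge0 dlU dl_sg sg_inj sgM sg_dist Ji ci1) -/Xg -prC //.
  have := prID mu (measurableC mY) mXg; rewrite (_ : ~` Y `&` Xg = Xg).
    by move=> ->; rewrite opprD addNKr normrN ger0_norm // pr_ge0.
  by apply/seteqP; split=> [x []//|x Xx]; split=> //; exact: XgY.
- move=> a; rewrite (models_fix cd E_mp dl_ge0 dlU dl_sg sg_inj sgM sg_dist Ji ci1 (M a) (lpsir a)).
  rewrite -/Xg.
  have mf : measurable (pfix (phi a)) by exact: (measurable_pfix cd).
  have mfr : measurable (pfix (psir a)).
    exact: (measurable_eq_baut cd (baut_id E) (lpsir a).1).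
  have mA : measurable (Xg `&` pfix (psir a)) by exact: measurableI.
  have mB : measurable (pfix (phi a) `\` Y) by exact: measurableD.
  have AB : Xg `&` pfix (psir a) `<=` pfix (phi a) `\` Y.
    by move=> x [Xx /psir_phi[_ h _]]; split=> //; exact: XgY.
  have le1 := le_pr mu mA mB AB.
  have mbY : measurable (bad a `|` (~` Y `\` Xg)) by exact: measurableU.
  have le2 : pr mu (pfix (phi a) `\` Y) <=
      pr mu (Xg `&` pfix (psir a)) + (pr mu (bad a) + pr mu (~` Y `\` Xg)).
    apply: le_trans (lerD (lexx _) (prU_le mu (mbad a) mYg)).
    apply: le_trans (prU_le mu mA mbY); apply: le_pr => //; first exact: measurableU.
    move=> x [fx nY]; case: (pselect (Xg x)) => Xx; last by right; right.
    case: (pselect (psir a x = phi a x)) => e1; last by right; left.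
    by left; split=> //; rewrite /pfix /= e1.
  rewrite ler_norml; have := bad_small a; lra.
- move=> a b c; rewrite (d_muE cd) => rel.
  have MC := models_comp cd E_mp dl_ge0 dlU dl_sg sg_inj sgM sg_dist (M a) (M b) (lpsir b).
  have lC := plocal_comp (lpsir a) (lpsir b).
  apply: le_trans (models_diff cd E_mp dl_ge0 dlU dl_sg sg_inj sgM sg_dist Ji ci1
    (M c) MC (lpsir c) lC) _.
  rewrite -/Xg.
  pose Nr := [set x | phi c x <> fullB_comp (phi a) (phi b) x].
  have mNr : measurable Nr by exact: measurable_fullB_neq.
  pose B4 := ppreimage (phi b) (bad a).
  have m4 : measurable B4 by exact: fullB_measurable.
  have p4 : pr mu B4 <= pr mu (bad a) by exact: pr_ppreimage_le.
  have m12 : measurable (bad c `|` Nr) by exact: measurableU.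
  have m34 : measurable (bad b `|` B4) by exact: measurableU.
  have q1 := prU_le mu (mbad c) mNr; have q2 := prU_le mu (mbad b) m4.
  have q3 := prU_le mu m12 m34.
  apply: (@le_trans _ _ (pr mu ((bad c `|` Nr) `|` (bad b `|` B4)))).
    apply: le_pr; [|exact: measurableU|].
      apply: measurableI => //; apply: (measurable_neqmap cd); first exact: (lpsir c).1.
      exact: lC.1.
    move=> x [Xx /= nx]; apply: contrapT => /not_orP[/not_orP[nc nN] /not_orP[nb n4]].
    have ec : psir c x = phi c x by apply: contrapT => h; apply: nc.
    have eb : psir b x = phi b x by apply: contrapT => h; apply: nb.
    have er : phi c x = pcomp (phi a) (phi b) x by apply: contrapT => h; apply: nN.
    apply: nx; rewrite ec er /pcomp eb; case E0: (phi b x) => [y|//] /=.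
    have Xy : Xg y by move: eb; rewrite E0 => /psir_phi[].
    apply: contrapT => h; apply: n4; exists y => //; split=> // e1; apply: h.
    by rewrite -e1.
  have := bad_small a; have := bad_small b; have := bad_small c.
  have rel0 : pr mu Nr = 0 := rel.
  rewrite rel0 in q1; lra.
Qed.

End LimitModels.

(** * From an ultraproduct to finite models *)

(** An isometric homomorphism [theta] makes the disjoint union of the finite sets
    ['I_(n k)] such a space, with the limit of the normalized counting measures. *)
Section LimitSpace.
Context {R : realType} {d : measure_display} {X : measurableType d}.
Variables (cd : coding X) (E : cber X) (mu : probability X R).
Hypothesis E_mp : measure_preserving E mu.
Variables (U : set_system nat) (n : nat -> nat)
  (theta : full_semigroup E mu -> ultraproduct R U n).
Hypotheses (UU : UltraFilter U) (n0 : forall k, (0 < n k)%N).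
Hypothesis thetaM : forall x y, full_group x -> full_group y ->
  theta (fs_mul x y) = up_mul (theta x) (theta y).
Hypothesis theta_dist : forall x y, full_group x -> full_group y ->
  Defs.mdist (theta x) (theta y) = Defs.mdist x y.

Definition points : Type := {k : nat & 'I_(n k)}.

Definition fiber (A : set points) k : set 'I_(n k) := [set m | A (existT _ k m)].

Arguments fiber A k : clear implicits.

(** Limits along an ultrafilter are additive, but not countably so. *)
Definition density (A : set points) : R := lim ((fun k => mu_sharp R (fiber A k)) @ U).

Definition act (g : baut E) (w : points) : points :=
  existT _ (projT1 w) (mrepr (theta (cl mu g)) (projT1 w) (projT2 w)).

Lemma fiber01 A k : 0 <= mu_sharp R (fiber A k) <= 1.
Proof. by rewrite ms_ge0 /= -(@msT R (n k) (n0 k)); exact: ms_le. Qed.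

Lemma density_ge0 A : 0 <= density A.
Proof.
rewrite -(ulim_cst UU 0); apply: ulim_le => k; rewrite ?fiber01 ?lexx ?ler01 //.
exact: ms_ge0.
Qed.

Lemma densityU A B : A `&` B = set0 -> density (A `|` B) = density A + density B.
Proof.
move=> AB; rewrite /density -(ulim_D UU); [|exact: fiber01|exact: fiber01].
congr (lim (_ @ U)); apply/funext => k; rewrite -msU //.
apply/seteqP; split=> m // [Am Bm].
by have : (A `&` B) (existT _ k m) by []; rewrite AB.
Qed.

Lemma density_act g A : density (act g @^-1` A) = density A.
Proof.
congr (lim (_ @ U)); apply/funext => k.
by rewrite -[RHS](ms_perm R (mrepr (theta (cl mu g)) k)).
Qed.

Lemma act_inj g : injective (act g).
Proof.
move=> [k m] [l m'] /= e; have /= kl : k = l := congr1 (@projT1 _ _) e.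
subst l.
by congr existT; exact: perm_inj (existT_inj2 e).
Qed.

Lemma act_eqP g h w : act g w = act h w <->
  mrepr (theta (cl mu g)) (projT1 w) (projT2 w) = mrepr (theta (cl mu h)) (projT1 w) (projT2 w).
Proof.
by split=> e; [exact: existT_inj2 e|rewrite /act e].
Qed.

Let cl_full (g : baut E) : full_group (cl mu g).
Proof. by apply/(full_group_cl cd); exists g. Qed.

Lemma act_dist (g h : baut E) : density [set w | act g w <> act h w] = pr mu [set x | g x <> h x].
Proof.
rewrite -(mdist_cl cd mu) -theta_dist ?cl_full // /Defs.mdist d_ultraE.
congr (lim (_ @ U)); apply/funext => k; rewrite dpermE; congr mu_sharp.
apply/seteqP; split=> m /= h1 h2; apply: h1.
  exact: (act_eqP g h (existT _ k m)).2.
exact: (act_eqP g h (existT _ k m)).1.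
Qed.

Lemma actM (g h : baut E) : density [set w | act (baut_comp g h) w <> act g (act h w)] = 0.
Proof.
have <- : d_ultra R U (mrepr (theta (cl mu (baut_comp g h))))
    (fun k => mrepr (theta (cl mu h)) k * mrepr (theta (cl mu g)) k)%g = 0.
  rewrite -(cl_mul cd E_mp) thetaM ?cl_full //.
  exact: (mrepr_mclass (@d_ultra0 R U UU n)).
rewrite d_ultraE; congr (lim (_ @ U)); apply/funext => k; rewrite dpermE; congr mu_sharp.
apply/seteqP; split=> m /= h1 h2; apply: h1; rewrite /act /=.
  by rewrite h2 permM.
by rewrite permM; exact: existT_inj2 h2.
Qed.

(** The partial maps of [points] preserve the fibres. *)
Definition fiber_map (F : points -> option points) k (m : 'I_(n k)) : option 'I_(n k) :=
  [pick m' : 'I_(n k) | `[< F (existT _ k m) = Some (existT _ k m') >]].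

Lemma fiber_mapP F k (m m' : 'I_(n k)) :
  fiber_map F m = Some m' <-> F (existT _ k m) = Some (existT _ k m').
Proof.
rewrite /fiber_map; case: pickP => [u /asboolP Fu|none]; split.
- by case=> <-.
- by rewrite Fu => -[e]; rewrite (existT_inj2 e).
- by [].
- by move=> Fm; have := none m' => /asboolP.
Qed.

Lemma fiber_map_None F k (m : 'I_(n k)) :
  (forall w v, F w = Some v -> projT1 v = projT1 w) ->
  fiber_map F m = None -> F (existT _ k m) = None.
Proof.
move=> tagF FN; case E0: (F _) => [[l m']|//].
have /= lk := tagF _ _ E0; subst l.
by have /fiber_mapP := E0; rewrite FN.
Qed.

Lemma eq_fiber_map F F' k (m : 'I_(n k)) : F (existT _ k m) = F' (existT _ k m) ->
  fiber_map F m = fiber_map F' m.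
Proof. by move=> e; apply: eq_pick => m'; rewrite e. Qed.

Lemma fiber_map_comp F F' k (m : 'I_(n k)) :
  (forall w v, F' w = Some v -> projT1 v = projT1 w) ->
  fiber_map (pcomp F F') m = pcomp (fiber_map F (k := k)) (fiber_map F' (k := k)) m.
Proof.
move=> tagF; rewrite [RHS]/pcomp; case E0: (fiber_map F' m) => [m'|] /=.
  by move/fiber_mapP: E0 => E0; apply: eq_pick => u; rewrite /pcomp E0.
have E1 := fiber_map_None tagF E0; rewrite /fiber_map; case: pickP => // u /asboolP.
by rewrite /pcomp E1.
Qed.

Lemma card_pair_bool (I : finType) (P : pred (I * bool)) :
  #|[pred s | P s]| = (#|[pred i | P (i, false)]| + #|[pred i | P (i, true)]|)%N.
Proof.
have <- : (#|[predX [pred i | P (i, false)] & pred1 false]| = #|[pred i | P (i, false)]|)%N.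
  by rewrite cardX card1 muln1.
have <- : (#|[predX [pred i | P (i, true)] & pred1 true]| = #|[pred i | P (i, true)]|)%N.
  by rewrite cardX card1 muln1.
rewrite -cardUI [X in (_ = _ + X)%N]eq_card0 ?addn0.
  by apply: eq_card => -[i []]; rewrite !inE /= ?andbT ?andbF ?orbF.
by move=> [i []]; rewrite !inE /= !andbF.
Qed.

Lemma fiber_near (T : finType) (A : T -> set points) (e : R) : 0 < e ->
  exists k, forall t, `|mu_sharp R (fiber (A t) k) - density (A t)| <= e.
Proof.
move=> e0.
have H : forall t, \forall k \near U, `|mu_sharp R (fiber (A t) k) - density (A t)| <= e.
  move=> t.
  have c := ulim_cvg UU (fiber01 (A t)).
  have /cvgrPdist_le /(_ _ e0) := c.
  by apply: filterS => k; rewrite distrC.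
have : \forall k \near U, forall t, `|mu_sharp R (fiber (A t) k) - density (A t)| <= e.
  by apply: filter_forall; exact: H.
by move=> /filter_ex[k kP]; exists k.
Qed.

(** A fibre of the ultraproduct is multiplied by a finite sample of the small part.
    The copies of [phi a] act on the fibre over [Reg], whose density is close to the
    measure of the large part, and the sample actions are used elsewhere. Since both
    kinds of maps preserve membership in [Reg], composition can be checked separately;
    for the sample it is exact, because the sample is taken off a null set that
    contains all exceptions. *)
Lemma finite_models (td : type_decomposition E mu) (r : nat) (phi : 'I_r -> fullB E) (e : R) :
  0 < e -> exists (N : nat) (pi : 'I_r -> pbij 'I_N),
  [/\ (0 < N)%N,
      forall a, `|pr mu (pfix (phi a)) - mu_sharp R (pfix (pi a))| <= e &
      forall a b c, d_mu mu (phi c) (fullB_comp (phi a) (phi b)) = 0 ->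
        d_sharp R (pi c) (pbij_comp (pi a) (pi b)) <= e].
Proof.
(* the errors below add up to at most [7 * h] *)
move=> e0; pose h : R := e / 7; have h0 : 0 < h by rewrite /h; lra.
pose Y := small_part td; pose tau := partner td.
have mY : measurable Y by exact: measurable_small_part.
have [Reg [G [GP RegE Gfix Gmul]]] := limit_models cd E_mp density_ge0 densityU density_act
  act_inj actM act_dist td phi h0.
have G_inj a : pinjective (G a) by case: (GP a).
have GR a w v : G a w = Some v -> [/\ Reg w, Reg v & exists g, v = act g w].
  by case: (GP a) => _; apply.
have Gtag a w v : G a w = Some v -> projT1 v = projT1 w by move=> /GR[_ _ [g ->]].
(* almost everywhere relations are made to hold at every point of the sampled set *)
have /choice[N NP] : forall a, exists N, [/\ measurable N, pr mu N = 0 &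
    forall x y, ~ N x -> phi a x = Some y ->
      (Y x -> y = x \/ y = tau x) /\ (Y y -> Y x)].
  by move=> a; exact: small_part_values.
pose relb (t : 'I_r * 'I_r * 'I_r) :=
  `[< d_mu mu (phi t.2) (fullB_comp (phi t.1.1) (phi t.1.2)) = 0 >].
pose Nrel t := if relb t then
  [set x | phi t.2 x <> fullB_comp (phi t.1.1) (phi t.1.2) x] else set0.
pose N1 i := if (insub i : option 'I_r) is Some a then N a else set0.
pose N2 i := if @unpickle ('I_r * 'I_r * 'I_r)%type i is Some t then Nrel t else set0.
have mN1 i : measurable (N1 i) by rewrite /N1; case: insub => // a; case: (NP a).
have mN2 i : measurable (N2 i).
  rewrite /N2 /Nrel; case: unpickle => // t; case: ifP => // _.
  exact: (measurable_fullB_neq cd).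
pose Nall := \bigcup_i N1 i `|` \bigcup_i N2 i.
have mU1 : measurable (\bigcup_i N1 i) by exact: bigcup_measurable.
have mU2 : measurable (\bigcup_i N2 i) by exact: bigcup_measurable.
have mNall : measurable Nall by exact: measurableU.
have Nall0 : pr mu Nall = 0.
  apply/eqP; rewrite eq_le pr_ge0 andbT; apply: le_trans (prU_le mu mU1 mU2) _.
  rewrite !pr_bigcup0 ?addr0 // => i.
    by rewrite /N1; case: insub => [a|]; [case: (NP a)|exact: pr0].
  rewrite /N2 /Nrel; case: unpickle => [t|]; last exact: pr0.
  case: ifP => [/asboolP|_]; last exact: pr0.
  by rewrite (d_muE cd).
pose Ns := Nall `|` tau @^-1` Nall.
have mtN : measurable (tau @^-1` Nall) by exact: measurable_afun.
have mNs : measurable Ns by exact: measurableU.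
have Ns0 : pr mu Ns = 0.
  apply/eqP; rewrite eq_le pr_ge0 andbT; apply: le_trans (prU_le mu mNall mtN) _.
  by rewrite (pr_baut E_mp) // Nall0 addr0.
pose Y0 := Y `\` Ns.
have mY0 : measurable Y0 by exact: measurableD.
have prY0 A : measurable A -> pr mu (Y0 `&` A) = pr mu (Y `&` A).
  move=> mA; have mYA : measurable (Y `&` A) by exact: measurableI.
  have z0 : pr mu (Y `&` A `&` Ns) = 0.
    by apply: pr_sub0 (measurableI _ _ mYA mNs) mNs _ Ns0; exact: subIsetr.
  by rewrite [RHS](prID mu mYA mNs) z0 add0r /Y0 setIDAC setIDA.
have resp a : respects Y0 tau (phi a).
  have [_ _ NE] := NP a.
  have nN x : ~ Nall x -> ~ N a x.
    by move=> nN Nx; apply: nN; left; exists (nat_of_ord a) => //; rewrite /N1 valK.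
  move=> y z [Yy /not_orP[n1 n2]]; split=> E1.
    by have [/(_ Yy)] := NE _ _ (nN _ n1) E1.
  have [+ _] := NE _ _ (nN _ n2) E1; rewrite /tau partnerK; apply.
  exact: small_part_partner.
have relE a b c : d_mu mu (phi c) (fullB_comp (phi a) (phi b)) = 0 ->
    forall y, Y0 y -> phi c y = pcomp (phi a) (phi b) y /\
      phi c (tau y) = pcomp (phi a) (phi b) (tau y).
  move=> rel.
  have nN x : ~ Nall x -> phi c x = pcomp (phi a) (phi b) x.
    move=> nN; apply: contrapT => ne; apply: nN; right; exists (pickle (a, b, c)) => //.
    by rewrite /N2 pickleK /Nrel /relb /= asboolT.
  by move=> y [Yy /not_orP[n1 n2]]; split; exact: nN.
have mfix a : measurable (pfix (phi a)) by exact: (measurable_pfix cd).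
pose F (t : 'I_r * bool) := if t.2 then tau @^-1` pfix (phi t.1) else pfix (phi t.1).
have mF t : measurable (F t).
  by rewrite /F; case: ifP => _; [apply: measurable_afun|]; exact: mfix.
have [I [x [I0 xP]]] := sampling mu mY0 mF h0.
pose H a := sample_action x Y0 tau (phi a).
have H_inj a : pinjective (H a).
  by apply: pinj_sample_action (@partnerK _ _ _ _ _ td) _ _ _ => //; exact: pbij_inj.
(* a single fibre is chosen for all the sets whose density matters *)
pose A (t : option ('I_r + 'I_r * 'I_r * 'I_r)) : set points := match t with
  | None => Reg
  | Some (inl a) => [set w | G a w = Some w] `&` Reg
  | Some (inr (a, b, c)) => [set w | G c w <> pcomp (G a) (G b) w] `&` Reg end.
have [k kP] := fiber_near A h0.
pose reg : {pred 'I_(n k)} := fun m => `[< Reg (existT _ k m) >].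
pose Gk a : 'I_(n k) -> option 'I_(n k) := fiber_map (G a) (k := k).
have Gk_inj a : pinjective (Gk a).
  move=> m m' v /fiber_mapP h1 /fiber_mapP h2; exact: existT_inj2 (G_inj _ _ _ _ h1 h2).
have GkR a m v : Gk a m = Some v -> v \in reg.
  by move=> /fiber_mapP /GR[_ hv _]; apply/asboolP.
have splice_inj a : pinjective (splice reg (Gk a) (H a)).
  by apply: pinj_splice => //; exact: GkR.
exists #|{: 'I_(n k) * (I * bool)}|, (fun a => PBij (pinj_transport (@splice_inj a))).
have cM : #|{: 'I_(n k)}| = n k by rewrite card_ord.
have cS : #|{: I * bool}| = (#|I| * 2)%N by rewrite card_prod card_bool.
have nk0 : 0 < (n k)%:R :> R by rewrite ltr0n.
have I0r : 0 < #|I|%:R :> R by rewrite ltr0n.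
have S0 : 0 < #|{: I * bool}|%:R :> R by rewrite ltr0n cS muln_gt0 I0.
have cT : #|{: 'I_(n k) * (I * bool)}|%:R = (n k)%:R * #|{: I * bool}|%:R :> R.
  by rewrite card_prod cM natrM.
split.
- by rewrite -(ltr0n R) cT mulr_gt0.
- move=> a; rewrite /= fix_transport cT splice_fix natrD !natrM.
  set c1 := #|_|; set c2 := #|_|; set c3 := #|_|.
  set s2 := #|{: I * bool}|%:R in S0 *.
  have e1 : c1%:R = (n k)%:R * mu_sharp R (fiber (A (Some (inl a))) k) :> R.
    rewrite /mu_sharp mulrC divfK ?gt_eqF //; congr (_%:R); apply: eq_card => m.
    rewrite -[RHS]/(m \in fiber (A (Some (inl a))) k) inE.
    apply/andP/idP => [[/asboolP mr /eqP /fiber_mapP gm]|/set_mem[gm mr]].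
      by apply: mem_set; split.
    by split; [apply/asboolP|apply/eqP/fiber_mapP].
  have e2 : c2%:R = (n k)%:R * (1 - mu_sharp R (fiber (A None) k)) :> R.
    have : (c2 + #|[pred m | m \in fiber (A None) k]|)%N = n k.
      by rewrite -[RHS]cM -(cardC reg) addnC; congr (_ + _)%N.
    move/(congr1 (fun z => z%:R : R)); rewrite natrD => e3.
    rewrite /mu_sharp mulrBr mulr1 mulrCA divff ?gt_eqF // mulr1 -e3.
    by rewrite addrK.
  pose f b := #|[pred i | x i \in Y0 `&` F (a, b)]|%:R / #|I|%:R : R.
  have f01 b : 0 <= f b <= 1.
    rewrite /f divr_ge0 //= ler_pdivrMr // mul1r ler_nat; exact: max_card.
  have e3 : c3%:R = s2 * ((f false + f true) / 2) :> R.
    have -> : c3 = (#|[pred i | x i \in Y0 `&` F (a, false)]| +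
        #|[pred i | x i \in Y0 `&` F (a, true)]|)%N.
      rewrite /c3 (card_pair_bool (fun s => H a s == Some s)).
      have fx b i : (H a (i, b) == Some (i, b)) = (x i \in Y0 `&` F (a, b)).
        apply/eqP/idP => [/sample_action_fix[h1 h2]|/set_mem[h1 h2]].
          by apply: mem_set; split=> //; move: h2; case: (b).
        by apply/sample_action_fix; split=> //; move: h2; case: (b).
      by congr (_ + _)%N; apply: eq_card => i; rewrite !inE fx.
    rewrite /s2 cS natrM natrD /f; field; rewrite gt_eqF //.
  set u := mu_sharp _ _ in e1; set p := mu_sharp _ _ in e2.
  have -> : (c1%:R * s2 + c2%:R * c3%:R) / ((n k)%:R * s2) =
      u + (1 - p) * ((f false + f true) / 2).
    by rewrite e1 e2 e3; field; rewrite !gt_eqF.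
  have ku := kP (Some (inl a)); have kp := kP None; rewrite -/u -/p in ku kp.
  have ga := Gfix a; rewrite -/Y in ga RegE.
  have PY : pr mu Y0 = pr mu Y by have := prY0 setT measurableT; rewrite !setIT.
  have x0 := xP (a, false); have x1 := xP (a, true).
  rewrite -/(f false) prY0 // PY in x0; rewrite -/(f true) prY0 // PY in x1.
  have Ft : pr mu (Y `&` F (a, true)) = pr mu (Y `&` pfix (phi a)).
    have mYf : measurable (Y `&` pfix (phi a)) by exact: measurableI.
    rewrite -[RHS](pr_baut E_mp tau) //; congr (pr mu _).
    apply/seteqP; split=> y [Yy fy]; split=> //; first exact: small_part_partner.
    by have := @small_part_partner _ _ _ _ _ td _ Yy; rewrite /= partnerK.
  rewrite Ft /= in x1; rewrite /F /= in x0.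
  have pf := prID mu (mfix a) mY; rewrite setIC in pf.
  have := f01 false; have := f01 true.
  move: x0 x1 ku kp ga RegE; rewrite /A /=.
  set P := pr mu Y in PY *; set D1 := density _; set D2 := density _.
  set Q1 := pr mu (Y `&` _) in pf *; set Q2 := pr mu (_ `\` Y) in pf *.
  set f0 := f false; set f1 := f true.
  rewrite !ler_norml => /andP[a1 a2] /andP[a3 a4] /andP[a5 a6] /andP[a7 a8] /andP[a9 a10]
    /andP[a11 a12] /andP[a13 a14] /andP[a15 a16].
  have b1 : (1 - p - P) * ((f0 + f1) / 2) <= 2 * h by nra.
  have b2 : - (2 * h) <= (1 - p - P) * ((f0 + f1) / 2) by nra.
  have b3 : (1 - p) * ((f0 + f1) / 2) = (1 - p - P) * ((f0 + f1) / 2) + (P * f0 + P * f1) / 2.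
    by field.
  rewrite pf b3; rewrite /h in a1 a2 a3 a4 a5 a6 a7 a8 a9 a10 a11 a12 b1 b2 *.
  apply/andP; split; lra.
- move=> a b c rel; rewrite d_sharpE.
  have Hc : H c = pcomp (H a) (H b).
    apply/funext => s; apply: sample_action_comp => //; first exact: partnerK.
    exact: relE.
  have -> : pbij_comp (PBij (pinj_transport (@splice_inj a))) (PBij (pinj_transport (@splice_inj b)))
      = transport (splice reg (pcomp (Gk a) (Gk b)) (H c)) :> (_ -> _).
    rewrite /= -transport_comp; congr transport; apply/funext => t.
    by rewrite splice_comp ?Hc //; exact: GkR.
  rewrite neq_transport splice_neq cT natrM.
  rewrite -mulf_div divff ?gt_eqF // mulr1.
  have le1 : #|[pred m | (m \in reg) && (Gk c m != pcomp (Gk a) (Gk b) m)]|%:R / (n k)%:R <=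
      mu_sharp R (fiber (A (Some (inr (a, b, c)))) k).
    rewrite /mu_sharp ler_pM2r ?invr_gt0 // ler_nat.
    apply/subset_leq_card/fintype.subsetP => m; rewrite !inE => /andP[/asboolP mr /eqP ne].
    split=> //= e1; apply: ne.
    by rewrite -fiber_map_comp; [exact: eq_fiber_map|exact: Gtag].
  apply: (le_trans le1).
  have := kP (Some (inr (a, b, c))); have := Gmul a b c rel; rewrite /A /=.
  set D1 := density _; set D2 := mu_sharp _ _; rewrite ler_norml /h => g1 /andP[_ g2].
  lra.
Qed.

End LimitSpace.

(** * Metric soficity implies soficity *)

Lemma finite_set_enum (T : Type) (L : set T) : finite_set L ->
  exists (r : nat) (g : 'I_r -> T), forall x, L x -> exists a, g a = x.
Proof.
move=> /finite_setP[r /card_set_bijP[f [fr fi fs]]].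
have /choice[g gP] : forall a : 'I_r, exists x, L x /\ f x = a.
  by move=> a; have [x Lx fx] := fs a (ltn_ord a); exists x.
exists r, g => x Lx; exists (Ordinal (fr x Lx)).
have [Lg fg] := gP (Ordinal (fr x Lx)).
by apply: fi; [exact: mem_set|exact: mem_set|].
Qed.

Section Repair.
Variables (R : realType) (N : nat).
Hypothesis N0 : (0 < N)%N.

Lemma pfix_le (p q : pbij 'I_N) :
  mu_sharp R (pfix p) <= mu_sharp R (pfix q) + d_sharp R p q.
Proof.
rewrite d_sharpE; apply: le_trans (msU_le _ _ _); apply: ms_le => x px.
by case: (pselect (p x = q x)) => e; [left; rewrite /pfix /= -e|right].
Qed.

Lemma d_sharp_id (p : pbij 'I_N) :
  d_sharp R p (pbij_id 'I_N) = 1 - mu_sharp R (pfix p).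
Proof.
rewrite d_sharpE -(@msT R N N0) (_ : setT = [set x | p x <> pbij_id 'I_N x] `|` pfix p).
  by rewrite msU ?addrK //; apply/seteqP; split=> x // [].
apply/seteqP; split=> x //= _.
by case: (pselect (p x = Some x)); [right|left].
Qed.

(** If [p x = y] and [p y = y] then [x = y] by injectivity. *)
Lemma d_sharp_empty (p : pbij 'I_N) :
  d_sharp R p (pbij_empty 'I_N) <= d_sharp R p (pbij_comp p p) + mu_sharp R (pfix p).
Proof.
rewrite !d_sharpE; apply: le_trans (msU_le _ _ _); apply: ms_le => x /=.
rewrite /pcomp /pfix /=; case px: (p x) => [y|//] _.
case: (pselect (p y = Some y)) => [py|npy]; [right|left] => //=.
  by rewrite (pbij_inj px py).
by move=> /esym.
Qed.

End Repair.

Section MetricToSofic.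
Context {R : realType} {d : measure_display} {X : measurableType d}.
Variables (cd : coding X) (E : cber X) (mu : probability X R).
Hypothesis E_mp : measure_preserving E mu.

Lemma fs_fix_id : fs_fix (fs_id E mu) = 1.
Proof. by rewrite /fs_id (fs_fixE cd) -(prT mu); congr (pr mu _); apply/seteqP; split. Qed.

Lemma fs_fix_empty : fs_fix (fs_empty E mu) = 0.
Proof. by rewrite /fs_empty (fs_fixE cd) -(pr0 mu); congr (pr mu _); apply/seteqP; split. Qed.

Lemma fs_empty_mul : fs_mul (fs_empty E mu) (fs_empty E mu) = fs_empty E mu.
Proof.
rewrite /fs_empty (fs_mulE cd E_mp).
apply: (mclass_eq (d_mu0 cd mu) (d_muC cd mu) (d_mu_tri cd mu)).
by rewrite (d_muE cd) (_ : mkset _ = set0) ?pr0 //; apply/seteqP; split.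
Qed.

(** The finite models need not send the identity to the identity, nor the empty map to
    the empty map. But the model of the identity fixes almost all points, and that of
    the empty map is close to its own square and fixes few points, so that changing
    these two values costs little. *)
Theorem metrically_sofic_sofic : metrically_sofic E mu -> sofic E mu.
Proof.
move=> [U [n [theta [[UU _] n0 thetaM theta_dist]]]] K eps finK eps0.
have [td] := type_decomposition_exists cd E_mp.
pose L := [set fs_id E mu; fs_empty E mu] `|` (K `|` [set fs_mul x y | x in K & y in K]).
have finL : finite_set L.
  rewrite !finite_setU; split; first by split; exact: finite_set1.
  by split=> //; exact: finite_image2.
have Lid : L (fs_id E mu) by left; left.
have Lem : L (fs_empty E mu) by left; right.
have LK x : K x -> L x by right; left.
have LM x y : K x -> K y -> L (fs_mul x y) by right; right; exists x => //; exists y.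
have [r [g gL]] := finite_set_enum finL.
(* in the first estimate, [e] for the model, [2 * e] for each of the three corrections:
   [7 * e < eps] *)
pose e := eps / 8; have e0 : 0 < e by rewrite /e; lra.
have [N [pi0 [N0 pi0_fix pi0_mul]]] :=
  finite_models cd E_mp UU n0 thetaM theta_dist td (fun a => mrepr (g a)) e0.
have /choice[p pP] : forall C, exists q, L C -> exists2 a, g a = C & pi0 a = q.
  move=> C; case: (pselect (L C)) => [/gL[a ga]|nL]; last by exists (pbij_id 'I_N).
  by exists (pi0 a) => _; exists a.
have p_fix C : L C -> `|fs_fix C - mu_sharp R (pfix (p C))| <= e.
  by move=> /pP[a <- <-]; exact: pi0_fix.
have p_mul x y : L x -> L y -> L (fs_mul x y) ->
    d_sharp R (p (fs_mul x y)) (pbij_comp (p x) (p y)) <= e.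
  move=> Lx Ly Lxy; have [a ga <-] := pP _ Lx; have [b gb <-] := pP _ Ly.
  have [c gc <-] := pP _ Lxy; apply: pi0_mul.
  by rewrite gc ga gb; exact: (mrepr_mclass (d_mu0 cd mu)).
pose q C := if pselect (C = fs_id E mu) then pbij_id 'I_N
  else if pselect (C = fs_empty E mu) then pbij_empty 'I_N else p C.
have q_id : q (fs_id E mu) = pbij_id 'I_N by rewrite /q; case: pselect.
have q_empty : q (fs_empty E mu) = pbij_empty 'I_N.
  have empty_id : fs_empty E mu <> fs_id E mu.
    move/(congr1 (fun C => fs_fix C)); rewrite fs_fix_id fs_fix_empty => /esym/eqP.
    by rewrite oner_eq0.
  by rewrite /q; case: pselect => // h; case: pselect.
have pq C : L C -> d_sharp R (p C) (q C) <= 2 * e.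
  move=> LC; case: (pselect (C = fs_id E mu)) => [->|Cid].
    by rewrite q_id d_sharp_id //; have := p_fix _ Lid; rewrite fs_fix_id ler_norml; lra.
  case: (pselect (C = fs_empty E mu)) => [->|Cempty].
    rewrite q_empty; apply: le_trans (d_sharp_empty _ _) _.
    have := p_fix _ Lem; have := p_mul _ _ Lem Lem; rewrite fs_empty_mul => /(_ Lem).
    by rewrite fs_fix_empty ler_norml; lra.
  rewrite (_ : q C = p C) ?d_sharp0; first lra.
  by rewrite /q; do 2![case: pselect => //].
exists N, q; split=> // [x y Kx Ky|x Kx].
  have [Lx Ly Lxy] := And3 (LK _ Kx) (LK _ Ky) (LM _ _ Kx Ky).
  have := p_mul _ _ Lx Ly Lxy; have := pq _ Lx; have := pq _ Ly; have := pq _ Lxy.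
  have := d_sharp_tri R (p (fs_mul x y)) (q (fs_mul x y)) (pbij_comp (q x) (q y)).
  have := d_sharp_tri R (pbij_comp (p x) (p y)) (p (fs_mul x y)) (pbij_comp (q x) (q y)).
  have := d_sharp_comp R (p x) (q x) (p y) (q y).
  by rewrite (d_sharpC _ (q (fs_mul x y)) (p _)) /e; lra.
have := p_fix _ (LK _ Kx); have := pq _ (LK _ Kx).
have := pfix_le R (p x) (q x); have := pfix_le R (q x) (p x).
by rewrite (d_sharpC _ (q x) (p x)) ler_norml ltr_norml /e => *; apply/andP; split; lra.
Qed.

End MetricToSofic.

Theorem theorem4p5 (R : realType) (d : measure_display) (X : measurableType d)
    (mu : probability X R) (E : cber X)
    (X_standard : standard_borel R X)
    (E_mp : measure_preserving E mu)
    (E_nosingleton : forall x y : X, [set z | E x z] <> [set y]) :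
  sofic E mu <-> metrically_sofic E mu.
Proof.
have [cd] := standard_borel_coding X_standard.
by split; [exact: sofic_metrically_sofic|exact: metrically_sofic_sofic].
Qed.
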